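(* Let $N\ge1$ and let $X=\{X(t), t\in\mathbb{S}^N\}$ be a centered, unit-variance, smooth isotropic Gaussian random field on the unit sphere $\mathbb{S}^N$ with covariance $\mathbb{E}\{X(t)X(s)\}=C(\langle t,s\rangle)$ and $C'C''\ne0$. Let $\widetilde{M}$ and $M$ be $N\times N$ random matrices that are $\mathrm{GOI}((1+\eta^2)/2)$ and $\mathrm{GOI}((1+\eta^2-\kappa^2)/2)$ respectively. Then for every $t\in\mathbb{S}^N$ and $x\in\mathbb{R}$: (i) the distribution of $\nabla^2X(t)$ is the same as that of $\sqrt{2C''}\,\widetilde{M}$; (ii) the conditional distribution of $\nabla^2X(t)$ given $X(t)=x$ is the same as the distribution of $\sqrt{2C''}\,\big[M-\big(\kappa x/\sqrt{2}\big)I_N\big]$.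
   Context: $\mathbb{S}^N\subset\mathbb{R}^{N+1}$ is the $N$-dimensional unit sphere and $\langle\cdot,\cdot\rangle$ the inner product of $\mathbb{R}^{N+1}$. Smoothness: $X$ has almost surely $C^2$ sample paths and, in local charts, there are finite $K,\alpha>0$ such that the second-order derivatives satisfy $\mathbb{E}[(X_{ij}(t)-X_{ij}(s))^2]\le K\,|\ln\|t-s\||^{-(1+\alpha)}$ for all $i,j$ and all $\|t-s\|$ small enough (this holds in particular if $X$ is $C^3$). Parameters: $C:[-1,1]\to\mathbb{R}$; $C'=C'(1)$, $C''=C''(1)$ (then $C'>0$, $C''>0$), $\eta=\sqrt{C'}/\sqrt{C''}$, $\kappa=C'/\sqrt{C''}$. Derivatives: for an orthonormal frame $\{E_i\}_{1\le i\le N}$ on $\mathbb{S}^N$, $X_{ij}=E_iE_jX$ (the frame at the point $t$ considered being such that $\nabla_{E_i}E_j=0$ at $t$) and $\nabla^2X(t)=(X_{ij}(t))_{1\le i,j\le N}$ is the matrix of the Riemannian Hessian in this frame. An $N\times N$ random matrix $M=(M_{ij})$ is $\mathrm{GOI}(c)$ (Gaussian Orthogonally Invariant with covariance parameter $c\in\mathbb{R}$) if it is symmetric and its entries are (jointly) centered Gaussian with $\mathbb{E}[M_{ij}M_{kl}]=\frac12(\delta_{ik}\delta_{jl}+\delta_{il}\delta_{jk})+c\,\delta_{ij}\delta_{kl}$, $\delta$ being the Kronecker delta. $I_N$ is the identity matrix. *)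

(* Defs.v *)
From HB Require Import structures.
From mathcomp Require Import all_boot all_order all_algebra.
From mathcomp Require Import all_classical all_reals all_analysis.

Set Implicit Arguments.
Unset Strict Implicit.
Unset Printing Implicit Defensive.

Import Order.TTheory GRing.Theory Num.Theory.
Import numFieldNormedType.Exports.

Local Open Scope classical_set_scope.
Local Open Scope ring_scope.

Definition dot (R : realType) (n : nat) (u v : 'rV[R]_n) : R :=
  \sum_(i < n) u 0 i * v 0 i.

Definition enorm (R : realType) (n : nat) (u : 'rV[R]_n) : R :=
  Num.sqrt (dot u u).

Definition sphere (R : realType) (n : nat) : set 'rV[R]_n :=
  [set t | dot t t = 1].

Definition normalize (R : realType) (n : nat) (u : 'rV[R]_n) : 'rV[R]_n :=
  (enorm u)^-1 *: u.

(* Differential at the point s of the sphere, applied to the tangent vector v,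
   of a function f of which only the values on the sphere matter: this is the
   derivative at 0 of f along the curve u |-> (s + u v) / |s + u v|. *)
Definition sphere_derive (R : realType) (n : nat) (W : normedModType R)
    (f : 'rV[R]_n -> W) (v s : 'rV[R]_n) : W :=
  'D_v (f \o @normalize R n) s.

(* Levi-Civita connection of the round metric: the orthogonal projection onto
   the tangent space at s of the ambient derivative of the vector field V. *)
Definition sphere_nabla (R : realType) (n : nat)
    (v : 'rV[R]_n) (V : 'rV[R]_n -> 'rV[R]_n) (s : 'rV[R]_n) : 'rV[R]_n :=
  let w := sphere_derive V v s in w - dot w s *: s.

(* Smooth frames are a special case: only differentiability near t is needed. *)
Definition normal_frame (R : realType) (N : nat) (t : 'rV[R]_N.+1)
    (E : 'I_N -> 'rV[R]_N.+1 -> 'rV[R]_N.+1) : Prop :=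
  [/\ \forall s \near t, sphere s ->
        (forall i, dot (E i s) s = 0) /\
        (forall i j, dot (E i s) (E j s) = (i == j)%:R),
      forall i, \forall s \near t, differentiable (E i \o @normalize R N.+1) s
    & forall i j, sphere_nabla (E i t) (E j) t = 0].

Definition sphere_hessian (R : realType) (N : nat)
    (E : 'I_N -> 'rV[R]_N.+1 -> 'rV[R]_N.+1) (f : 'rV[R]_N.+1 -> R)
    (t : 'rV[R]_N.+1) : 'M[R]_N :=
  \matrix_(i, j)
    sphere_derive (fun s => sphere_derive f (E j s) s) (E i t) t.

Definition tangent_basis (R : realType) (N : nat) (p : 'rV[R]_N.+1)
    (B : 'M[R]_(N, N.+1)) : Prop :=
  (forall i, dot (row i B) p = 0) /\
  (forall i j, dot (row i B) (row j B) = (i == j)%:R).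

(* Inverse of the central projection of the open hemisphere around p onto the
   tangent hyperplane at p, identified with R^N by an orthonormal basis B;
   these charts form a smooth atlas of the sphere. *)
Definition chart (R : realType) (N : nat) (p : 'rV[R]_N.+1)
    (B : 'M[R]_(N, N.+1)) (u : 'rV[R]_N) : 'rV[R]_N.+1 :=
  normalize (p + u *m B).

Definition partial (R : realType) (N : nat) (i : 'I_N) (g : 'rV[R]_N -> R) :
    'rV[R]_N -> R :=
  'D_(delta_mx 0 i) g.

Definition C1_fun (R : realType) (N : nat) (g : 'rV[R]_N -> R) : Prop :=
  forall i : 'I_N,
    (forall u, derivable g u (delta_mx 0 i)) /\ continuous (partial i g).

Definition C2_fun (R : realType) (N : nat) (g : 'rV[R]_N -> R) : Prop :=
  C1_fun g /\ forall i : 'I_N, C1_fun (partial i g).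

Definition C2_sphere (R : realType) (N : nat) (f : 'rV[R]_N.+1 -> R) : Prop :=
  forall (p : 'rV[R]_N.+1) (B : 'M[R]_(N, N.+1)),
    sphere p -> tangent_basis p B -> C2_fun (f \o chart p B).

(* One-sided when D is an interval and x one of its endpoints. *)
Definition derive_within (R : realType) (D : set R) (f : R -> R) (x : R) : R :=
  lim ((f y - f x) / (y - x) @[y --> within D x^']).

Definition derive_cov (R : realType) (C : R -> R) : R -> R :=
  derive_within `[-1, 1] C.

Definition derive2_cov (R : realType) (C : R -> R) : R -> R :=
  derive_within `[-1, 1] (derive_cov C).

(* The library's normal_prob m 0 is not the Dirac mass at m, hence the case
   distinction. *)
Definition gaussian_rv (R : realType) (d : measure_display)
    (T : measurableType d) (P : probability T R) (Y : T -> R) : Prop :=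
  measurable_fun [set: T] Y /\
  exists m s : R, forall A : set R, measurable A ->
    P (Y @^-1` A) = if s == 0 then dirac m A else normal_prob m s A.

Definition gaussian_family (R : realType) (d : measure_display)
    (T : measurableType d) (P : probability T R) (I : Type) (D : set I)
    (Y : I -> T -> R) : Prop :=
  forall (n : nat) (k : 'I_n -> I) (a : 'I_n -> R), (forall l, D (k l)) ->
    gaussian_rv P (fun w => \sum_(l < n) a l * Y (k l) w).

(* Only the values of the field X at the points of the sphere, and those of C
   on [-1, 1], matter. *)
Definition isotropic_gaussian_field (R : realType) (d : measure_display)
    (T : measurableType d) (P : probability T R) (N : nat) (C : R -> R)
    (X : 'rV[R]_N.+1 -> T -> R) : Prop :=
  [/\ gaussian_family P (@sphere R N.+1) X,
      forall t, sphere t -> ('E_P[X t] = 0)%E,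
      forall t, sphere t -> ('V_P[X t] = 1)%E
    & forall t s, sphere t -> sphere s ->
        'E_P[(fun w => (X t w * X s w)%R)]%E = (C (dot t s))%:E].

Definition smooth_field (R : realType) (d : measure_display)
    (T : measurableType d) (P : probability T R) (N : nat)
    (X : 'rV[R]_N.+1 -> T -> R) : Prop :=
  {ae P, forall w, C2_sphere (X ^~ w)} /\
  forall (p : 'rV[R]_N.+1) (B : 'M[R]_(N, N.+1)),
    sphere p -> tangent_basis p B ->
    let X2 i j (u : 'rV[R]_N) (w : T) :=
      partial i (partial j ((X ^~ w) \o chart p B)) u in
    exists K alpha delta : R, [/\ 0 < K, 0 < alpha, 0 < delta &
      forall (i j : 'I_N) (u v : 'rV[R]_N),
        enorm u < delta -> enorm v < delta -> 0 < enorm (u - v) < delta ->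
        ('E_P[(fun w => ((X2 i j u w - X2 i j v w) ^+ 2)%R)]
           <= (K * `|ln (enorm (u - v))| `^ (- (1 + alpha)))%:E)%E].

Definition GOI (R : realType) (d : measure_display) (T : measurableType d)
    (P : probability T R) (N : nat) (c : R) (M : T -> 'M[R]_N) : Prop :=
  [/\ forall w, (M w)^T = M w,
      gaussian_family P [set: 'I_N * 'I_N] (fun ij w => M w ij.1 ij.2),
      forall i j, ('E_P[(fun w => M w i j)] = 0)%E
    & forall i j k l,
        'E_P[(fun w => (M w i j * M w k l)%R)]%E =
          (2^-1 * ((i == k)%:R * (j == l)%:R + (i == l)%:R * (j == k)%:R)
             + c * ((i == j)%:R * (k == l)%:R))%:E].

Definition borel_mx (R : realType) (N : nat) :=
  g_sigma_algebraType (@open 'M[R]_N).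

(* The Hessian at a point is defined only up to a null set (where the sample
   paths are not C^2 the derivatives take unspecified values), hence need not be
   measurable everywhere: its law is that of an almost surely equal measurable
   random matrix. *)
Definition version (R : realType) (d : measure_display) (T : measurableType d)
    (P : probability T R) (N : nat) (Y Y' : T -> 'M[R]_N) : Prop :=
  measurable_fun [set: T] (Y' : T -> borel_mx R N) /\
  {ae P, forall w, Y w = Y' w}.

Definition has_law (R : realType) (d : measure_display) (T : measurableType d)
    (P : probability T R) (N : nat) (Y : T -> 'M[R]_N)
    (mu : set 'M[R]_N -> \bar R) : Prop :=
  exists2 Y' : T -> 'M[R]_N, version P Y Y' &
    forall A : set (borel_mx R N), measurable A -> P (Y' @^-1` A) = mu A.

Definition conditional_kernel (R : realType) (d : measure_display)
    (T : measurableType d) (P : probability T R) (N : nat)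
    (Y : T -> 'M[R]_N) (Z : T -> R) (K : R.-pker R ~> borel_mx R N)
    : Prop :=
  exists2 Y' : T -> 'M[R]_N, version P Y Y' &
    forall (A : set (borel_mx R N)) (B : set R), measurable A -> measurable B ->
      P ((Y' @^-1` A) `&` (Z @^-1` B)) =
        (\int[P]_(w in Z @^-1` B) K (Z w) A)%E.

Definition weakly_continuous (R : realType) (N : nat)
    (K : R.-pker R ~> borel_mx R N) : Prop :=
  forall f : 'M[R]_N -> R, continuous f -> (exists b : R, forall m, `|f m| <= b) ->
    continuous (fun z : R => \int[K z]_m f m).

(* mu is the conditional law of Y given Z = x.  A regular conditional
   distribution is determined up to a null set of values of Z only; when the
   law of Z has full support, at most one version depends continuously (for the
   weak topology) on the value of Z, and this is the one meant here, at every
   point x. *)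
Definition has_cond_law (R : realType) (d : measure_display)
    (T : measurableType d) (P : probability T R) (N : nat)
    (Y : T -> 'M[R]_N) (Z : T -> R) (x : R)
    (mu : set 'M[R]_N -> \bar R) : Prop :=
  exists K : R.-pker R ~> borel_mx R N,
    [/\ conditional_kernel P Y Z K, weakly_continuous K &
        forall A : set (borel_mx R N), measurable A -> K x A = mu A].

(* Main.v *)
(* The Hessian at t in a normal frame is the matrix of second partial
   derivatives at 0 of the field read in the central chart at t, hence a
   pointwise limit of linear combinations of values of the field: jointly with
   X(t) it is centered Gaussian, and its covariances are limits of fourth and
   second order mixed differences of C (<t, s>).  These limits only need a second
   order Taylor-Peano expansion of C at 1, which follows from the smoothness of
   the sample paths along a geodesic, because the covariance c of a stationary
   process with C^2 paths is four times differentiable at 0.  With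
   E(X_ij X_kl) = C'' (d_ik d_jl + d_il d_jk) + (C' + C'') d_ij d_kl and
   E(X_ij X) = - C' d_ij, both statements follow by comparing characteristic
   functions, after regressing the Hessian on X(t).  C'' >= 0 comes from the
   positive definiteness of C o cos on finite subgroups of the circle. *)
Require Import Defs.
From HB Require Import structures.
From mathcomp Require Import all_boot all_order all_algebra.
From mathcomp Require Import all_classical all_reals all_analysis.
From mathcomp Require Import measurable_realfun ring lra.

Import Order.TTheory GRing.Theory Num.Theory.
Import numFieldNormedType.Exports.

Local Open Scope classical_set_scope.
Local Open Scope ring_scope.

Set Implicit Arguments.
Unset Strict Implicit.
Unset Printing Implicit Defensive.

(** * Derivatives and a trigonometric approximation of indicators *)

(** Laws are compared in real terms only: a characteristic function is the family of expectations of
    cos (linear form + b) with an arbitrary phase b. It determines the law because suitable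
    trigonometric polynomials converge boundedly to indicators of orthants, and orthants form a
    pi-system generating the Borel sets of matrices. Joint Gaussianity is carried by linear spaces
    of centered Gaussian variables, closed under limits at every outcome; Gaussianity is what lets
    covariances pass to such limits. The point 1 is an endpoint of the domain of [C], so the
    derivatives there are one-sided limits; they are computed by substituting cos x and letting x
    tend to 0. Their nonnegativity matters because eta and kappa are built from square roots, and
    [Num.sqrt] is 0 on negative numbers. The conditional law is exhibited rather than derived: on
    the product with the space of M, the pair (shifted matrix, X(t)) has the joint law of (Hessian,
    X(t)), and the kernel is the law of the shifted matrix with X(t) frozen. *)

Lemma is_derive1P (R : realType) (f : R -> R) (x l : R) :
  is_derive x 1 f l <-> (h^-1 * (f (x + h) - f x)) @[h --> 0^'] --> l.
Proof.
have E : (fun h => h^-1 *: (f (h *: 1 + x) - f x)) =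
         (fun h => h^-1 * (f (x + h) - f x)).
  by apply/funext => h; congr (_ * (f _ - _)); rewrite [_ *: _]mulr1 addrC.
split=> [[dx dE]|H].
  by rewrite -E -dE; exact: dx.
have H' : h^-1 *: (f (h *: (1:R) + x) - f x) @[h --> 0^'] --> l by rewrite E.
split; first by apply/cvg_ex; exists l.
exact/cvg_lim.
Qed.

(** The value [l] is left free and tied by an equation, so that a computed derivative can be matched
    afterwards by [ring] or [field]. *)
Lemma is_derive1_comp_eq (R : realType) (f g : R -> R) (x a b l : R) :
  is_derive (g x) 1 f a -> is_derive x 1 g b -> l = a * b ->
  is_derive x 1 (fun y => f (g y)) l.
Proof. by move=> df dg ->; exact: is_derive1_comp. Qed.

Lemma is_derive1M_eq (R : realType) (f g : R -> R) (x a b l : R) :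
  is_derive x 1 f a -> is_derive x 1 g b -> l = a * g x + f x * b ->
  is_derive x 1 (fun y => f y * g y) l.
Proof.
move=> df dg ->; apply: is_derive_eq (is_deriveM df dg) _.
by rewrite addrC; congr (_ + _); rewrite [LHS]mulrC.
Qed.

Lemma bernoulli_ineq (R : realFieldType) (x : R) (n : nat) :
  -1 <= x -> 1 + n%:R * x <= (1 + x) ^+ n.
Proof.
move=> x1; elim: n => [|n IH]; first by rewrite expr0 mul0r addr0.
rewrite exprS; apply: le_trans (_ : (1 + x) * (1 + n%:R * x) <= _).
  have := mulr_ge0 (ler0n R n) (sqr_ge0 x); rewrite -natr1.
  by rewrite expr2; lra.
by apply: ler_wpM2l => //; lra.
Qed.

(* A trigonometric polynomial in y that converges boundedly to the indicator of
   y > 0. *)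
Definition trig_step (R : realType) (n : nat) (y : R) : R :=
  (1 - ((1 - sin (y / n.+1%:R)) / 2) ^+ (n.+1 ^ 3)) ^+ (n.+1 * 2 ^ (n.+1 ^ 3)).

Section trig_step.
Context {R : realType}.
Implicit Types y : R.

Lemma half1Bsin_itv y : 0 <= (1 - sin y) / 2 <= 1.
Proof. by have := sin_le1 y; have := sin_geN1 y; lra. Qed.

Lemma trig_step_itv n y : 0 <= trig_step n y <= 1.
Proof.
have /andP[u0 u1] := half1Bsin_itv (y / n.+1%:R).
have p0 := exprn_ge0 (n.+1 ^ 3) u0; have p1 := exprn_ile1 (n.+1 ^ 3) u0 u1.
by apply/andP; split; [apply: exprn_ge0|apply: exprn_ile1]; lra.
Qed.

Lemma sin_ge_half : \forall y \near (0 : R)^'+, y / 2 <= sin y.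
Proof.
have /is_derive1P := is_derive_sin (0 : R).
rewrite cos0 sin0 => /cvg_dnbhs_at_right/cvgrPdist_lt/(_ (1/2)).
have h : (0 : R) < 1 / 2 by lra.
move=> /(_ h) H; near=> z.
have z0 : 0 < z by near: z; exact: nbhs_right_gt.
have : `|1 - z^-1 * (sin (0 + z) - 0)| < 1 / 2 by near: z.
rewrite add0r subr0 => /ltr_normlP[_]; rewrite ltrBlDr => H1.
have {}H1 : 1 / 2 < z^-1 * sin z by lra.
by rewrite ltr_pdivlMl // in H1; lra.
Unshelve. all: by end_near. Qed.

(** Put u = (1 - sin (y / (n+1))) / 2, m = (n+1)^3 and k = (n+1) 2^m, so that k u^m = (n+1) (2u)^m.
    If y > 0, then 2u <= 1 - y / (2 (n+1)), hence k u^m is O(1/n) and Bernoulli's inequality gives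
    (1 - u^m)^k -> 1. If y <= 0, then 2u >= 1, hence (1 + u^m)^k >= n+1, while (1 - u^m)^k (1 +
    u^m)^k <= 1. The factor n+1 in k forces the limit 0 at y = 0. *)
Lemma cvg_trig_step y : trig_step n y @[n --> \oo] --> ((0 < y)%R%:R : R).
Proof.
have cvg0 (c : R) : c / n.+1%:R @[n --> \oo] --> (0 : R).
  rewrite -[0](mulr0 c); apply: cvgM; first exact: cvg_cst.
  exact: cvg_harmonic.
have pm (n : nat) : ((n.+1 ^ 3)%:R : R) = n.+1%:R ^+ 3 by rewrite natrX.
have [y0|y0] := ltP 0 y => /=.
- apply: (@squeeze_cvgr _ _ _ _ (fun n => 1 - (2 / y) / n.+1%:R) (cst 1)).
  + near=> n.
    have /andP[_ ->] := trig_step_itv n y; rewrite andbT.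
    have a0 : (0 : R) < n.+1%:R by [].
    have : y / n.+1%:R / 2 <= sin (y / n.+1%:R).
      have yn0 : 0 < y / n.+1%:R by rewrite divr_gt0.
      by move: yn0; near: n; exact: (cvg0 y _ sin_ge_half).
    set s := sin _ => hs.
    rewrite /trig_step -/s.
    set m := (n.+1 ^ 3)%N; set u := (1 - s) / 2.
    have /andP[u0 u1] : 0 <= u <= 1 by exact: half1Bsin_itv.
    have um0 := exprn_ge0 m u0; have um1 := exprn_ile1 m u0 u1.
    apply: le_trans (_ : 1 + (n.+1 * 2 ^ m)%:R * - u ^+ m <= _); last first.
      by apply: bernoulli_ineq; lra.
    rewrite mulrN lerD2l lerN2 natrM natrX -(mulrA n.+1%:R) -exprMn.
    set x := y / n.+1%:R / 2 in hs *.
    have x0 : 0 < x by rewrite !divr_gt0.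
    have ux : 2 * u <= 1 - x by rewrite /u; lra.
    have p0 : 0 <= (2 * u) ^+ m by rewrite exprn_ge0// mulr_ge0.
    have H : (2 * u) ^+ m * (1 + m%:R * x) <= 1.
      apply: le_trans (_ : (2 * u) ^+ m * (1 + x) ^+ m <= _).
        by apply: ler_wpM2l => //; apply: bernoulli_ineq; lra.
      rewrite -exprMn; apply: exprn_ile1; first by apply: mulr_ge0; lra.
      by nra.
    have mx : m%:R * x = n.+1%:R ^+ 2 * y / 2.
      by rewrite /m /x pm; field; lra.
    rewrite mx in H.
    rewrite ler_pdivlMr // ler_pdivlMr //.
    suff : (2 * u) ^+ m * (n.+1%:R ^+ 2 * y / 2) <= 1 by nra.
    nra.
  + rewrite -[X in _ --> X]subr0; apply: cvgB; first exact: cvg_cst.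
    exact: cvg0.
  + exact: cvg_cst.
- apply: (@squeeze_cvgr _ _ _ _ (cst 0) (fun n => 1 / n.+1%:R)).
  + near=> n.
    have /andP[-> _] := trig_step_itv n y; rewrite /=.
    have a0 : (0 : R) < n.+1%:R by [].
    have hs : sin (y / n.+1%:R) <= 0.
      rewrite -[y]opprK mulNr sinN oppr_le0 sin_ge0_pi //.
      apply/andP; split; first by rewrite mulr_ge0 // oppr_ge0.
      by near: n; apply: (cvgr_le _ (cvg0 (- y))); exact: pi_gt0.
    rewrite /trig_step; set s := sin _ in hs *.
    set m := (n.+1 ^ 3)%N; set u := (1 - s) / 2.
    have /andP[u0 u1] : 0 <= u <= 1 by exact: half1Bsin_itv.
    have um0 := exprn_ge0 m u0; have um1 := exprn_ile1 m u0 u1.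
    rewrite ler_pdivlMr //.
    set k := (n.+1 * 2 ^ m)%N.
    have k1 : n.+1%:R <= (1 + u ^+ m) ^+ k.
      apply: le_trans (_ : 1 + k%:R * u ^+ m <= _); last first.
        by apply: bernoulli_ineq; lra.
      rewrite natrM natrX -(mulrA n.+1%:R) -exprMn.
      have : 1 <= (2 * u) ^+ m by rewrite exprn_ege1 // /u; lra.
      nra.
    apply: le_trans (_ : (1 - u ^+ m) ^+ k * (1 + u ^+ m) ^+ k <= _).
      by apply: ler_wpM2l => //; apply: exprn_ge0; lra.
    by rewrite -exprMn; move: (u ^+ m) um0 um1 => U U0 U1; apply: exprn_ile1; nra.
  + exact: cvg_cst.
  + exact: cvg0.
Unshelve. all: by end_near. Qed.
End trig_step.

(** * Expectations of bounded functions and the Cramér-Wold device *)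

Definition Ex (d : measure_display) (T : measurableType d) (R : realType)
  (P : probability T R) (f : T -> R) : R := \int[P]_w f w.

Section Ex.
Context {d : measure_display} {T : measurableType d} {R : realType}.
Variable P : probability T R.
Implicit Types f g : T -> R.

Lemma bounded_integrable f (K : R) : measurable_fun setT f ->
  (forall w, `|f w| <= K) -> P.-integrable setT (EFin \o f).
Proof.
move=> mf fK; apply: measurable_bounded_integrable => //.
  exact: le_lt_trans (probability_le1 P measurableT) (ltry 1).
rewrite /bounded_near; near=> M => w _ /=; apply: le_trans (fK w) _.
by near: M; apply: nbhs_pinfty_ge; exact: num_real.
Unshelve. all: by end_near. Qed.

Lemma ExD f g : P.-integrable setT (EFin \o f) ->
  P.-integrable setT (EFin \o g) -> Ex P (fun w => f w + g w) = Ex P f + Ex P g.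
Proof. by move=> fi gi; rewrite /Ex RintegralD. Qed.

Lemma ExZ (c : R) f : P.-integrable setT (EFin \o f) ->
  Ex P (fun w => c * f w) = c * Ex P f.
Proof. by move=> fi; rewrite /Ex RintegralZl. Qed.

Lemma Ex_cst (c : R) : Ex P (fun=> c) = c.
Proof.
rewrite /Ex [LHS](_ : _ = Rintegral P setT (cst c)) // Rintegral_cst //.
by have := @probability_setT _ _ _ P => /= ->; rewrite mulr1.
Qed.

Lemma eq_Ex f g : (forall w, f w = g w) -> Ex P f = Ex P g.
Proof. by move=> fg; congr Ex; apply/funext. Qed.

Lemma ae_eq_Ex f g : measurable_fun setT f -> measurable_fun setT g ->
  {ae P, forall w, f w = g w} -> Ex P f = Ex P g.
Proof.
move=> mf mg fg; rewrite /Ex /Rintegral; congr fine.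
apply: ae_eq_integral => //; [exact/measurable_EFinP|exact/measurable_EFinP|].
by apply: filterS fg => w /= -> .
Qed.

Lemma Ex_dct (f_ : nat -> T -> R) f g :
  (forall n, measurable_fun setT (f_ n)) ->
  (forall n w, `|f_ n w| <= g w) ->
  P.-integrable setT (EFin \o g) ->
  (forall w, f_ n w @[n --> \oo] --> f w) ->
  P.-integrable setT (EFin \o f) /\ Ex P (f_ n) @[n --> \oo] --> Ex P f.
Proof.
move=> mf_ fg ig ff.
have mf : measurable_fun setT f by apply: (measurable_fun_cvg mf_) => x _; exact: ff.
have ffE : {ae P, forall w, setT w -> (EFin \o f_ n) w @[n --> \oo] --> (EFin \o f) w}.
  apply: aeW => w _; apply/fine_cvgP; split; first exact: nearW.
  exact: ff.
have [|||fi _ H] := @dominated_convergence _ _ _ P setT measurableT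
  (fun n => EFin \o f_ n) (EFin \o f) (EFin \o g) _ _ ffE ig.
- by move=> n; apply/measurable_EFinP.
- exact/measurable_EFinP.
- by apply: aeW => w n _; rewrite lee_fin.
split=> //; apply: fine_cvg; rewrite /= fineK //.
by apply: integrable_fin_num.
Qed.

Lemma cvg_Ex (f_ : nat -> T -> R) f (K : R) :
  (forall n, measurable_fun setT (f_ n)) ->
  (forall n w, `|f_ n w| <= K) ->
  (forall w, f_ n w @[n --> \oo] --> f w) ->
  Ex P (f_ n) @[n --> \oo] --> Ex P f.
Proof.
move=> mf fK ff; have [] := Ex_dct mf fK _ ff => //.
exact: finite_measure_integrable_cst.
Qed.

End Ex.

Section trigpoly.
Context {R : realType} {I : finType}.
Implicit Types (f g : (I -> R) -> R) (z : I -> R).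

(** The phase [b] provides sines as well as cosines, and arbitrary real frequencies make the class
    stable under products, so it contains the products of [trig_step] that approximate indicators of
    orthants. *)
Inductive trigpoly : ((I -> R) -> R) -> Prop :=
| trigpoly_cos c a b : trigpoly (fun z => c * cos (\sum_i a i * z i + b))
| trigpolyD f g : trigpoly f -> trigpoly g -> trigpoly (fun z => f z + g z).

Lemma eq_trigpoly f g : f =1 g -> trigpoly f -> trigpoly g.
Proof. by move=> /funext ->. Qed.

Lemma trigpoly_cst c : trigpoly (fun=> c).
Proof.
apply: (eq_trigpoly _ (trigpoly_cos c (fun=> 0) 0)) => z.
rewrite big1 ?addr0 ?cos0 ?mulr1 // => i _; exact: mul0r.
Qed.

Lemma trigpolyM f g : trigpoly f -> trigpoly g -> trigpoly (fun z => f z * g z).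
Proof.
move=> + tg; elim=> [c a b|f1 f2 _ IH1 _ IH2]; last first.
  by apply: (eq_trigpoly _ (trigpolyD IH1 IH2)) => z; rewrite mulrDl.
elim: tg => [c' a' b'|g1 g2 _ IH1 _ IH2]; last first.
  by apply: (eq_trigpoly _ (trigpolyD IH1 IH2)) => z; rewrite mulrDr.
apply: (eq_trigpoly _ (trigpolyD
  (trigpoly_cos (c * c' / 2) (fun i => a i + a' i) (b + b'))
  (trigpoly_cos (c * c' / 2) (fun i => a i - a' i) (b - b')))) => z.
have -> : \sum_i (a i + a' i) * z i = \sum_i a i * z i + \sum_i a' i * z i.
  by rewrite -big_split; apply: eq_bigr => i _; rewrite mulrDl.
have -> : \sum_i (a i - a' i) * z i = \sum_i a i * z i - \sum_i a' i * z i.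
  by rewrite -sumrB; apply: eq_bigr => i _; rewrite mulrBl.
set A := \sum_i a i * z i; set A' := \sum_i a' i * z i.
have -> : A + A' + (b + b') = (A + b) + (A' + b') by ring.
have -> : A - A' + (b - b') = (A + b) - (A' + b') by ring.
by rewrite cosD cosB; field.
Qed.

Lemma trigpolyX f n : trigpoly f -> trigpoly (fun z => f z ^+ n).
Proof.
move=> tf; elim: n => [|n IH]; first exact: trigpoly_cst.
by apply: (eq_trigpoly _ (trigpolyM tf IH)) => z; rewrite exprS.
Qed.

Lemma trigpoly_prod (J : Type) (s : seq J) (F : J -> (I -> R) -> R) :
  (forall j, trigpoly (F j)) -> trigpoly (fun z => \prod_(j <- s) F j z).
Proof.
move=> tF; elim: s => [|j s IH].
  by apply: (eq_trigpoly _ (trigpoly_cst 1)) => z; rewrite big_nil.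
by apply: (eq_trigpoly _ (trigpolyM (tF j) IH)) => z; rewrite big_cons.
Qed.

Lemma trigpoly_step n (i : I) (c : R) : trigpoly (fun z => trig_step n (z i - c)).
Proof.
rewrite /trig_step; apply: trigpolyX.
apply: (eq_trigpoly (f := fun z => 1 + (-1) *
   ((1 - sin ((z i - c) / n.+1%:R)) / 2) ^+ (n.+1 ^ 3))).
  by move=> z; rewrite mulN1r.
apply: trigpolyD; first exact: trigpoly_cst.
apply: trigpolyM; first exact: trigpoly_cst.
apply: trigpolyX.
(* Here - sin y is written as cos (y + pi/2), with a frequency vector supported on the coordinate
   [i]. *)
apply: (eq_trigpoly (f := fun z => 1/2 + (1/2) *
   cos (\sum_j ((j == i)%:R / n.+1%:R) * z j + (pi/2 - c / n.+1%:R)))).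
  move=> z; rewrite (bigD1 i) //= eqxx big1 ?addr0; last first.
    by move=> j /negbTE ->; rewrite !mul0r.
  set y := (z i - c) / _.
  have -> : 1%:R / n.+1%:R * z i + (pi / 2 - c / n.+1%:R) = y + pi / 2.
    by rewrite /y; ring.
  by rewrite cosD sin_pihalf cos_pihalf; field.
by apply: trigpolyD; [exact: trigpoly_cst|exact: trigpoly_cos].
Qed.

End trigpoly.

(** The arbitrary carrier [S] covers both events of a probability space and, with [Y] the matrix
    entries, subsets of the space of matrices. *)
Definition orthant (R : realType) (I : finType) (S : Type) (Y : I -> S -> R) (c : I -> R) : set S :=
  [set w | forall i, c i < Y i w].

Section cramer_wold.
Context {R : realType} {I : finType}.

Section measurable.
Context {d : measure_display} {T : measurableType d}.
Variables (P : probability T R) (Z : I -> T -> R).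
Hypothesis mZ : forall i, measurable_fun setT (Z i).

Lemma measurable_lin (a : I -> R) : measurable_fun setT (fun w => \sum_i a i * Z i w).
Proof. by apply: measurable_sum => i; apply: measurable_funM. Qed.

Lemma measurable_cos_lin (a : I -> R) (b : R) :
  measurable_fun setT (fun w => cos (\sum_i a i * Z i w + b)).
Proof.
apply: (measurableT_comp (f := cos)).
  by apply: continuous_measurable_fun; exact: continuous_cos.
by apply: measurable_funD => //; exact: measurable_lin.
Qed.

Lemma trigpoly_bounded f : trigpoly f ->
  measurable_fun setT (fun w => f (Z ^~ w)) /\ exists K, forall w, `|f (Z ^~ w)| <= K.
Proof.
elim=> [c a b|f1 f2 _ [m1 [K1 b1]] _ [m2 [K2 b2]]].
  split; first by apply: measurable_funM => //; exact: measurable_cos_lin.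
  exists `|c| => w; rewrite normrM ler_piMr //.
  by rewrite ler_norml cos_le1 cos_geN1.
split; first exact: measurable_funD.
by exists (K1 + K2) => w; apply: le_trans (ler_normD _ _) (lerD _ _).
Qed.

End measurable.

Variables (d d' : measure_display) (T : measurableType d) (T' : measurableType d').
Variables (P : probability T R) (P' : probability T' R).
Variables (Z : I -> T -> R) (Z' : I -> T' -> R).
Hypothesis mZ : forall i, measurable_fun setT (Z i).
Hypothesis mZ' : forall i, measurable_fun setT (Z' i).
Hypothesis eq_cos : forall a b, Ex P (fun w => cos (\sum_i a i * Z i w + b)) =
  Ex P' (fun w => cos (\sum_i a i * Z' i w + b)).

Lemma eq_Ex_trigpoly f : trigpoly f ->
  Ex P (fun w => f (Z ^~ w)) = Ex P' (fun w => f (Z' ^~ w)).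
Proof.
elim=> [c a b|f1 f2 t1 IH1 t2 IH2].
  rewrite !ExZ ?eq_cos //; apply: (@bounded_integrable _ _ _ _ _ 1);
    by [exact: measurable_cos_lin|move=> w; rewrite ler_norml cos_le1 cos_geN1].
have [m1 [K1 b1]] := trigpoly_bounded mZ t1.
have [m2 [K2 b2]] := trigpoly_bounded mZ t2.
have [m1' [K1' b1']] := trigpoly_bounded mZ' t1.
have [m2' [K2' b2']] := trigpoly_bounded mZ' t2.
by rewrite !ExD ?IH1 ?IH2 //; apply: bounded_integrable.
Qed.

Let prod_step (S : Type) (Y : I -> S -> R) (c : I -> R) w :
  \prod_i ((0 < Y i w - c i)%R%:R : R) = \1_(orthant Y c) w.
Proof.
rewrite indicE; have [|/negP h] := boolP (w \in orthant Y c).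
  rewrite inE => h; rewrite big1 // => i _; by rewrite subr_gt0 h.
suff [i hi] : exists i, ~~ (c i < Y i w).
  by rewrite (bigD1 i) //= subr_gt0 (negbTE hi) mul0r.
apply/existsP; rewrite -negb_forall; apply/negP => /forallP h'.
by apply: h; rewrite inE => i; exact: h'.
Qed.

Let cvg_prod_step (J : Type) (s : seq J) (y : J -> R) :
  \prod_(i <- s) trig_step n (y i) @[n --> \oo] -->
  \prod_(i <- s) ((0 < y i)%R%:R : R).
Proof.
elim: s => [|i s IH].
  rewrite big_nil; under eq_fun do rewrite big_nil; exact: cvg_cst.
rewrite big_cons; under eq_fun do rewrite big_cons.
by apply: cvgM IH; exact: cvg_trig_step.
Qed.

Let Ex_orthant d0 (T0 : measurableType d0) (P0 : probability T0 R) (Y : I -> T0 -> R) c :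
  (forall i, measurable_fun setT (Y i)) ->
  P0 (orthant Y c) \is a fin_num /\
  Ex P0 (fun w => \prod_i trig_step n (Y i w - c i)) @[n --> \oo]
    --> fine (P0 (orthant Y c)).
Proof.
move=> mY.
have tP n : trigpoly (fun z : I -> R => \prod_i trig_step n (z i - c i)).
  by apply: trigpoly_prod => i; exact: trigpoly_step.
have mO : measurable (orthant Y c).
  rewrite (_ : orthant Y c = \big[setI/setT]_i (Y i @^-1` `]c i, +oo[)).
    by apply: bigsetI_measurable => i _; rewrite -[X in measurable X]setTI; apply: mY.
  apply/seteqP; split=> [w /= h|w].
    by rewrite -bigcap_seq => i _ /=; rewrite in_itv/= h.
  by rewrite -bigcap_seq => h i /=; have := h i (mem_index_enum i); rewrite /= in_itv/= andbT.
have fO : P0 (orthant Y c) \is a fin_num by exact: fin_num_measure.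
split=> //.
have -> : fine (P0 (orthant Y c)) = Ex P0 (fun w => \prod_i (0 < Y i w - c i)%R%:R).
  under eq_Ex => w do rewrite prod_step.
  by rewrite /Ex /Rintegral integral_indic // setIT.
apply: (@cvg_Ex _ _ _ _ _ _ 1).
- by move=> n; have [] := trigpoly_bounded mY (tP n).
- move=> n w; rewrite normr_prod; apply: prodr_ile1 => i _.
  by have /andP[h0 h1] := trig_step_itv n (Y i w - c i); rewrite ger0_norm ?h0.
- by move=> w; exact: cvg_prod_step.
Qed.

(** Both probabilities are limits, by bounded convergence, of expectations of the same trigonometric
    polynomials, on which the two laws agree by [eq_cos]. *)
Lemma eq_orthant c : P (orthant Z c) = P' (orthant Z' c).
Proof.
have [f1 h1] := Ex_orthant P c mZ; have [f2 h2] := Ex_orthant P' c mZ'.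
rewrite -[LHS]fineK // -[RHS]fineK //; congr EFin.
apply: (cvg_unique (@Rhausdorff R) h1).
rewrite (_ : (fun n => _) = fun n => Ex P' (fun w => \prod_i trig_step n (Z' i w - c i))) //.
apply/funext => n.
apply: (eq_Ex_trigpoly (f := fun z : I -> R => \prod_i trig_step n (z i - c i))).
by apply: trigpoly_prod => i; exact: trigpoly_step.
Qed.
End cramer_wold.

(** * The Borel sigma-algebra on matrices *)

Lemma ratr_near (R : realType) (x e : R) : 0 < e -> exists q : rat, `|x - ratr q| < e.
Proof.
move=> e0; have hlt : x - e < x + e by lra.
have [q] := rat_in_itvoo hlt; rewrite in_itv/= => /andP[q1 q2].
by exists q; rewrite ltr_norml; apply/andP; split; lra.
Qed.

Definition entry (R : realType) (N : nat) (ij : 'I_N * 'I_N) (m : 'M[R]_N) : R := m ij.1 ij.2.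

Section borel_mx.
Context {R : realType} {N : nat}.
Let I := ('I_N * 'I_N)%type.

Definition mx_orthants : set (set 'M[R]_N) :=
  [set A | exists c, A = orthant (@entry R N) c].

Let gT := g_sigma_algebraType mx_orthants.

Let measurable_entry (ij : I) : measurable_fun [set: gT] (@entry R N ij : gT -> R).
Proof.
move=> mD; apply: (measurability _ (RGenOInfty.measurableE R)).
move=> _ [_ [c ->] <-]; rewrite setTI.
(* A half-space in one entry is the union of orthants whose other thresholds go to minus
   infinity. *)
pose cc n := (fun kl : I => if kl == ij then c else - n%:R : R).
have -> : @entry R N ij @^-1` `]c, +oo[ = \bigcup_n orthant (@entry R N) (cc n).
  apply/seteqP; split=> m /=; rewrite in_itv/= andbT.
    move=> cm; near \oo => n; exists n => // kl; rewrite /cc.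
    case: eqP => [->//|_].
    rewrite ltrNl; apply: le_lt_trans (ler_norm _) _; rewrite normrN.
    apply: (@le_lt_trans _ _ (\sum_ij `|entry ij m|)).
      by rewrite (bigD1 kl) //= lerDl sumr_ge0.
    by near: n; exact: nbhs_infty_gtr.
  by move=> [n _ /(_ ij)]; rewrite /cc eqxx.
apply: bigcupT_measurable => n; apply: sub_sigma_algebra; by exists (cc n).
Unshelve. all: by end_near. Qed.

Let box (q : 'M[rat]_N) (n : nat) : set 'M[R]_N :=
  [set m | forall ij : I, `|entry ij m - ratr (q ij.1 ij.2)| < n.+1%:R^-1].

Let measurable_box q n : measurable (box q n : set gT).
Proof.
rewrite (_ : box q n = \big[setI/setT]_(ij : I) (@entry R N ij @^-1`
    (ball (ratr (q ij.1 ij.2) : R) n.+1%:R^-1))).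
  apply: bigsetI_measurable => ij _; rewrite -[X in measurable X]setTI.
  by apply: measurable_entry => //; exact: measurable_ball.
apply/seteqP; split=> [m h|m]; rewrite -bigcap_seq.
  by move=> ij _ /=; rewrite /ball/= distrC; exact: h.
by move=> h ij; have := h ij (mem_index_enum ij); rewrite /= /ball/= distrC.
Qed.

(** Each point of [U] lies in a box with rational center and half-width 1/(n+1) contained in [U];
    there are countably many such boxes. Taking 1/(n+1) < e/2 keeps the whole box in the ball of
    radius e around the point. *)
Lemma open_measurable_orthants (U : set 'M[R]_N) : open U -> <<s mx_orthants >> U.
Proof.
move=> oU.
have -> : U = \bigcup_(p in [set p : 'M[rat]_N * nat | box p.1 p.2 `<=` U]) box p.1 p.2.
  apply/seteqP; split=> [m Um|m [p hp]]; last exact: hp.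
  have /nbhs_ballP[e /= e0 eU] : nbhs m U by exact: open_nbhs_nbhs.
  have e20 : 0 < e / 2 by lra.
  near \oo => n.
  have n0 : (0:R) < n.+1%:R^-1 by [].
  have qP ij : exists q : rat, `|entry ij m - ratr q| < n.+1%:R^-1.
    exact: ratr_near.
  have /choice[q qE] := qP.
  exists (\matrix_(i, j) q (i, j), n); last by move=> ij; rewrite mxE -surjective_pairing.
  move=> m' /= h; apply: eU; split=> // i j.
  have := h (i, j); have := qE (i, j); rewrite /entry mxE /= => h1 h2.
  rewrite /ball/= -(subrKA (ratr (q (i, j)))).
  apply: le_lt_trans (ler_normD _ _) _.
  rewrite distrC in h2; apply: lt_trans (ltrD h1 h2) _.
  rewrite (splitr e); suff H : n.+1%:R^-1 < e / 2 by exact: ltrD.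
  near: n; exact: (near_infty_natSinv_lt (PosNum e20)).
rewrite bigcup_mkcond.
apply: (@countable_bigcupT_measurable _ gT) => //.
by move=> p; case: ifP => _; [exact: measurable_box|exact: measurable0].
Unshelve. all: by end_near. Qed.

(** This reduces measurability of a random matrix to that of its entries, and equality of laws to
    equality on orthants. *)
Lemma borel_mxE : (@measurable _ (borel_mx R N)) = <<s mx_orthants >>.
Proof.
apply/seteqP; split.
  apply: smallest_sub; first exact: smallest_sigma_algebra.
  exact: open_measurable_orthants.
apply: smallest_sub; first exact: smallest_sigma_algebra.
move=> _ [c ->]; apply: sub_sigma_algebra.
rewrite (_ : orthant _ _ = \big[setI/setT]_(ij : I) (@entry R N ij @^-1` `]c ij, +oo[)).
  apply: (big_ind open) => [||ij _]; [exact: openT|exact: openI|].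
  by apply: open_comp => // m _; exact: coord_continuous.
apply/seteqP; split=> [m h|m]; rewrite -bigcap_seq.
  by move=> ij _ /=; rewrite in_itv/= h.
by move=> h ij; have := h ij (mem_index_enum ij); rewrite /= in_itv/= andbT.
Qed.

Lemma measurable_mx d (T : measurableType d) (f : T -> 'M[R]_N) :
  (forall ij, measurable_fun setT (fun w => entry ij (f w))) ->
  measurable_fun setT (f : T -> borel_mx R N).
Proof.
move=> mf mD; apply: (measurability _ borel_mxE).
move=> _ [_ [c ->] <-]; rewrite setTI.
rewrite (_ : _ @^-1` _ = \big[setI/setT]_(ij : I) ((fun w => entry ij (f w)) @^-1` `]c ij, +oo[)).
  by apply: bigsetI_measurable => ij _; rewrite -[X in measurable X]setTI; apply: mf.
apply/seteqP; split=> [m h|m]; rewrite -bigcap_seq.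
  by move=> ij _ /=; rewrite in_itv/= h.
by move=> h ij; have := h ij (mem_index_enum ij); rewrite /= in_itv/= andbT.
Unshelve. all: exact: mD. Qed.

(** Orthants form a pi-system (thresholds combine by maximum) and those with thresholds -n exhaust
    the space. *)
Lemma mx_measure_unique (m1 m2 : {measure set (borel_mx R N) -> \bar R}) :
  (m1 setT < +oo)%E ->
  (forall c, m1 (orthant (@entry R N) c) = m2 (orthant (@entry R N) c)) ->
  forall A, measurable A -> m1 A = m2 A.
Proof.
move=> m1oo m12 A mA.
apply: (@measure_unique _ R (borel_mx R N) mx_orthants (fun n => orthant (@entry R N) (fun=> - n%:R))) => //.
- exact: borel_mxE.
- move=> _ _ [c1 ->] [c2 ->]; exists (fun ij => Num.max (c1 ij) (c2 ij)).
  apply/seteqP; split=> m /=.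
    by move=> [h1 h2] ij; rewrite gt_max h1 h2.
  by move=> h; split=> ij; have := h ij; rewrite gt_max => /andP[].
- by move=> n; exists (fun=> - n%:R).
- apply/seteqP; split=> // m _.
  near \oo => n; exists n => // ij /=; rewrite ltrNl.
  apply: le_lt_trans (ler_norm _) _; rewrite normrN.
  apply: (@le_lt_trans _ _ (\sum_ij `|entry ij m|)).
    by rewrite (bigD1 ij) //= lerDl sumr_ge0.
  by near: n; exact: nbhs_infty_gtr.
- by move=> _ [c ->].
- move=> n; apply: le_lt_trans m1oo; apply: le_measure; rewrite ?inE //.
  by rewrite borel_mxE; apply: sub_sigma_algebra; exists (fun=> - n%:R).
Unshelve. all: by end_near. Qed.
End borel_mx.

(** * The characteristic function of normal laws *)

Section normal_cf.
Context {R : realType}.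
Notation mu := (@lebesgue_measure R).
Variables (m s : R).
Hypothesis s0 : s != 0.

(** The Radon-Nikodym derivative of [normal_prob] agrees almost everywhere with [normal_pdf], both
    having the same integrals over measurable sets. *)
Lemma integral_normal_prob (f : R -> \bar R) :
  (normal_prob m s).-integrable setT f ->
  (\int[normal_prob m s]_x f x = \int[mu]_x (f x * (normal_pdf m s x)%:E))%E.
Proof.
move=> intf; have mf := measurable_int _ intf.
rewrite -(Radon_Nikodym_change_of_variables (normal_prob_dominates m s))//=.
apply: ae_eq_integral => //.
- apply: emeasurable_funM => //; apply: (measurable_int mu).
  by apply: Radon_Nikodym_integrable; exact: normal_prob_dominates.
- apply: emeasurable_funM => //=; apply/measurableT_comp => //=.
  exact: measurable_normal_pdf.
- apply: ae_eqe_mul2l => /=.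
  rewrite Radon_NikodymE//=; first exact: normal_prob_dominates.
  move=> abmu.
  case: cid => /= h [h1 h2 h3].
  apply: integral_ae_eq => //=.
  + by apply/measurable_EFinP; exact: measurable_normal_pdf.
  + by move=> E E01 mE; rewrite -h3.
Qed.

Let g := normal_pdf m s.

Let gE x : g x = normal_peak s * expR (- (x - m) ^+ 2 / (s ^+ 2 *+ 2)).
Proof. by rewrite /g normal_pdfE. Qed.

Let s2 : 0 < s ^+ 2. Proof. by rewrite exprn_even_gt0. Qed.

Let is_derive_g (x : R) : is_derive x 1 g (- ((x - m) / s ^+ 2) * g x).
Proof.
rewrite (_ : g = fun x => normal_peak s * expR (- (x - m) ^+ 2 / (s ^+ 2 *+ 2))); last exact/funext.
have dq : is_derive x 1 (fun y : R => - (y - m) ^+ 2 / (s ^+ 2 *+ 2))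
    (- ((x - m) / s ^+ 2)).
  by apply: is_derive_eq; rewrite /GRing.scale/=; field.
have dE := is_derive1_comp_eq (is_derive_expR _) dq erefl.
apply: (is_derive1M_eq (f := cst (normal_peak s)) (is_derive_cst _ _ _) dE).
by rewrite /=; ring.
Qed.

Let is_derive_aff (k c y : R) : is_derive y 1 (fun z : R => z * k + c) k.
Proof. by apply: is_derive_eq; rewrite /GRing.scale/=; ring. Qed.

Let is_derive_aff' (u c y : R) : is_derive y 1 (fun z : R => u * (z - m) + c) u.
Proof. by apply: is_derive_eq; rewrite /GRing.scale/=; ring. Qed.

(** Constant of the bound of |x - m| g(x) by a normal density of doubled deviation. With y = (x -
    m)/s the exponent splits as 1/2 = 1/8 + 3/8, and |y| exp (- 3 y^2 / 8) <= 2. The resulting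
    integrable majorant allows differentiation under the integral sign. *)
Let C : R := `|s| * 2 * normal_peak s / normal_peak (2 * s).

Let dom x : `|x - m| * g x <= C * normal_pdf m (2 * s) x.
Proof.
have s20 : 2 * s != 0 by rewrite mulf_neq0.
have p0 := normal_peak_gt0 s0; have p20 := normal_peak_gt0 s20.
rewrite gE normal_pdfE // /normal_fun /C.
set y := (x - m) / s.
have sy : `|x - m| = `|s| * `|y|.
  by rewrite -normrM /y; congr (`| _ |); field.
have -> : - (x - m) ^+ 2 / (s ^+ 2 *+ 2) = - (y ^+ 2 / 8) - 3 / 8 * y ^+ 2.
  by rewrite /y -mulr_natl; field.
have -> : - (x - m) ^+ 2 / ((2 * s) ^+ 2 *+ 2) = - (y ^+ 2 / 8).
  by rewrite /y -mulr_natl; field.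
rewrite expRD sy.
have e1 : `|y| * expR (- (3 / 8 * y ^+ 2)) <= 2.
  rewrite expRN ler_pdivrMr ?expR_gt0 //.
  have := expR_ge1Dx (3 / 8 * y ^+ 2).
  rewrite -(real_normK (num_real y)); have := sqr_ge0 (`|y| - 1).
  have := sqr_ge0 `|y|; move: (expR (_ * _)) => E; move: `|y| => z; rewrite !expr2; nra.
have e0 := expR_ge0 (- (y ^+ 2 / 8)).
rewrite [leRHS](_ : _ = `|s| * normal_peak s * expR (- (y ^+ 2 / 8)) * 2); last first.
  by field; rewrite gt_eqF.
rewrite [leLHS](_ : _ = `|s| * normal_peak s * expR (- (y ^+ 2 / 8)) *
   (`|y| * expR (- (3 / 8 * y ^+ 2)))); last by ring.
by apply: ler_wpM2l => //; rewrite !mulr_ge0 // ltW.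
Qed.

Let integrable_dom : mu.-integrable setT (EFin \o (fun x => `|x - m| * g x)).
Proof.
apply: (@le_integrable _ _ _ mu _ _ _ (EFin \o (fun x => C * normal_pdf m (2 * s) x))) => //.
- apply/measurable_EFinP; apply: measurable_funM.
    apply: measurableT_comp => //; exact: measurable_funB.
  exact: measurable_normal_pdf.
- move=> x _; have h0 : 0 <= `|x - m| * g x by rewrite mulr_ge0 // normal_pdf_ge0.
  by rewrite lee_fin (ger0_norm h0) (ger0_norm (le_trans h0 (dom x))).
- under [X in integrable _ _ X]eq_fun do rewrite /= EFinM.
  by apply: integrableZl => //; exact: integrable_normal_pdf.
Qed.

Variable b : R.
Let f (u x : R) : R := cos (u * (x - m) + b) * g x.
Let f' (u x : R) : R := - (x - m) * sin (u * (x - m) + b) * g x.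
Let phi (u : R) : R := \int[mu]_x f u x.

Let is_derive_f (u x : R) : is_derive u 1 (f ^~ x) (f' u x).
Proof.
have dE := is_derive1_comp_eq (is_derive_cos _) (is_derive_aff (x - m) b u) erefl.
apply: (is_derive1M_eq (g := cst (g x)) dE (is_derive_cst _ _ _)).
by rewrite /f' /=; ring.
Qed.

Let mf u : measurable_fun setT (f u).
Proof.
apply: measurable_funM; last exact: measurable_normal_pdf.
apply: (measurableT_comp (f := cos)).
  by apply: continuous_measurable_fun; exact: continuous_cos.
apply: measurable_funD => //; apply: measurable_funM => //; exact: measurable_funB.
Qed.

Let mf' u : measurable_fun setT (f' u).
Proof.
apply: measurable_funM; last exact: measurable_normal_pdf.
apply: measurable_funM; first by apply: measurableT_comp => //; exact: measurable_funB.
apply: (measurableT_comp (f := sin)).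
  by apply: continuous_measurable_fun; exact: continuous_sin.
apply: measurable_funD => //; apply: measurable_funM => //; exact: measurable_funB.
Qed.

Let integrable_f u : mu.-integrable setT (EFin \o f u).
Proof.
apply: (@le_integrable _ _ _ mu _ _ _ (EFin \o g)) => //.
- by apply/measurable_EFinP; exact: mf.
- move=> x _; rewrite lee_fin normrM ler_piMl // ler_norml cos_le1 cos_geN1//.
- exact: integrable_normal_pdf.
Qed.

Let f'_dom u x : `|f' u x| <= `|x - m| * g x.
Proof.
rewrite /f' !normrM normrN [`|g x|]ger0_norm ?normal_pdf_ge0 //.
rewrite ler_wpM2r ?normal_pdf_ge0 // ler_piMr // ler_norml sin_le1 sin_geN1//.
Qed.

Let integrable_f' u : mu.-integrable setT (EFin \o f' u).
Proof.
apply: le_integrable integrable_dom => //.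
  by apply/measurable_EFinP; exact: mf'.
move=> x _; have h0 : 0 <= `|x - m| * g x by rewrite mulr_ge0 // normal_pdf_ge0.
by rewrite lee_fin (ger0_norm h0); exact: f'_dom.
Qed.

Let d1f (u x : R) : partial1of2 f u x = f' u x.
Proof. by rewrite partial1of2E; have [_] := is_derive_f u x. Qed.

Let is_derive_phi (u : R) : is_derive u 1 phi (\int[mu]_x f' u x).
Proof.
have Iu : `]u - 1, u + 1[%classic u by rewrite /= in_itv/=; lra.
have dfu x y : `]u - 1, u + 1[%classic x -> setT y -> derivable (f ^~ y) x 1.
  by move=> _ _; have [] := is_derive_f x y.
have G0 y : 0 <= `|y - m| * g y by rewrite mulr_ge0 ?normal_pdf_ge0.
have Gub x y : `]u - 1, u + 1[%classic x -> setT y -> `|partial1of2 f x y| <= `|y - m| * g y.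
  by move=> _ _; rewrite d1f; exact: f'_dom.
have := @cvg_differentiation_under_integral R _ _ mu f setT measurableT u (u - 1) (u + 1) Iu
  (fun x _ => integrable_f x) dfu _ G0 integrable_dom Gub.
rewrite (_ : partial1of2 f u = f' u); last by apply/funext => y; exact: d1f.
move=> H; apply/is_derive1P; move: H.
rewrite (_ : (fun h => _) = (fun h => h^-1 * (phi (u + h) - phi u))) //.
by apply/funext => k; rewrite /phi [u + k]addrC.
Qed.

(* The integral of h' vanishes: this is the differential equation
   phi' = - u s^2 phi of the characteristic function. *)
Let h (u x : R) : R := g x * sin (u * (x - m) + b).
Let is_derive_h (u x : R) : is_derive x 1 (h u) (s ^- 2 * f' u x + u * f u x).
Proof.
have dE := is_derive1_comp_eq (is_derive_sin _) (is_derive_aff' u b x) erefl.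
apply: (is_derive1M_eq (is_derive_g x) dE).
by rewrite /f' /f; field; exact: s0.
Qed.

Let h' (u x : R) := s ^- 2 * f' u x + u * f u x.

Let integrable_h' u : mu.-integrable setT (EFin \o h' u).
Proof.
under [X in integrable _ _ X]eq_fun do rewrite /= EFinD !EFinM.
apply: integrableD => //; apply: integrableZl => //.
  exact: integrable_f'.
exact: integrable_f.
Qed.

Let cont_h' (u : R) : continuous (h' u).
Proof.
move=> x; have ca : (u * (y - m) + b) @[y --> x] --> u * (x - m) + b.
  apply: cvgD; last exact: cvg_cst.
  apply: cvgM; first exact: cvg_cst.
  by apply: cvgB; [exact: cvg_id|exact: cvg_cst].
have cg : g y @[y --> x] --> g x by exact: continuous_normal_pdf.
apply: cvgD; (apply: cvgM; first exact: cvg_cst); apply: cvgM => //.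
  apply: cvgM.
    by apply: cvgN; apply: cvgB; [exact: cvg_id|exact: cvg_cst].
  exact: (cvg_comp _ _ ca (@continuous_sin _ _)).
exact: (cvg_comp _ _ ca (@continuous_cos _ _)).
Qed.

(** The condition [e ^+ 2 = 1] treats both ends m + (n+1) and m - (n+1) at once; exp z >= 1 + z
    already yields a bound of order 1/(n+1). *)
Let g_cvg0 (e : R) : e ^+ 2 = 1 -> g (m + e * n.+1%:R) @[n --> \oo] --> (0 : R).
Proof.
move=> e1; apply: (@squeeze_cvgr _ _ _ _ (cst 0) (fun n : nat => (normal_peak s * (s ^+ 2 *+ 2)) / n.+1%:R)).
- near=> n; rewrite normal_pdf_ge0 /=.
  rewrite gE -mulrA ler_pM2l ?normal_peak_gt0 //.
  rewrite mulNr expRN -[leRHS]invf_div.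
  have n0 : (0 : R) < n.+1%:R by [].
  have d0 : 0 < s ^+ 2 *+ 2 by rewrite mulrn_wgt0.
  have D0 : 0 < n.+1%:R / (s ^+ 2 *+ 2) by rewrite divr_gt0.
  rewrite lef_pV2 ?posrE ?expR_gt0 //.
  rewrite addrC addKr exprMn e1 mul1r.
  apply: le_trans (expR_ge1Dx _); rewrite -[leLHS]add0r lerD // ler_pM2r ?invr_gt0 //.
  by rewrite expr2 ler_peMr // ler1n.
- exact: cvg_cst.
- rewrite -[X in _ --> X](mulr0 (normal_peak s * (s ^+ 2 *+ 2))).
  by apply: cvgM; [exact: cvg_cst|exact: cvg_harmonic].
Unshelve. all: by end_near. Qed.

Let h_cvg0 (u e : R) : e ^+ 2 = 1 -> h u (m + e * n.+1%:R) @[n --> \oo] --> (0 : R).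
Proof.
move=> e1; apply: norm_cvg0.
apply: (@squeeze_cvgr _ _ _ _ (cst 0) (fun n : nat => g (m + e * n.+1%:R))).
- near=> n; rewrite normr_ge0 /= normrM [`|g _|]ger0_norm ?normal_pdf_ge0 //.
  by rewrite ler_piMr ?normal_pdf_ge0 // ler_norml sin_le1 sin_geN1.
- exact: cvg_cst.
- exact: g_cvg0.
Unshelve. all: by end_near. Qed.

(** On growing intervals the integral is, by the fundamental theorem of calculus, a difference of
    boundary values of [h u], which tend to 0; dominated convergence identifies the limit with the
    full integral. *)
Let int_h' (u : R) : \int[mu]_x (s ^- 2 * f' u x + u * f u x) = 0.
Proof.
pose A n : set R := `[m - n.+1%:R, m + n.+1%:R]%classic.
have lim1 : \int[mu]_(x in A n) h' u x @[n --> \oo] --> \int[mu]_x h' u x.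
  have := @dominated_convergence _ _ _ mu setT measurableT
    (fun n => EFin \o (h' u \_ (A n))) (EFin \o h' u) (fun x => `|h' u x|%:E).
  case => [n|||||_ _ H].
  - apply/measurable_EFinP; apply/(measurable_restrictT _ _).1 => //.
      exact: measurable_itv.
    by apply: measurable_funTS; exact: continuous_measurable_fun.
  - by apply/measurable_EFinP; exact: continuous_measurable_fun.
  - apply: aeW => x _; apply/fine_cvgP; split; first exact: nearW.
    apply: cvg_near_cst; near=> n; rewrite /= patchE ifT // inE /A /= in_itv/=.
    rewrite -ler_distlC distrC.
    apply: ltW; apply: lt_trans (_ : n%:R < _); last by rewrite ltr_nat.
    by near: n; exact: nbhs_infty_gtr.
  - exact: integrable_norm.
  - apply: aeW => x n _; rewrite lee_fin patchE; case: ifP => _ //.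
    by rewrite normr0.
  rewrite (_ : (fun n => _) = fun n => \int[mu]_x (h' u \_ (A n)) x).
    have fn := integrable_fin_num measurableT (integrable_h' u).
    by rewrite -(fineK fn) in H; exact: fine_cvg H.
  by apply/funext => n; rewrite Rintegral_mkcond.
have E n : \int[mu]_(x in A n) h' u x = h u (m + 1 * n.+1%:R) - h u (m + (-1) * n.+1%:R).
  rewrite /Rintegral (@continuous_FTC2 _ _ (h u)) ?mul1r ?mulN1r //.
  - have n0 : (0 : R) < n.+1%:R by [].
    by rewrite ltrD2l gt0_cp // ltrNl oppr0.
  - by apply: continuous_subspaceT; exact: cont_h'.
  - have ch : continuous (h u).
      move=> x; apply: differentiable_continuous; apply/derivable1_diffP.
      by have [] := is_derive_h u x.
    split=> [x _||]; first by have [] := is_derive_h u x.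
      by apply: cvg_at_right_filter; exact: ch.
    by apply: cvg_at_left_filter; exact: ch.
  - by move=> x _; rewrite derive1E; have [_] := is_derive_h u x.
have lim2 : \int[mu]_(x in A n) h' u x @[n --> \oo] --> (0 : R).
  rewrite (_ : (fun n => _) = (fun n => h u (m + 1 * n.+1%:R) - h u (m + (-1) * n.+1%:R))).
    by rewrite -(subr0 0); apply: cvgB; apply: h_cvg0; rewrite ?sqrrN expr1n.
  by apply/funext => n; exact: E.
exact: (cvg_unique (@Rhausdorff R) lim1 lim2).
Unshelve. all: by end_near. Qed.

Let phi_ode (u : R) : \int[mu]_x f' u x = - (s ^+ 2 * u) * phi u.
Proof.
have := int_h' u; rewrite RintegralD //; last 2 first.
- under [X in integrable _ _ X]eq_fun do rewrite /= EFinM.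
  by apply: integrableZl => //; exact: integrable_f'.
- under [X in integrable _ _ X]eq_fun do rewrite /= EFinM.
  by apply: integrableZl => //; exact: integrable_f.
rewrite !RintegralZl // -/(phi u) => /eqP; rewrite addr_eq0 => /eqP H.
have -> : \int[mu]_x f' u x = s ^+ 2 * (s ^- 2 * \int[mu]_x f' u x).
  by rewrite mulrA divff ?mul1r // gt_eqF.
by rewrite H; ring.
Qed.

Lemma normal_cf (u : R) :
  \int[mu]_x (cos (u * (x - m) + b) * normal_pdf m s x) =
  cos b * expR (- (s ^+ 2 * u ^+ 2 / 2)).
Proof.
rewrite -/(phi u).
(* Integrating factor of the differential equation: [k] has zero derivative, so it equals its value
   at 0, which is cos b. *)
pose k (v : R) : R := phi v * expR (s ^+ 2 * v ^+ 2 / 2).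
have dk (v : R) : is_derive v 1 k 0.
  have dq : is_derive v 1 (fun w : R => s ^+ 2 * w ^+ 2 / 2) (s ^+ 2 * v).
    by apply: is_derive_eq; rewrite /GRing.scale/=; field.
  have dE := is_derive1_comp_eq (is_derive_expR _) dq erefl.
  apply: (is_derive1M_eq (is_derive_phi v) dE).
  by rewrite phi_ode; ring.
have : k u = k 0 by exact: is_derive_0_is_cst.
rewrite /k expr0n/= mulr0 mul0r expR0 mulr1.
have -> : phi 0 = cos b.
  rewrite /phi /f; under eq_Rintegral do rewrite mul0r add0r.
  rewrite RintegralZl //; last exact: integrable_normal_pdf.
  by rewrite /Rintegral integral_normal_pdf mulr1.
by move=> <-; rewrite -mulrA -expRD subrr expR0 mulr1.
Qed.
End normal_cf.

(** * Centered Gaussian variables *)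

Lemma ler_abs_sin (R : realType) (y : R) : `|sin y| <= `|y|.
Proof.
wlog y0 : y / 0 <= y => [H|].
  have [|/ltW y0] := leP 0 y; first exact: H.
  by rewrite -normrN -sinN -(normrN y); apply: H; rewrite oppr_ge0.
have [->|yn0] := eqVneq y 0; first by rewrite sin0.
have {}y0 : 0 < y by rewrite lt_neqAle eq_sym yn0.
have [|c _] := @MVT R sin cos 0 y y0 (fun x _ => is_derive_sin x).
  by apply: continuous_subspaceT; exact: continuous_sin.
rewrite sin0 !subr0 => ->; rewrite normrM ler_piMl // ler_norml cos_le1 cos_geN1 //.
Qed.

Lemma cvg_n_sin (R : realType) (a : R) :
  n.+1%:R * sin (a / n.+1%:R) @[n --> \oo] --> a.
Proof.
have [->|a0] := eqVneq a 0.
  by under eq_fun do rewrite mul0r sin0 mulr0; exact: cvg_cst.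
have /is_derive1P := is_derive_sin (0 : R).
rewrite cos0 sin0 => /cvgr_dnbhsP/(_ (fun n => a / n.+1%:R)) H.
have h_neq0 n : a / n.+1%:R != 0 by rewrite mulf_neq0 // invr_eq0.
have h_cvg0 : a / n.+1%:R @[n --> \oo] --> (0 : R).
  rewrite -[X in _ --> X](mulr0 a); apply: cvgM; first exact: cvg_cst.
  exact: cvg_harmonic.
have K : a * ((a / n.+1%:R)^-1 * (sin (0 + a / n.+1%:R) - 0)) @[n --> \oo] --> a * 1.
  by apply: cvgM; [exact: cvg_cst|exact: H (conj h_neq0 h_cvg0)].
rewrite mulr1 in K.
rewrite (_ : (fun n => _) = (fun n => a * ((a / n.+1%:R)^-1 * (sin (0 + a / n.+1%:R) - 0)))) //.
apply/funext => n; rewrite add0r subr0 mulrA; congr (_ * _).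
by rewrite invf_div mulrCA divff ?mulr1.
Qed.

(* The phase b makes this real identity equivalent to the complex formula for
   the characteristic function; v = 0 is the null variable. *)
Definition cgauss (d : measure_display) (T : measurableType d) (R : realType)
    (P : probability T R) (Z : T -> R) (v : R) : Prop :=
  [/\ measurable_fun setT Z, 0 <= v &
    forall u b, Ex P (fun w => cos (u * Z w + b)) =
      cos b * expR (- (v * u ^+ 2 / 2))].

Section cgauss.
Context {d : measure_display} {T : measurableType d} {R : realType}.
Variable P : probability T R.
Implicit Types (Z : T -> R) (v : R).

Let mcos Z (u b : R) : measurable_fun setT Z ->
  measurable_fun setT (fun w => cos (u * Z w + b)).
Proof.
move=> mZ; apply: (measurableT_comp (f := cos)).
  by apply: continuous_measurable_fun; exact: continuous_cos.
by apply: measurable_funD => //; apply: measurable_funM.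
Qed.

Let cos_ub (x : R) : `|cos x| <= 1.
Proof. by rewrite ler_norml cos_le1 cos_geN1. Qed.

(** The parameter [s] gives the variance [s ^+ 2], whatever its sign; for s = 0 the law is a Dirac
    mass and the exponential factor is 1. *)
Lemma gaussian_rv_cgauss Z : gaussian_rv P Z ->
  exists m v, cgauss P (fun w => Z w - m) v.
Proof.
move=> [mZ [m [s law]]]; exists m, (s ^+ 2); split.
- exact: measurable_funB.
- exact: sqr_ge0.
move=> u b.
pose f (y : R) := cos (u * (y - m) + b).
have mf : measurable_fun setT f.
  apply: (measurableT_comp (f := cos)).
    by apply: continuous_measurable_fun; exact: continuous_cos.
  by apply: measurable_funD => //; apply: measurable_funM => //; exact: measurable_funB.
pose mR := measurableTypeR R.
have mZ' : @measurable_fun _ _ T mR setT Z := mZ.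
have mf' : measurable_fun setT (f : mR -> R) := mf.
have -> : Ex P (fun w => cos (u * (Z w - m) + b)) =
    fine (\int[@pushforward _ _ T mR _ P Z]_(y in [set: mR]) (f y)%:E)%E.
  rewrite integral_pushforward //; first exact/measurable_EFinP.
  apply: (@bounded_integrable _ _ _ P (fun w => f (Z w)) 1) => //.
    exact: measurableT_comp.
  by move=> w; exact: cos_ub.
have [s0|s0] := eqVneq s 0.
  rewrite (eq_measure_integral (@dirac _ mR m _)); last first.
    by move=> A mA _; have := law A mA; rewrite s0 eqxx.
  rewrite integral_dirac //; last exact/measurable_EFinP.
  by rewrite diracT mul1e /= /f subrr mulr0 add0r s0 expr0n/= !mul0r oppr0 expR0 mulr1.
rewrite (eq_measure_integral (normal_prob m s)); last first.
  by move=> A mA _; have := law A mA; rewrite (negbTE s0).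
rewrite integral_normal_prob //; last first.
  by apply: (@bounded_integrable _ _ _ (normal_prob m s) f 1) => // w; exact: cos_ub.
exact: normal_cf.
Qed.

(** The functions 2 (n+1)^2 (1 - cos (Z / (n+1))) are squares of 2 (n+1) sin (Z / (2 (n+1))): they
    tend to Z^2 and stay below it. Their expectations are explicit and tend to v, so Fatou's lemma
    gives integrability of Z^2, after which dominated convergence gives the value. *)
Lemma cgauss_sqr Z v : cgauss P Z v ->
  P.-integrable setT (EFin \o (fun w => Z w ^+ 2)) /\ Ex P (fun w => Z w ^+ 2) = v.
Proof.
move=> [mZ v0 ZE].
have mZ2 : measurable_fun setT (fun w => Z w ^+ 2) by exact: measurable_funX.
pose f n w := 2 * n.+1%:R ^+ 2 * (1 - cos (n.+1%:R^-1 * Z w + 0)).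
have fE n w : f n w = (n.+1%:R * (2 * sin (Z w / 2 / n.+1%:R))) ^+ 2.
  rewrite /f addr0 [_^-1 * _]mulrC.
  have -> : Z w / n.+1%:R = (Z w / 2 / n.+1%:R) + (Z w / 2 / n.+1%:R).
    by rewrite -mulr2n -mulr_natl -!mulrA; field.
  set y := Z w / 2 / _; rewrite cosD -!expr2.
  by rewrite !exprMn; have := cos2Dsin2 y; move: (cos y) (sin y) => c z h; rewrite (_ : c ^+ 2 = 1 - z ^+ 2); [ring|rewrite -h; ring].
have ff w : f n w @[n --> \oo] --> Z w ^+ 2.
  under eq_fun do rewrite fE.
  have K : 2 * (n.+1%:R * sin (Z w / 2 / n.+1%:R)) @[n --> \oo] --> 2 * (Z w / 2).
    by apply: cvgM; [exact: cvg_cst|exact: cvg_n_sin].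
  rewrite (_ : 2 * (Z w / 2) = Z w) in K; last by field.
  have : n.+1%:R * (2 * sin (Z w / 2 / n.+1%:R)) @[n --> \oo] --> Z w.
    rewrite (_ : (fun n => _) = (fun n => 2 * (n.+1%:R * sin (Z w / 2 / n.+1%:R)))) //.
    by apply/funext => n; rewrite mulrCA.
  by move=> H; rewrite expr2; under eq_fun do rewrite expr2; exact: cvgM.
have mf n : measurable_fun setT (f n).
  by apply: measurable_funM => //; apply: measurable_funB => //; exact: mcos.
have f0 n w : 0 <= f n w by rewrite fE sqr_ge0.
have fZ n w : f n w <= Z w ^+ 2.
  rewrite fE -[leRHS]real_normK ?num_real // -[leLHS]real_normK ?num_real //.
  rewrite ler_sqr ?nnegrE // !normrM !normr_nat.
  have := ler_abs_sin (Z w / 2 / n.+1%:R); rewrite !normrM !normfV !normr_nat => h.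
  apply: le_trans (_ : n.+1%:R * (2 * (`|Z w| / 2 / n.+1%:R)) <= _).
    by apply: ler_wpM2l => //; apply: ler_wpM2l.
  by rewrite le_eqVlt; apply/orP; left; apply/eqP; field.
have icos n : P.-integrable setT (EFin \o (fun w => - cos (n.+1%:R^-1 * Z w + 0))).
  apply: (@bounded_integrable _ _ _ P _ 1); last by move=> w; rewrite normrN cos_ub.
  by apply: measurableT_comp => //; exact: mcos.
have i1 n : P.-integrable setT (EFin \o (fun w => 1 - cos (n.+1%:R^-1 * Z w + 0))).
  under [X in integrable _ _ X]eq_fun do rewrite /= EFinD.
  apply: integrableD => //; last exact: icos.
  exact: finite_measure_integrable_cst.
have Ef n : Ex P (f n) = 2 * n.+1%:R ^+ 2 * (1 - expR (- (v * n.+1%:R^-1 ^+ 2 / 2))).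
  rewrite /f ExZ // ExD //; last exact: finite_measure_integrable_cst.
  rewrite Ex_cst; congr (_ * (1 + _)).
  under eq_Ex do rewrite -mulN1r; rewrite ExZ ?ZE ?cos0 ?mul1r ?mulN1r //.
  by apply: (@bounded_integrable _ _ _ P _ 1) => [|w]; [exact: mcos|exact: cos_ub].
have Efv : Ex P (f n) @[n --> \oo] --> v.
  pose x n : R := v * n.+1%:R^-1 ^+ 2 / 2.
  have x0 n : 0 <= x n by rewrite /x !mulr_ge0 // sqr_ge0.
  have nx n : 2 * n.+1%:R ^+ 2 * x n = v by rewrite /x; field.
  (* Since 2 (n+1)^2 x = v, this is the enclosure x / (1 + x) <= 1 - exp (- x) <= x. *)
  apply: (@squeeze_cvgr _ _ _ _ (fun n => v * (1 + x n)^-1) (cst v)).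
  - near=> n; rewrite Ef -/(x n) /= -(nx n).
    have : 0 < 2 * n.+1%:R ^+ 2 :> R by rewrite mulr_gt0 // exprn_gt0.
    move: (2 * n.+1%:R ^+ 2) => c c0.
    have e1 := expR_ge1Dx (x n); have e2 := expR_ge1Dx (- x n).
    have p1 : 0 < 1 + x n by have := x0 n; lra.
    rewrite -[leLHS]mulrA !ler_pM2l //; apply/andP; split; last lra.
    have e3 : expR (- x n) <= (1 + x n)^-1.
      by rewrite expRN lef_pV2 ?posrE ?expR_gt0.
    apply: le_trans (_ : 1 - (1 + x n)^-1 <= _); last lra.
    by rewrite le_eqVlt; apply/orP; left; apply/eqP; field; rewrite gt_eqF.
  - have xc0 : x n @[n --> \oo] --> v * (0 * 0) / 2.
      apply: cvgM; last exact: cvg_cst.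
      apply: cvgM; first exact: cvg_cst.
      by under eq_fun do rewrite expr2; apply: cvgM; exact: cvg_harmonic.
    have K : v * (1 + x n)^-1 @[n --> \oo] --> v * (1 + v * (0 * 0) / 2)^-1.
      apply: cvgM; first exact: cvg_cst.
      apply: cvgV; first by rewrite !mulr0 mul0r addr0 oner_neq0.
      by apply: cvgD => //; exact: cvg_cst.
    by rewrite !mulr0 mul0r addr0 invr1 mulr1 in K.
  - exact: cvg_cst.
have intf n : P.-integrable setT (EFin \o f n).
  under [X in integrable _ _ X]eq_fun do rewrite /= EFinM.
  by apply: integrableZl => //; exact: i1.
have iZ : P.-integrable setT (EFin \o (fun w => Z w ^+ 2)).
  apply/integrableP; split; first exact/measurable_EFinP.
  have mEf n : measurable_fun setT (EFin \o f n) by apply/measurable_EFinP.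
  have := @fatou _ _ _ P setT measurableT (fun n => EFin \o f n) mEf (fun n w _ => f0 n w).
  have -> : (fun n => \int[P]_w (EFin \o f n) w)%E = EFin \o (fun n => Ex P (f n)).
    by apply/funext => n /=; rewrite /Ex /Rintegral fineK //; exact: (integrable_fin_num measurableT (intf n)).
  rewrite (cvg_limn_einf_sup (_ : _ --> v%:E)).1; last first.
    by apply/fine_cvgP; split; [exact: nearW|exact: Efv].
  move=> H; apply: le_lt_trans (ltry v); apply: le_trans H.
  rewrite le_eqVlt; apply/orP; left; apply/eqP; apply: eq_integral => w _.
  rewrite (cvg_limn_einf_sup (_ : _ --> (Z w ^+ 2)%:E)).1; last first.
    by apply/fine_cvgP; split; [exact: nearW|exact: ff].
  by rewrite /= ger0_norm // sqr_ge0.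
split=> //.
have fg n w : `|f n w| <= Z w ^+ 2 by rewrite ger0_norm.
have [_ H] := Ex_dct mf fg iZ ff.
exact: (cvg_unique (@Rhausdorff R) H Efv).
Unshelve. all: by end_near. Qed.

(** With phase - pi/2 the formula says that sin (Z / (n+1)) has mean 0, and (n+1) sin (Z / (n+1))
    tends to Z, dominated by |Z|. *)
Lemma cgauss_mean Z v : cgauss P Z v ->
  P.-integrable setT (EFin \o Z) /\ Ex P Z = 0.
Proof.
move=> ZG; have [iZ2 _] := cgauss_sqr ZG; have [mZ _ ZE] := ZG.
have iZ : P.-integrable setT (EFin \o Z).
  apply: (@le_integrable _ _ _ P _ measurableT _ (EFin \o (fun w => 1 + Z w ^+ 2))).
  - exact/measurable_EFinP.
  - move=> w _; rewrite lee_fin [leRHS]ger0_norm ?addr_ge0 ?sqr_ge0 //.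
    rewrite -[Z w ^+ 2]real_normK ?num_real //.
    have := sqr_ge0 (`|Z w| - 1); move: `|Z w| (normr_ge0 (Z w)) => z z0.
    rewrite expr2; nra.
  - under [X in integrable _ _ X]eq_fun do rewrite /= EFinD.
    apply: integrableD => //; exact: finite_measure_integrable_cst.
split=> //.
pose f n w := n.+1%:R * cos (n.+1%:R^-1 * Z w + - (pi / 2)).
have fE n w : f n w = n.+1%:R * sin (Z w / n.+1%:R).
  by rewrite /f cosB cos_pihalf sin_pihalf mulr0 add0r mulr1 mulrC [Z w * _]mulrC mulrC.
have [||||_] := @Ex_dct _ _ _ P f Z (fun w => `|Z w|).
- by move=> n; apply: measurable_funM => //; exact: mcos.
- move=> n w; rewrite fE normrM ger0_norm // mulrC -ler_pdivlMr //.
  by apply: le_trans (ler_abs_sin _) _; rewrite normrM normfV [`|n.+1%:R|]ger0_norm.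
- exact: integrable_norm.
- by move=> w; under eq_fun do rewrite fE; exact: cvg_n_sin.
move=> H; apply: (cvg_unique (@Rhausdorff R) H).
apply: cvg_near_cst; near=> n.
rewrite /f ExZ; last by apply: (@bounded_integrable _ _ _ P _ 1) => [|w]; [exact: mcos|exact: cos_ub].
by rewrite ZE cosN cos_pihalf mul0r mulr0.
Unshelve. all: by end_near. Qed.

(** The cosine expectations converge by bounded convergence. The limit at frequency 1/(k+1) tends to
    1 as k grows, so it is positive for some k; the logarithm at that single frequency yields
    convergence of the variances. *)
Lemma cgauss_lim (z : nat -> T -> R) (v : nat -> R) Z :
  (forall n, cgauss P (z n) (v n)) -> (forall w, z n w @[n --> \oo] --> Z w) ->
  exists2 v0, v n @[n --> \oo] --> v0 & cgauss P Z v0.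
Proof.
move=> zG zZ.
have mZ : measurable_fun setT Z.
  by apply: (@measurable_fun_cvg _ _ _ _ z) => [n|w _]; [have [] := zG n|exact: zZ].
have cvg_cf u b : cos b * expR (- (v n * u ^+ 2 / 2)) @[n --> \oo] -->
    Ex P (fun w => cos (u * Z w + b)).
  have H : Ex P (fun w => cos (u * z n w + b)) @[n --> \oo] -->
    Ex P (fun w => cos (u * Z w + b)).
    apply: (@cvg_Ex _ _ _ _ _ _ 1) => [n|n w|w].
    - by apply: mcos; have [] := zG n.
    - exact: cos_ub.
    - apply: continuous_cvg; first exact: continuous_cos.
      by apply: cvgD; [apply: cvgM => //; exact: cvg_cst|exact: cvg_cst].
  rewrite (_ : (fun n => _) = (fun n => Ex P (fun w => cos (u * z n w + b)))) //.
  by apply/funext => n; have [_ _ ->] := zG n.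
have cvg1 : Ex P (fun w => cos (k.+1%:R^-1 * Z w + 0)) @[k --> \oo] --> (1 : R).
  rewrite -[X in _ --> X](Ex_cst P).
  apply: (@cvg_Ex _ _ _ _ _ _ 1) => [k|k w|w]; [exact: mcos|exact: cos_ub|].
  rewrite -[X in _ --> X]cos0; apply: continuous_cvg; first exact: continuous_cos.
  rewrite -[X in _ --> X]addr0; apply: cvgD; last exact: cvg_cst.
  rewrite -[X in _ --> X](mul0r (Z w)); apply: cvgM; last exact: cvg_cst.
  exact: cvg_harmonic.
have [k k0] : exists k : nat, 0 < Ex P (fun w => cos (k.+1%:R^-1 * Z w + 0)).
  near \oo => k; exists k; near: k; apply: (cvgr_gt _ cvg1); exact: ltr01.
set u : R := k.+1%:R^-1 in k0; have u0 : 0 < u by rewrite /u invr_gt0.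
set c := Ex _ _ in k0.
pose v0 := - 2 / u ^+ 2 * ln c.
have vv0 : v n @[n --> \oo] --> v0.
  have : ln (cos 0 * expR (- (v n * u ^+ 2 / 2))) @[n --> \oo] --> ln c.
    apply: continuous_cvg; first exact: continuous_ln.
    exact: cvg_cf.
  move=> /(cvgM (cvg_cst (- 2 / u ^+ 2))).
  rewrite (_ : (_ \* _) = v) //.
  apply/funext => n /=; rewrite cos0 mul1r expRK; field.
  by rewrite gt_eqF.
exists v0 => //; split=> //.
  rewrite -(cvg_lim _ vv0) //; apply: limr_ge; first by apply/cvg_ex; exists v0.
  by apply: nearW => n; have [] := zG n.
move=> a b; apply: (cvg_unique (@Rhausdorff R) (cvg_cf a b)).
apply: cvgM; first exact: cvg_cst.
apply: continuous_cvg; first exact: continuous_expR.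
apply: cvgN; apply: cvgM; last exact: cvg_cst.
by apply: cvgM => //; exact: cvg_cst.
Unshelve. all: by end_near. Qed.
End cgauss.

(** * Gaussian spaces *)

(** Joint Gaussianity of a tuple is expressed as membership in one linear space of centered Gaussian
    variables; the laws of all linear forms are then fixed by covariances. *)
Definition gspace (d : measure_display) (T : measurableType d) (R : realType)
    (P : probability T R) (V : set (T -> R)) : Prop :=
  (forall Z, V Z -> exists v, cgauss P Z v) /\
  (forall a b Z W, V Z -> V W -> V (fun w => a * Z w + b * W w)).

(** Convergence is asked at every outcome, so measurability passes to the limit. A single sequence
    is used: one closure accounts for one differentiation, and it is iterated for second
    derivatives. *)
Definition ptclosure (T : Type) (R : realType) (V : set (T -> R)) : set (T -> R) :=
  [set Z | exists2 z : nat -> T -> R,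
    forall n, V (z n) & forall w, z n w @[n --> \oo] --> Z w].

(** An uncentered second moment, equal to the covariance on the centered variables of a [gspace]. *)
Definition cov (d : measure_display) (T : measurableType d) (R : realType)
  (P : probability T R) (Z W : T -> R) : R := Ex P (fun w => Z w * W w).

Section gspace.
Context {d : measure_display} {T : measurableType d} {R : realType}.
Variable P : probability T R.
Implicit Types (Z W U : T -> R) (V : set (T -> R)).

Lemma covC Z W : cov P Z W = cov P W Z.
Proof. by apply: eq_Ex => w; rewrite mulrC. Qed.

Lemma sub_ptclosure V : V `<=` ptclosure V.
Proof. by move=> Z VZ; exists (fun=> Z) => // w; exact: cvg_cst. Qed.

Lemma ptclosure_gspace V : gspace P V -> gspace P (ptclosure V).
Proof.
move=> [Vg Vl]; split=> [Z [z Vz zZ]|a b Z W [z Vz zZ] [y Vy yW]].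
  have /choice[v vE] : forall n, exists v, cgauss P (z n) v by move=> n; exact: Vg.
  by have [v0 _ ?] := cgauss_lim vE zZ; exists v0.
exists (fun n w => a * z n w + b * y n w) => [n|w]; first exact: Vl.
by apply: cvgD; apply: cvgM => //; exact: cvg_cst.
Qed.

Variable V : set (T -> R).
Hypothesis gV : gspace P V.

Lemma gspace_cgauss Z : V Z -> cgauss P Z (cov P Z Z).
Proof.
move=> /gV.1[v ZG]; rewrite (_ : cov P Z Z = v) //.
by rewrite -(cgauss_sqr ZG).2; apply: eq_Ex => w; rewrite expr2.
Qed.

Lemma gspace_measurable Z : V Z -> measurable_fun setT Z.
Proof. by move=> /gspace_cgauss[]. Qed.

Lemma cov_ge0 Z : V Z -> 0 <= cov P Z Z.
Proof. by move=> /gspace_cgauss[]. Qed.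

Lemma gspaceM_integrable Z W : V Z -> V W ->
  P.-integrable setT (EFin \o (fun w => Z w * W w)).
Proof.
move=> VZ VW; have mZ := gspace_measurable VZ; have mW := gspace_measurable VW.
have [iZ _] := cgauss_sqr (gspace_cgauss VZ).
have [iW _] := cgauss_sqr (gspace_cgauss VW).
apply: (@le_integrable _ _ _ P _ measurableT _ (EFin \o (fun w => Z w ^+ 2 + W w ^+ 2))).
- by apply/measurable_EFinP; exact: measurable_funM.
- move=> w _; rewrite lee_fin [leRHS]ger0_norm ?addr_ge0 ?sqr_ge0 // normrM.
  rewrite -[Z w ^+ 2]real_normK ?num_real // -[W w ^+ 2]real_normK ?num_real //.
  have := sqr_ge0 (`|Z w| - `|W w|).
  move: `|Z w| `|W w| (normr_ge0 (Z w)) (normr_ge0 (W w)) => z y z0 y0.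
  rewrite !expr2; nra.
- under [X in integrable _ _ X]eq_fun do rewrite /= EFinD.
  exact: integrableD.
Qed.

Lemma covDl a b Z W U : V Z -> V W -> V U ->
  cov P (fun w => a * Z w + b * W w) U = a * cov P Z U + b * cov P W U.
Proof.
move=> VZ VW VU.
have iZ := gspaceM_integrable VZ VU; have iW := gspaceM_integrable VW VU.
rewrite /cov -ExZ // -ExZ // -ExD.
- by apply: eq_Ex => w; ring.
- under [X in integrable _ _ X]eq_fun do rewrite /= EFinM.
  exact: integrableZl.
- under [X in integrable _ _ X]eq_fun do rewrite /= EFinM.
  exact: integrableZl.
Qed.

Lemma gspace0 Z : V Z -> V (fun=> 0).
Proof.
move=> VZ; have := gV.2 0 0 Z Z VZ VZ; congr V.
by apply/funext => w; rewrite !mul0r addr0.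
Qed.

Lemma gspace_sum (I : Type) (s : seq I) (a : I -> R) (Z : I -> T -> R) : V !=set0 ->
  (forall k, V (Z k)) -> V (fun w => \sum_(k <- s) a k * Z k w).
Proof.
move=> [W /gspace0 V0] VZ; elim: s => [|k s IH].
  by rewrite (_ : (fun w => _) = fun=> 0) //; apply/funext => w; rewrite big_nil.
have := gV.2 (a k) 1 _ _ (VZ k) IH.
by congr V; apply/funext => w; rewrite mul1r big_cons.
Qed.

Lemma cov_suml (I : Type) (s : seq I) (a : I -> R) (Z : I -> T -> R) U : V U ->
  (forall k, V (Z k)) ->
  cov P (fun w => \sum_(k <- s) a k * Z k w) U = \sum_(k <- s) a k * cov P (Z k) U.
Proof.
move=> VU VZ; have V0 : V !=set0 by exists U.
elim: s => [|k s IH].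
  rewrite big_nil /cov -[RHS](Ex_cst P); apply: eq_Ex => w; by rewrite big_nil mul0r.
rewrite big_cons -IH -[X in _ + X]mul1r -covDl //; last exact: gspace_sum.
by apply: eq_Ex => w; rewrite mul1r big_cons.
Qed.

(** Variances converge by [cgauss_lim], which rests on Gaussianity; polarization then handles
    covariances. *)
Lemma cov_cvg (z y : nat -> T -> R) Z Y : (forall n, V (z n)) -> (forall n, V (y n)) ->
  V Z -> V Y -> (forall w, z n w @[n --> \oo] --> Z w) ->
  (forall w, y n w @[n --> \oo] --> Y w) ->
  cov P (z n) (y n) @[n --> \oo] --> cov P Z Y.
Proof.
move=> Vz Vy VZ VY zZ yY.
have var_cvg (u : nat -> T -> R) U : (forall n, V (u n)) -> V U ->
    (forall w, u n w @[n --> \oo] --> U w) ->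
    cov P (u n) (u n) @[n --> \oo] --> cov P U U.
  move=> Vu VU uU.
  have [v0 + UG] := cgauss_lim (fun n => gspace_cgauss (Vu n)) uU.
  have [_ <-] := cgauss_sqr UG.
  by under [X in _ --> X -> _]eq_Ex do rewrite expr2.
have polar U W : V U -> V W -> cov P U W = (cov P (fun w => 1 * U w + 1 * W w)
    (fun w => 1 * U w + 1 * W w) - cov P U U - cov P W W) / 2.
  move=> VU VW; have V1 : V (fun w => 1 * U w + 1 * W w) by exact: gV.2.
  rewrite (covDl _ _ VU VW V1) !(covC _ (fun w => 1 * U w + 1 * W w)).
  rewrite (covDl _ _ VU VW VU) (covDl _ _ VU VW VW).
  by rewrite (covC W U); field.
rewrite (polar Z) //.
rewrite (_ : (fun n => _) = fun n => (cov P (fun w => 1 * z n w + 1 * y n w)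
    (fun w => 1 * z n w + 1 * y n w) - cov P (z n) (z n) - cov P (y n) (y n)) / 2); last first.
  by apply/funext => n; rewrite -polar.
apply: cvgM; last exact: cvg_cst.
apply: cvgB; last exact: var_cvg.
apply: cvgB; last exact: var_cvg.
apply: (var_cvg (fun n w => 1 * z n w + 1 * y n w)).
- by move=> n; exact: gV.2.
- exact: gV.2.
- move=> w; apply: cvgD; apply: cvgM; first exact: cvg_cst.
  + exact: zZ.
  + exact: cvg_cst.
  + exact: yY.
Qed.

End gspace.

(** * Kernels and joint laws *)

Section cgauss_prod.
Context {d d2 : measure_display} {T : measurableType d} {T2 : measurableType d2}
  {R : realType}.
Variables (P : probability T R) (P2 : probability T2 R).

Lemma Ex_prod (f : T * T2 -> R) (K : R) : measurable_fun setT f ->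
  (forall w, `|f w| <= K) ->
  Ex (P \x P2)%E f = Ex P (fun w => Ex P2 (fun w2 => f (w, w2))).
Proof.
move=> mf fK.
have mf2 w : measurable_fun setT (fun w2 => f (w, w2)).
  by apply: (measurableT_comp mf); exact: measurable_pair1.
have if2 w : P2.-integrable setT (EFin \o (fun w2 => f (w, w2))).
  by apply: (@bounded_integrable _ _ _ P2 _ K) => // w2; exact: fK.
have if1 : (P \x P2)%E.-integrable setT (EFin \o f).
  exact: (@bounded_integrable _ _ _ (P \x P2)%E f K).
rewrite {1}/Ex /Rintegral -(integral12_prod_meas1 if1); congr fine.
apply: eq_integral => w _; rewrite /Ex /Rintegral fineK //.
exact: (integrable_fin_num measurableT (if2 w)).
Qed.

(** The two variables are independent on the product space: by Fubini, the inner integral absorbs u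
    Z + b as a phase and leaves the Gaussian factor of [M]. *)
Lemma cgauss_prod (Z : T -> R) (M : T2 -> R) (v v2 : R) :
  cgauss P Z v -> cgauss P2 M v2 ->
  cgauss (P \x P2)%E (fun w => Z w.1 + M w.2) (v + v2).
Proof.
move=> [mZ v0 ZE] [mM v20 ME].
have mZM : measurable_fun setT (fun w : T * T2 => Z w.1 + M w.2).
  by apply: measurable_funD; [exact: (measurableT_comp mZ)|exact: (measurableT_comp mM)].
split=> //; first exact: addr_ge0.
move=> u b; rewrite (Ex_prod (K := 1)); last 2 first.
- apply: (measurableT_comp (f := cos)).
    by apply: continuous_measurable_fun; exact: continuous_cos.
  by apply: measurable_funD => //; apply: measurable_funM.
- by move=> w; rewrite ler_norml cos_le1 cos_geN1.
rewrite (_ : (fun w => _) = fun w => expR (- (v2 * u ^+ 2 / 2)) * cos (u * Z w + b)).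
  rewrite ExZ ?ZE; first by rewrite mulrCA -expRD; congr (_ * expR _); field.
  apply: (@bounded_integrable _ _ _ P _ 1) => [|w]; last by rewrite ler_norml cos_le1 cos_geN1.
  apply: (measurableT_comp (f := cos)).
    by apply: continuous_measurable_fun; exact: continuous_cos.
  by apply: measurable_funD => //; apply: measurable_funM.
apply/funext => w; rewrite mulrC -ME; apply: eq_Ex => w2 /=.
by congr cos; ring.
Qed.
End cgauss_prod.

Definition push (d d' : measure_display) (T : measurableType d) (Y : measurableType d')
    (R : realType) (mu : {measure set T -> \bar R}) (f : T -> Y)
    (mf : measurable_fun setT f) : {measure set Y -> \bar R} :=
  measure_function_pushforward__canonical__measure_function_Measure mu mf.

Section random_kernel.
Context {d d2 d3 : measure_display} {X : measurableType d} {T2 : measurableType d2}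
  {Y : measurableType d3} {R : realType}.
Variables (P2 : probability T2 R) (phi : X * T2 -> Y).
Hypothesis mphi : measurable_fun setT phi.

(** The law of [phi (x, w2)] for [w2] drawn from [P2]; measurability in [x] is that of the measure
    of sections. *)
Definition random_kernel (mphi : measurable_fun setT phi) (x : X) :
  {measure set Y -> \bar R} :=
  push P2 (measurableT_comp mphi (measurable_pair1 x)).

Let measurable_random_kernel (U : set Y) : measurable U ->
  measurable_fun setT (random_kernel mphi ^~ U).
Proof.
move=> mU.
rewrite (_ : (fun x => _) = P2 \o xsection (phi @^-1` U)).
  apply: measurable_fun_xsection; rewrite -[X in measurable X]setTI; exact: mphi.
apply/funext => x /=; rewrite /random_kernel /push /= /pushforward; congr (P2 _).
by apply/seteqP; split=> w /=; rewrite /xsection/= inE.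
Qed.

HB.instance Definition _ := isKernel.Build _ _ _ _ _ (random_kernel mphi)
  measurable_random_kernel.

Let random_kernel_prob x : random_kernel mphi x setT = 1%E.
Proof.
rewrite /random_kernel /push /= /pushforward preimage_setT.
exact: (@probability_setT _ _ _ P2).
Qed.

HB.instance Definition _ := Kernel_isProbability.Build _ _ _ _ _
  (random_kernel mphi) random_kernel_prob.

(** When [w2] is independent of [Z], the conditional law of [phi (Z, w2)] given [Z] is the kernel
    evaluated at [Z]; the product measure is itself defined as an integral over sections. *)
Lemma random_kernel_prod d0 (T : measurableType d0) (P : probability T R) (Z : T -> X)
  (A : set Y) (B : set X) : measurable_fun setT Z -> measurable A -> measurable B ->
  (P \x P2)%E ([set w | A (phi (Z w.1, w.2))] `&` [set w | B (Z w.1)]) =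
  (\int[P]_(w in Z @^-1` B) random_kernel mphi (Z w) A)%E.
Proof.
move=> mZ mA mB; rewrite [LHS]/product_measure1 [RHS]integral_mkcond.
apply: eq_integral => w _ /=; rewrite patchE.
case: ifPn => [|/negP]; rewrite inE /= => ZwB.
  rewrite /random_kernel /push /= /pushforward /=; congr (P2 _).
  apply/seteqP; split=> w2 /=; rewrite /xsection/= inE/=; first by case.
  by [].
rewrite (_ : xsection _ _ = set0) ?measure0 //.
by apply/seteqP; split=> w2 //=; rewrite /xsection/= inE/= => -[_]; exact: ZwB.
Qed.
End random_kernel.

Section joint_law.
Context {d d' : measure_display} {T : measurableType d} {T' : measurableType d'}
  {R : realType} {N : nat}.
Variables (P : probability T R) (P' : probability T' R).
Variables (Y : T -> 'M[R]_N) (Z : T -> R) (Y' : T' -> 'M[R]_N) (Z' : T' -> R).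
Let I := ('I_N * 'I_N)%type.
Hypotheses (mY : forall ij, measurable_fun setT (fun w => entry ij (Y w)))
  (mZ : measurable_fun setT Z)
  (mY' : forall ij, measurable_fun setT (fun w => entry ij (Y' w)))
  (mZ' : measurable_fun setT Z').
Hypothesis eq_cos : forall (a : I -> R) (r b : R),
  Ex P (fun w => cos (\sum_ij a ij * entry ij (Y w) + r * Z w + b)) =
  Ex P' (fun w => cos (\sum_ij a ij * entry ij (Y' w) + r * Z' w + b)).

(** The index [None] adjoins the scalar to the matrix entries, so that the orthant criterion applies
    to the joint vector. *)
Let coord (S : Type) (F : S -> 'M[R]_N) (G : S -> R) (o : option I) (w : S) : R :=
  if o is Some ij then entry ij (F w) else G w.

Let joint_orthant c r : P (orthant (fun ij w => entry ij (Y w)) c `&` Z @^-1` `]r, +oo[) =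
  P' (orthant (fun ij w => entry ij (Y' w)) c `&` Z' @^-1` `]r, +oo[).
Proof.
pose c' o := if o is Some ij then c ij else r.
have E (S : Type) (F : S -> 'M[R]_N) (G : S -> R) :
    orthant (fun ij w => entry ij (F w)) c `&` G @^-1` `]r, +oo[ =
    orthant (coord F G) c'.
  apply/seteqP; split=> w /=; rewrite in_itv/= andbT.
    by move=> [h1 h2] [ij|] /=.
  by move=> h; split=> [ij|]; [exact: (h (Some ij))|exact: (h None)].
have sumE (S : Type) (F : S -> 'M[R]_N) (G : S -> R) (a : option I -> R) w :
    \sum_o a o * coord F G o w = \sum_ij a (Some ij) * entry ij (F w) + a None * G w.
  rewrite (bigD1 None) //= addrC; congr (_ + _).
  rewrite (@reindex_omap _ _ _ _ _ Some id) /=; last by case.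
  by apply: eq_bigl => ij; rewrite eqxx.
rewrite !E; apply: eq_orthant.
- by case.
- by case.
- by move=> a b; under eq_Ex do rewrite sumE; under [RHS]eq_Ex do rewrite sumE.
Qed.

Let measurable_orthant d0 (T0 : measurableType d0) (F : T0 -> 'M[R]_N) c :
  (forall ij, measurable_fun setT (fun w => entry ij (F w))) ->
  measurable (orthant (fun ij w => entry ij (F w)) c).
Proof.
move=> mF; rewrite (_ : orthant _ c = F @^-1` orthant (@entry R N) c) //.
rewrite -[X in measurable X]setTI; apply: (measurable_mx mF) => //.
by rewrite borel_mxE; apply: sub_sigma_algebra; exists c.
Qed.

(** Two successive pi-system arguments: for fixed [B], orthants determine the measure of [A]
    restricted to Z in [B]; for a fixed orthant, half-lines determine the measure of [B]. *)
Lemma joint_law (A : set (borel_mx R N)) (B : set R) : measurable A -> measurable B ->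
  P (Y @^-1` A `&` Z @^-1` B) = P' (Y' @^-1` A `&` Z' @^-1` B).
Proof.
move=> mA mB.
have mZB : measurable (Z @^-1` B) by rewrite -[X in measurable X]setTI; exact: mZ.
have mZB' : measurable (Z' @^-1` B) by rewrite -[X in measurable X]setTI; exact: mZ'.
have mYm := measurable_mx mY; have mYm' := measurable_mx mY'.
pose m1 : {measure set (borel_mx R N) -> \bar R} :=
  push (mrestr P mZB) mYm.
pose m2 : {measure set (borel_mx R N) -> \bar R} :=
  push (mrestr P' mZB') mYm'.
apply: (@mx_measure_unique R N m1 m2) => // [|c].
  rewrite /m1 /= /pushforward /mrestr preimage_setT setTI.
  exact: le_lt_trans (probability_le1 P mZB) (ltry 1).
rewrite /m1 /m2 /= /pushforward /mrestr.
have mo := measurable_orthant c mY; have mo' := measurable_orthant c mY'.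
pose n1 : {measure set R -> \bar R} := push (mrestr P mo) mZ.
pose n2 : {measure set R -> \bar R} := push (mrestr P' mo') mZ'.
suff : n1 B = n2 B by rewrite /n1 /n2 /= /pushforward /mrestr setIC => ->; rewrite setIC.
have H := @measure_unique _ R R (@RGenOInfty.G R) (fun n : nat => `](- n%:R : R), +oo[%classic) _ _ _ _ n1 n2.
apply: H => //.
- exact: RGenOInfty.measurableE.
- move=> _ _ [x ->] [y ->]; exists (Num.max x y).
  apply/seteqP; split=> z /=; rewrite !in_itv/= !andbT gt_max; first by move=> [-> ->].
  by move=> /andP[].
- by move=> n; exists (- n%:R).
- apply/seteqP; split=> // z _; near \oo => n; exists n => //=.
  rewrite in_itv/= andbT ltrNl; apply: le_lt_trans (ler_norm _) _; rewrite normrN.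
  by near: n; exact: nbhs_infty_gtr.
- move=> _ [r ->]; rewrite /n1 /n2 /= /pushforward /mrestr setIC [in RHS]setIC.
  exact: joint_orthant.
- move=> n; rewrite /n1 /= /pushforward /mrestr.
  apply: le_lt_trans (probability_le1 P _) (ltry 1).
  by apply: measurableI => //; rewrite -[X in measurable X]setTI; exact: mZ.
Unshelve. all: by end_near. Qed.
End joint_law.

(** * Multivariate calculus *)

Lemma is_derive1_seqP (R : realType) (f : R -> R) (x l : R) :
  is_derive x 1 f l <->
  (forall h : nat -> R, (forall n, h n != 0) -> h n @[n --> \oo] --> 0 ->
    (h n)^-1 * (f (x + h n) - f x) @[n --> \oo] --> l).
Proof.
rewrite is_derive1P cvgr_dnbhsP.
by split=> [H h h0 hc|H h [h0 hc]]; exact: H.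
Qed.

Lemma cvg_sum_seq (R : realType) (I : Type) (s : seq I) (f : I -> nat -> R) (l : I -> R) :
  (forall i, f i n @[n --> \oo] --> l i) ->
  \sum_(i <- s) f i n @[n --> \oo] --> \sum_(i <- s) l i.
Proof.
move=> fl; elim: s => [|i s IH].
  rewrite big_nil; under eq_fun do rewrite big_nil; exact: cvg_cst.
by rewrite big_cons; under eq_fun do rewrite big_cons; exact: cvgD.
Qed.

Lemma is_derive1_sum (R : realType) (I : Type) (s : seq I) (f : I -> R -> R)
    (x : R) (l : I -> R) : (forall i, is_derive x 1 (f i) (l i)) ->
  is_derive x 1 (fun y => \sum_(i <- s) f i y) (\sum_(i <- s) l i).
Proof.
move=> fl; elim: s => [|i s IH].
  rewrite big_nil (_ : (fun y => _) = cst 0); first exact: is_derive_cst.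
  by apply/funext => y; rewrite big_nil.
rewrite big_cons (_ : (fun y => _) = f i \+ (fun y => \sum_(j <- s) f j y)).
  exact: is_deriveD.
by apply/funext => y; rewrite big_cons.
Qed.

Lemma near_is_derive1 (R : realType) (f g : R -> R) (x l : R) :
  (\forall y \near x, f y = g y) -> is_derive x 1 g l -> is_derive x 1 f l.
Proof.
move=> fg /is_derive1P gl; apply/is_derive1P.
have fgx : f x = g x by exact: nbhs_singleton fg.
apply: cvg_trans gl; apply: near_eq_cvg.
have : (x + h) @[h --> 0^'] --> x.
  rewrite -[X in _ --> X]addr0; apply: cvgD; first exact: cvg_cst.
  exact: nbhs_dnbhs.
move=> H; near=> h; rewrite fgx; congr (_ * (_ - _)).
by apply/esym; near: h; exact: (H _ fg).
Unshelve. all: by end_near. Qed.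

Section row_calculus.
Context {R : realType} {N : nat}.
Implicit Types (g : 'rV[R]_N -> R) (u v p q : 'rV[R]_N).
Let e (i : 'I_N) : 'rV[R]_N := delta_mx 0 i.

Lemma cvg_row_seq (f : nat -> 'rV[R]_N) (l : 'rV[R]_N) :
  (forall j, f n 0 j @[n --> \oo] --> l 0 j) -> f n @[n --> \oo] --> l.
Proof.
move=> fl; apply/cvg_ballP => eps eps0.
have H j : \forall n \near \oo, ball (l 0 j) eps (f n 0 j).
  by move: (fl j) => /cvg_ballP/(_ _ eps0).
have : \forall n \near \oo, forall j, ball (l 0 j) eps (f n 0 j).
  exact: filter_forall.
apply: filterS => n h; split=> // i j; rewrite (ord1 i); exact: h.
Qed.

Lemma is_derive_line g v (u : 'rV[R]_N) (x : R) :
  derivable g (u + x *: v) v ->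
  is_derive x 1 (fun y : R => g (u + y *: v)) ('D_v g (u + x *: v)).
Proof.
move=> dg; apply/is_derive1P.
have := dg; rewrite /derivable => /cvg_ex[l Hl].
have -> : 'D_v g (u + x *: v) = l by exact/cvg_lim.
move: Hl; rewrite (_ : (fun h => _) = (fun h : R => h^-1 * (g (u + (x + h) *: v) - g (u + x *: v)))) //.
apply/funext => h; congr (_ * (g _ - _)); by rewrite /= scalerDl addrCA [h *: v + _]addrC.
Qed.

Variable g : 'rV[R]_N -> R.
Hypothesis gC1 : C1_fun g.

Lemma mvt_coord u (i : 'I_N) (d : R) : exists2 c : R, `|c| <= `|d| &
  g (u + d *: e i) - g u = d * partial i g (u + c *: e i).
Proof.
pose F (y : R) := g (u + y *: e i).
have dF (x : R) : is_derive x 1 F (partial i g (u + x *: e i)).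
  by apply: is_derive_line; exact: (gC1 i).1.
have cF : continuous F.
  move=> x; apply: differentiable_continuous; apply/derivable1_diffP.
  by have [] := dF x.
have gu : g u = F 0 by rewrite /F scale0r addr0.
have [d0|d0] := leP 0 d.
  have [c] := MVT_segment d0 (fun x _ => dF x) (continuous_subspaceT cF).
  rewrite in_itv/= => /andP[c0 cd] H; exists c; first by rewrite !ger0_norm.
  by rewrite gu -/(F d) H subr0 mulrC.
have [c] := MVT_segment (ltW d0) (fun x _ => dF x) (continuous_subspaceT cF).
rewrite in_itv/= => /andP[c0 cd] H; exists c.
  by rewrite !ler0_norm ?lerN2 // ltW.
by rewrite gu -/(F d) -opprB H sub0r mulrN opprK mulrC.
Qed.

(** Corner of the staircase from [p] to [q] that changes one coordinate at a time; the mean value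
    theorem applied to each stair gives the next lemma by telescoping. *)
Let hyb p q (k : nat) : 'rV[R]_N := \row_j if (j < k)%N then q 0 j else p 0 j.

Lemma mvt_row p q : exists xi : 'I_N -> 'rV[R]_N,
  (forall k j, `|xi k 0 j - p 0 j| <= `|q 0 j - p 0 j|) /\
  g q - g p = \sum_k (q 0 k - p 0 k) * partial k g (xi k).
Proof.
have step (k : 'I_N) : exists xi : 'rV[R]_N,
    (forall j, `|xi 0 j - p 0 j| <= `|q 0 j - p 0 j|) /\
    g (hyb p q k.+1) - g (hyb p q k) = (q 0 k - p 0 k) * partial k g xi.
  have [c cd H] := mvt_coord (hyb p q k) k (q 0 k - p 0 k).
  exists (hyb p q k + c *: e k); split=> [j|].
    rewrite !mxE eqxx /=; have [->|jk] := eqVneq j k.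
      by rewrite ltnn mulr1 addrAC subrr add0r.
    rewrite /= mulr0 addr0; case: ifP => _ //.
    by rewrite subrr normr0.
  rewrite -H; congr (g _ - _); apply/rowP => j; rewrite !mxE eqxx /= ltnS leq_eqVlt.
  have [jk|jk] := eqVneq j k.
    by rewrite jk eqxx ltnn /= mulr1 addrC subrK.
  have -> : (nat_of_ord j == k) = false by exact/negbTE.
  by rewrite /= mulr0 addr0.
have /choice[xi H] := step.
exists xi; split=> [k|]; first by have [] := H k.
have -> : q = hyb p q N by apply/rowP => j; rewrite !mxE ltn_ord.
have {2}-> : p = hyb p q 0 by apply/rowP => j; rewrite !mxE ltn0.
rewrite -(telescope_sumr (fun k => g (hyb p q k))) // big_mkord.
apply: eq_bigr => k _; have [_ ->] := H k.
by rewrite !mxE ltn_ord.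
Qed.

(** [C1_fun] only speaks of partial derivatives, so the chain rule is obtained from [mvt_row]: the
    intermediate points are squeezed to [c x], where the partial derivatives are continuous. *)
Lemma C1_chain (c : R -> 'rV[R]_N) (c' : 'I_N -> R) (x : R) :
  (forall k, is_derive x 1 (fun y => c y 0 k) (c' k)) ->
  is_derive x 1 (g \o c) (\sum_k c' k * partial k g (c x)).
Proof.
move=> dc; apply/is_derive1_seqP => h h0 hc.
have /choice[xi H] : forall n, exists xi : 'I_N -> 'rV[R]_N,
  (forall k j, `|xi k 0 j - c x 0 j| <= `|c (x + h n) 0 j - c x 0 j|) /\
  g (c (x + h n)) - g (c x) =
    \sum_k (c (x + h n) 0 k - c x 0 k) * partial k g (xi k).
  by move=> n; exact: mvt_row.
rewrite (_ : (fun n => _) = fun n => \sum_k ((h n)^-1 * (c (x + h n) 0 k - c x 0 k)) * partial k g (xi n k)); last first.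
  by apply/funext => n; have [_ /= ->] := H n; rewrite mulr_sumr; apply: eq_bigr => k _; rewrite mulrA.
apply: cvg_sum_seq => k.
apply: cvgM; first by have /is_derive1_seqP := dc k; exact.
apply: continuous_cvg; first exact: (gC1 k).2.
apply: cvg_row_seq => j.
have cc : `|c (x + h n) 0 j - c x 0 j| @[n --> \oo] --> (0 : R).
  have cj : {for x, continuous (fun y => c y 0 j)}.
    apply: differentiable_continuous; apply/derivable1_diffP.
    by have [] := dc j.
  rewrite -(normr0 R) -(subrr (c x 0 j)); apply: cvg_norm.
  apply: cvgB; last exact: cvg_cst.
  have cxh : x + h n @[n --> \oo] --> x + 0 by apply: cvgD => //; exact: cvg_cst.
  by rewrite addr0 in cxh; exact: (cvg_comp _ _ cxh cj).
apply/subr_cvg0; apply: norm_cvg0.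
apply: (@squeeze_cvgr _ _ _ _ (cst 0) (fun n => `|c (x + h n) 0 j - c x 0 j|)) => //.
  by apply: nearW => n; rewrite normr_ge0 /=; have [] := H n.
exact: cvg_cst.
Qed.

End row_calculus.

(** The mean value theorem in direction j, for the increment of g in direction i, then in direction
    i for its j-th partial derivative. The bound 2 |h| on the intermediate point covers the case i =
    j, where both displacements add up in one coordinate. *)
Lemma cvg_mixed_difference (R : realType) (N : nat) (g : 'rV[R]_N -> R)
    (i j : 'I_N) (h : nat -> R) : C2_fun g -> (forall n, h n != 0) ->
  h n @[n --> \oo] --> (0 : R) ->
  (h n) ^- 2 * (g (h n *: (delta_mx 0 i + delta_mx 0 j)) - g (h n *: delta_mx 0 i)
     - g (h n *: delta_mx 0 j) + g 0) @[n --> \oo] --> partial i (partial j g) 0.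
Proof.
move=> [g1 g2] h0 hc.
pose e (k : 'I_N) : 'rV[R]_N := delta_mx 0 k.
have /choice[xi H] : forall n, exists xi : 'rV[R]_N,
   (forall k, `|xi 0 k| <= 2 * `|h n|) /\
   g (h n *: (e i + e j)) - g (h n *: e i) - g (h n *: e j) + g 0 =
     h n ^+ 2 * partial i (partial j g) xi.
  move=> n.
  pose F (y : R) := g (h n *: e i + y *: e j) - g (0 + y *: e j).
  pose dF y := partial j g (h n *: e i + y *: e j) - partial j g (0 + y *: e j).
  have FE (y : R) : is_derive y 1 F (dF y).
    by apply: is_deriveB; apply: is_derive_line; exact: (g1 j).1.
  have cF : continuous F.
    move=> x; apply: differentiable_continuous; apply/derivable1_diffP.
    by have [] := FE x.
  have [c ch Hc] : exists2 c : R, `|c| <= `|h n| & F (h n) - F 0 = h n * dF c.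
    have [d0|d0] := leP 0 (h n).
      have [c] := MVT_segment d0 (fun x _ => FE x) (continuous_subspaceT cF).
      rewrite in_itv/= => /andP[c0 cd] ->; exists c; first by rewrite !ger0_norm.
      by rewrite subr0 mulrC.
    have [c] := MVT_segment (ltW d0) (fun x _ => FE x) (continuous_subspaceT cF).
    rewrite in_itv/= => /andP[c0 cd] K; exists c.
      by rewrite !ler0_norm ?lerN2 // ltW.
    by rewrite -opprB K sub0r mulrN opprK mulrC.
  have [c2 c2h Hc2] := mvt_coord (g2 j) (0 + c *: e j) i (h n).
  exists (0 + c *: e j + c2 *: e i); split=> [k|].
    rewrite !mxE add0r mulrDl mul1r; apply: le_trans (ler_normD _ _) _.
    by apply: lerD; rewrite normrM; (apply: le_trans (_ : `|h n| * 1 <= _); last by rewrite mulr1);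
      apply: ler_pM => //; rewrite normr_nat; case: (_ && _) => //=; exact: ler01.
  rewrite expr2 -mulrA -Hc2; move: Hc; rewrite /F /dF.
  rewrite !add0r !scale0r !addr0 scalerDr [c *: e j + _]addrC => <-.
  ring.
have -> : (fun n => (h n) ^- 2 * (g (h n *: (delta_mx 0 i + delta_mx 0 j)) - g (h n *: delta_mx 0 i)
     - g (h n *: delta_mx 0 j) + g 0)) = fun n => partial i (partial j g) (xi n).
  apply/funext => n; have [_ ->] := H n.
  by rewrite mulrA mulVf ?mul1r // expf_neq0.
apply: continuous_cvg; first exact: (g2 j i).2.
apply: cvg_row_seq => k; rewrite mxE; apply: norm_cvg0.
apply: (@squeeze_cvgr _ _ _ _ (cst 0) (fun n => 2 * `|h n|)).
- by apply: nearW => n; rewrite normr_ge0 /=; have [] := H n.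
- exact: cvg_cst.
- rewrite -(mulr0 2) -(normr0 R); apply: cvgM; [exact: cvg_cst|exact: cvg_norm].
Qed.

(** * Charts of the sphere and the Hessian *)

Section dot.
Context {R : realType} {n : nat}.
Implicit Types (u v w : 'rV[R]_n) (a : R).

Lemma dotE u v : dot u v = (u *m v^T) 0 0.
Proof. by rewrite mxE; apply: eq_bigr => i _; rewrite mxE. Qed.

Lemma dotC u v : dot u v = dot v u.
Proof. by apply: eq_bigr => i _; rewrite mulrC. Qed.

Lemma dotDl u v w : dot (u + v) w = dot u w + dot v w.
Proof. by rewrite -big_split; apply: eq_bigr => i _; rewrite mxE mulrDl. Qed.

Lemma dotZl a u v : dot (a *: u) v = a * dot u v.
Proof. by rewrite mulr_sumr; apply: eq_bigr => i _; rewrite mxE mulrA. Qed.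

Lemma dotDr u v w : dot u (v + w) = dot u v + dot u w.
Proof. by rewrite dotC dotDl !(dotC u). Qed.

Lemma dotZr a u v : dot u (a *: v) = a * dot u v.
Proof. by rewrite dotC dotZl dotC. Qed.

Lemma dot0l u : dot 0 u = 0.
Proof. by rewrite -(scale0r u) dotZl mul0r. Qed.

Lemma dot_ge0 u : 0 <= dot u u.
Proof. by apply: sumr_ge0 => i _; rewrite -expr2 sqr_ge0. Qed.

Lemma normalizeZ a u : 0 < a -> normalize (a *: u) = normalize u.
Proof.
move=> a0; rewrite /normalize /enorm dotZl dotZr mulrA -expr2.
rewrite sqrtrM ?sqr_ge0 // sqrtr_sqr gtr0_norm // scalerA invfM.
by rewrite mulrAC mulVf ?mul1r // gt_eqF.
Qed.

Lemma normalize_sphere u : sphere u -> normalize u = u.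
Proof. by rewrite /sphere /normalize /enorm /= => ->; rewrite sqrtr1 invr1 scale1r. Qed.

Lemma sphere_normalize u : 0 < dot u u -> sphere (normalize u).
Proof.
move=> u0; rewrite /sphere /= /normalize dotZl dotZr mulrA -expr2 exprVn /enorm.
by rewrite sqr_sqrtr ?dot_ge0 // mulVf // gt_eqF.
Qed.

Lemma dot_delta u (i : 'I_n) : dot (delta_mx 0 i) u = u 0 i.
Proof.
rewrite /dot (bigD1 i) //= big1 ?addr0 => [|j ji]; rewrite mxE eqxx ?eqxx ?mul1r //=.
by rewrite (negbTE ji) mul0r.
Qed.

End dot.

Section frame.
Context {R : realType} {N : nat}.
Variables (t : 'rV[R]_N.+1) (B : 'M[R]_(N, N.+1)).
Hypotheses (t1 : sphere t) (tB : tangent_basis t B).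

Lemma dot_mulmx (u : 'rV[R]_N) (s : 'rV[R]_N.+1) :
  dot (u *m B) s = \sum_k u 0 k * dot (row k B) s.
Proof.
rewrite dotE -mulmxA mxE; apply: eq_bigr => k _; congr (_ * _).
by rewrite dotE !mxE; apply: eq_bigr => i _; rewrite !mxE.
Qed.

Lemma dot_mulmx_t (u : 'rV[R]_N) : dot (u *m B) t = 0.
Proof. by rewrite dot_mulmx big1 // => k _; rewrite tB.1 mulr0. Qed.

Lemma dot_mulmx_row (u : 'rV[R]_N) k : dot (u *m B) (row k B) = u 0 k.
Proof.
rewrite dot_mulmx (bigD1 k) //= tB.2 eqxx mulr1 big1 ?addr0 // => j jk.
by rewrite tB.2 (negbTE jk) mulr0.
Qed.

Lemma dot_mulmx2 (u v : 'rV[R]_N) : dot (u *m B) (v *m B) = dot u v.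
Proof. by rewrite dot_mulmx; apply: eq_bigr => k _; rewrite dotC dot_mulmx_row. Qed.

Lemma dot_tuB (u v : 'rV[R]_N) : dot (t + u *m B) (t + v *m B) = 1 + dot u v.
Proof.
rewrite dotDl !dotDr dot_mulmx2 (dotC t (v *m B)) !dot_mulmx_t addr0 add0r.
by rewrite (t1 : dot t t = 1).
Qed.

Lemma dot_tuB_gt0 (u : 'rV[R]_N) : 0 < dot (t + u *m B) (t + u *m B).
Proof. by rewrite dot_tuB ltr_pwDl // dot_ge0. Qed.

Lemma sphere_chart u : sphere (chart t B u).
Proof. exact/sphere_normalize/dot_tuB_gt0. Qed.

Lemma dot_chart (u v : 'rV[R]_N) : dot (chart t B u) (chart t B v) =
  (1 + dot u v) / (Num.sqrt (1 + dot u u) * Num.sqrt (1 + dot v v)).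
Proof.
rewrite /chart /normalize dotZl dotZr /enorm !dot_tuB invfM.
by rewrite mulrA mulrC.
Qed.

(** Stacking [t] on [B] gives a square matrix with A A^T = 1, hence also A^T A = 1, which is the
    expansion in the orthonormal basis. *)
Lemma frame_decomp (s : 'rV[R]_N.+1) :
  s = dot s t *: t + (\row_k dot s (row k B)) *m B.
Proof.
pose A : 'M[R]_(1 + N, 1 + N) := col_mx t B.
have BBT : B *m B^T = 1%:M.
  apply/matrixP => i j; rewrite [RHS]mxE -(tB.2 i j) dotE !mxE.
  by apply: eq_bigr => k _; rewrite !mxE.
have tt : t *m t^T = 1%:M.
  by apply/matrixP => i j; rewrite !ord1 -dotE (t1 : dot t t = 1) mxE.
have Bt : B *m t^T = 0.
  apply/matrixP => i j; rewrite ord1 [RHS]mxE -(tB.1 i) dotE !mxE.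
  by apply: eq_bigr => k _; rewrite !mxE.
have tBT : t *m B^T = 0 by rewrite -[LHS]trmxK trmx_mul trmxK Bt trmx0.
have AAT : A *m A^T = 1%:M.
  by rewrite tr_col_mx mul_col_row BBT tt Bt tBT -scalar_mx_block.
have ATA : A^T *m A = 1%:M by exact: mulmx1C.
rewrite -[LHS]mulmx1 -ATA mulmxA tr_col_mx mul_mx_row mul_row_col.
have -> : s *m B^T = \row_k dot s (row k B).
  apply/rowP => k; rewrite !mxE; apply: eq_bigr => i _.
  by rewrite !mxE.
by rewrite (mx11_scalar (s *m t^T)) mul_scalar_mx dotE.
Qed.

(** Gnomonic coordinates, inverse to [chart] on the hemisphere around [t]. They are invariant under
    scaling of [s], which matches the normalization in [sphere_derive]. *)
Definition chart_coord (s : 'rV[R]_N.+1) : 'rV[R]_N :=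
  \row_k (dot s (row k B) / dot s t).

Lemma normalize_chart s : 0 < dot s t -> normalize s = chart t B (chart_coord s).
Proof.
move=> st; rewrite /chart -[RHS](normalizeZ _ st); congr normalize.
rewrite {1}(frame_decomp s) scalerDr; congr (_ + _).
rewrite -mul_scalar_mx mulmxA; congr (_ *m _).
apply/rowP => k; rewrite !mxE /= (bigD1 ord0) //= big1 ?addr0; last first.
  by move=> i; rewrite (ord1 i) eqxx.
by rewrite !mxE eqxx mulr1n mulrCA divff ?mulr1 // gt_eqF.
Qed.

End frame.

Lemma derive_near (R : realType) (V : normedModType R) (F : V -> R) (v s : V)
    (psi : R -> R) (l : R) :
  (\forall h \near (0 : R), F (h *: v + s) = psi h) -> is_derive (0 : R) (1 : R) psi l ->
  'D_v F s = l.
Proof.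
move=> Fpsi /is_derive1P dpsi.
have Fs : F s = psi 0.
  by have := nbhs_singleton Fpsi; rewrite scale0r add0r.
apply/cvg_lim => //; apply: cvg_trans dpsi; apply: near_eq_cvg.
have : \forall h \near (0:R)^', F (h *: v + s) = psi h by exact: nbhs_dnbhs Fpsi.
by apply: filterS => h /= ->; rewrite Fs add0r.
Qed.

Lemma is_derive_mobius (R : realType) (a b c d : R) : d != 0 ->
  is_derive (0 : R) (1 : R) (fun y => (y * a + b) / (y * c + d))
    ((a * d - b * c) / d ^+ 2).
Proof.
move=> d0.
have da : is_derive (0 : R) (1 : R) (fun y : R => y * a + b) a.
  by apply: is_derive_eq; rewrite /GRing.scale/=; ring.
have dc : is_derive (0 : R) (1 : R) (fun y : R => y * c + d) c.
  by apply: is_derive_eq; rewrite /GRing.scale/=; ring.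
have d1 : 0 * c + d != 0 by rewrite mul0r add0r.
have dV : is_derive (0 : R) (1 : R) (fun y : R => (y * c + d)^-1) (- (0 * c + d) ^- 2 * c).
  exact: (@is_deriveV R (fun y => y * c + d) 0 c 1 d1 dc).
by apply: (is_derive1M_eq da dV); rewrite !mul0r !add0r; field.
Qed.

Section hessian.
Context {R : realType} {N : nat}.
Variables (t : 'rV[R]_N.+1) (B : 'M[R]_(N, N.+1)).
Hypotheses (t1 : sphere t) (tB : tangent_basis t B).
Variable f : 'rV[R]_N.+1 -> R.
Hypothesis fC2 : C2_sphere f.
Let g := f \o chart t B.
Let gC2 : C2_fun g. Proof. exact: fC2. Qed.

(** Along the line s + h v the gnomonic coordinates are homographic functions of h, whose
    derivatives at 0 are the coefficients of the chain rule. *)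
Lemma sphere_derive_chart (v s : 'rV[R]_N.+1) : 0 < dot s t ->
  sphere_derive f v s = \sum_k (dot v (row k B) * dot s t - dot s (row k B) * dot v t)
    / (dot s t) ^+ 2 * partial k g (chart_coord t B s).
Proof.
move=> st; pose c (h : R) := chart_coord t B (h *: v + s).
have dlin (w : 'rV[R]_N.+1) h : dot (h *: v + s) w = h * dot v w + dot s w.
  by rewrite dotDl dotZl.
apply: (@derive_near _ _ _ _ _ (g \o c)).
  have : (h * dot v t + dot s t) @[h --> (0 : R)] --> 0 * dot v t + dot s t.
    apply: cvgD; last exact: cvg_cst.
    by apply: cvgM; [exact: cvg_id|exact: cvg_cst].
  rewrite mul0r add0r => /cvgr_gt/(_ _ st); apply: filterS => h h0.
  by rewrite /= (normalize_chart t1 tB) ?dlin.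
have -> : chart_coord t B s = c 0 by rewrite /c scale0r add0r.
apply: C1_chain; first exact: gC2.1.
move=> k; rewrite (_ : (fun y => _) = fun y => (y * dot v (row k B) + dot s (row k B)) / (y * dot v t + dot s t)).
  by apply: is_derive_mobius; rewrite gt_eqF.
by apply/funext => y; rewrite /c mxE !dlin.
Qed.

Variable E : 'I_N -> 'rV[R]_N.+1 -> 'rV[R]_N.+1.
Hypotheses (EB : forall k, E k t = row k B) (Et : normal_frame t E).

(** Along the curve x -> normalize (x e + t) the chart coordinate is exactly x in direction i, and
    the first derivative of f is a combination of the partial derivatives of g. The coefficients
    have zero derivative at x = 0, because the frame is parallel at [t] and tangent to the sphere,
    so only the derivative of the j-th partial derivative survives. *)
Lemma hessian_chart i j : sphere_hessian E f t i j = partial i (partial j g) 0.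
Proof.
rewrite mxE.
pose e := row i B; pose r (x : R) := Num.sqrt (1 + x ^+ 2).
pose V (x : R) := E j (normalize (x *: e + t)).
have ee : dot e e = 1 by rewrite tB.2 eqxx.
have et : dot e t = 0 by rewrite tB.1.
have r0 x : 0 < r x by rewrite sqrtr_gt0 ltr_pwDl // sqr_ge0.
have nE x : normalize (x *: e + t) = (r x)^-1 *: (x *: e + t).
  rewrite /normalize /enorm dotDl !dotDr !dotZl !dotZr (dotC t e) ee et (t1 : dot t t = 1).
  by congr ((Num.sqrt _)^-1 *: _); ring.
have nt x : dot (normalize (x *: e + t)) t = (r x)^-1.
  by rewrite nE dotZl dotDl dotZl et (t1 : dot t t = 1); ring.
have nb x k : dot (normalize (x *: e + t)) (row k B) = (r x)^-1 * (x * (i == k)%:R).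
  by rewrite nE dotZl dotDl dotZl tB.2 dotC tB.1 addr0.
have phiE x : chart_coord t B (normalize (x *: e + t)) = 0 + x *: delta_mx 0 i.
  apply/rowP => k; rewrite !mxE nt nb eqxx /= eq_sym add0r.
  by field; rewrite gt_eqF.
pose psi (x : R) := \sum_k (dot (V x) (row k B) - x * (i == k)%:R * dot (V x) t) * r x
    * partial k g (0 + x *: delta_mx 0 i).
apply: (@derive_near _ _ _ _ _ psi).
  near=> x; rewrite /= EB sphere_derive_chart ?nt ?invr_gt0 //.
  apply: eq_bigr => k _; rewrite phiE nb; congr (_ * _).
  by rewrite /V; field; rewrite gt_eqF.
pose w := sphere_derive (E j) e t.
have dV (b : 'rV[R]_N.+1) : is_derive (0 : R) (1 : R) (fun x => dot (V x) b) (dot w b).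
  have [_ Ed _] := Et.
  have dEj : derivable (E j \o @normalize R N.+1) t e.
    by apply: diff_derivable; exact: nbhs_singleton (Ed j).
  apply/is_derive1P.
  have : (h^-1 *: (V h - V 0)) @[h --> (0 : R)^'] --> w.
    have := dEj; rewrite /derivable => /cvg_ex[l Hl].
    have -> : w = l by exact/cvg_lim.
    by move: Hl; rewrite /= /V scale0r add0r.
  move=> H.
  rewrite (_ : (fun h => _) = (fun h => \sum_(l <- index_enum 'I_N.+1) (h^-1 *: (V h - V 0)) 0 l * b 0 l)); last first.
    apply/funext => h; rewrite add0r mulrBr !mulr_sumr -sumrB; apply: eq_bigr => l _.
    by rewrite !mxE; ring.
  rewrite /dot; elim: (index_enum _) => [|l s IH].
    by rewrite big_nil; under eq_fun do rewrite big_nil; exact: cvg_cst.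
  rewrite big_cons; under eq_fun do rewrite big_cons.
  apply: cvgD => //; apply: cvgM; last exact: cvg_cst.
  exact: (cvg_comp _ _ H (@coord_continuous _ _ _ _ _ _)).
have V0 : V 0 = row j B by rewrite /V scale0r add0r normalize_sphere.
have dr : is_derive (0 : R) (1 : R) r 0.
  have dq : is_derive (0 : R) (1 : R) (fun x : R => 1 + x ^+ 2) 0.
    by apply: is_derive_eq; rewrite /GRing.scale/=; ring.
  have p1 : 0 < 1 + 0 ^+ 2 :> R by rewrite expr0n/= addr0.
  apply: (@is_derive1_comp_eq R Num.sqrt (fun x => 1 + x ^+ 2) 0 _ 0 0 (is_derive1_sqrt p1) dq).
  by rewrite mulr0.
(* A vanishing covariant derivative says that the ambient derivative [w] is a multiple of [t]. *)
have wb k : dot w (row k B) = 0.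
  have [_ _ /(_ i j)] := Et; rewrite EB /sphere_nabla -/e -/w => /eqP.
  by rewrite subr_eq0 => /eqP ->; rewrite dotZl (dotC t) tB.1 mulr0.
have -> : partial i (partial j g) 0 = \sum_(k <- index_enum 'I_N)
    (((dot w (row k B) - (i == k)%:R * dot (V 0) t) * r 0 + 0) * partial k g 0 +
     (dot (V 0) (row k B) * r 0) * partial i (partial k g) 0).
  rewrite (bigD1 j) //= big1 ?addr0 => [|k kj].
    rewrite wb V0 tB.1 tB.2 eqxx /r expr0n/= addr0 sqrtr1; ring.
  by rewrite wb V0 tB.1 tB.2 (eq_sym j) (negbTE kj) mulr0n; ring.
apply: is_derive1_sum => k.
have d1 : is_derive (0 : R) (1 : R) (fun x => dot (V x) (row k B) - x * (i == k)%:R * dot (V x) t)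
    (dot w (row k B) - (i == k)%:R * dot (V 0) t).
  apply: is_deriveB.
  have dx : is_derive (0 : R) (1 : R) (fun x : R => x * (i == k)%:R) (i == k)%:R.
    by apply: is_derive_eq; rewrite /GRing.scale/=; ring.
  by apply: (is_derive1M_eq dx (dV t)); ring.
have d2 : is_derive (0 : R) (1 : R) (fun x => (dot (V x) (row k B) - x * (i == k)%:R * dot (V x) t) * r x)
    ((dot w (row k B) - (i == k)%:R * dot (V 0) t) * r 0 + 0).
  by apply: (is_derive1M_eq d1 dr); ring.
have d3 : is_derive (0 : R) (1 : R) (fun x : R => partial k g (0 + x *: delta_mx 0 i)) (partial i (partial k g) 0).
  have := @is_derive_line R N (partial k g) (delta_mx 0 i) 0 0.
  by rewrite scale0r addr0; apply; exact: (gC2.2 k i).1.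
apply: (is_derive1M_eq d2 d3).
by rewrite scale0r !addr0 !mul0r subr0.
Unshelve. all: by end_near. Qed.

End hessian.

(** * Derivatives of the covariance at 1 *)

(** f = o(|x|^n) at 0, on a full neighborhood that contains 0. *)
Definition small (R : realType) (n : nat) (f : R -> R) : Prop :=
  forall e, 0 < e -> \forall x \near (0 : R), `|f x| <= e * `|x| ^+ n.

Section small.
Context {R : realType}.
Implicit Types f g : R -> R.

Lemma smallD n f g : small n f -> small n g -> small n (fun x => f x + g x).
Proof.
move=> sf sg e e0; have e20 : 0 < e / 2 by lra.
near=> x; apply: le_trans (ler_normD _ _) _.
rewrite (splitr e) mulrDl; apply: lerD; near: x; [exact: sf|exact: sg].
Unshelve. all: by end_near. Qed.

Lemma smallZ n (c : R) f : small n f -> small n (fun x => c * f x).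
Proof.
move=> sf e e0; have c0 : 0 < `|c| + 1 by rewrite ltr_wpDl.
near=> x; rewrite normrM.
have : `|f x| <= e / (`|c| + 1) * `|x| ^+ n by near: x; apply: sf; rewrite divr_gt0.
move: (`|x| ^+ n) (exprn_ge0 n (normr_ge0 x)) => X X0 H.
apply: le_trans (ler_wpM2l (normr_ge0 c) H) _.
rewrite mulrA; apply: ler_wpM2r => //; rewrite mulrCA; apply: ler_piMr; first exact: ltW.
by rewrite ler_pdivrMr // mul1r lerDl.
Unshelve. all: by end_near. Qed.

(** By the mean value theorem f x = f1 c * x with |c| <= |x|: a Peano estimate on the derivative
    gains one order. Iterated, it replaces Taylor's formula. *)
Lemma small_derive n f f1 : f 0 = 0 ->
  (\forall x \near (0 : R), is_derive (x : R) (1 : R) f (f1 x)) -> small n f1 -> small n.+1 f.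
Proof.
move=> f00 df sf e e0.
have /nbhs_ballP[r /= r0 rP] : \forall x \near (0 : R), is_derive (x : R) (1 : R) f (f1 x) /\ `|f1 x| <= e * `|x| ^+ n.
  by near=> x; split; near: x => //; exact: sf.
have {}rP x : `|x| < r -> is_derive (x : R) (1 : R) f (f1 x) /\ `|f1 x| <= e * `|x| ^+ n.
  by move=> xr; apply: rP; rewrite /ball/= sub0r normrN.
near=> x.
have xr : `|x| < r.
  near: x; apply/nbhs_ballP; exists r => //= x; by rewrite /ball/= sub0r normrN.
have cf a b : `|a| < r -> `|b| < r -> {within `[a, b], continuous f}.
  move=> ar br; apply: continuous_in_subspaceT => z; rewrite inE /= in_itv/= => /andP[az zb].
  apply: differentiable_continuous; apply/derivable1_diffP.
  have zr : `|z| < r.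
    move: ar br; rewrite !ltr_norml => /andP[a1 _] /andP[_ b2].
    by apply/andP; split; lra.
  by have [[]] := rP z zr.
have dff a b : `|a| < r -> `|b| < r -> forall z, z \in `]a, b[ -> is_derive z 1 f (f1 z).
  move=> ar br z; rewrite in_itv/= => /andP[az zb].
  have zr : `|z| < r.
    move: ar br; rewrite !ltr_norml => /andP[a1 _] /andP[_ b2].
    by apply/andP; split; lra.
  by have [] := rP z zr.
have r00 : `|0 : R| < r by rewrite normr0.
have [c cx Hc] : exists2 c : R, `|c| <= `|x| & f x = f1 c * x.
  have [x0|x0] := leP 0 x.
    have [c] := MVT_segment x0 (dff _ _ r00 xr) (cf _ _ r00 xr).
    rewrite in_itv/= => /andP[c0 cd]; rewrite f00 !subr0 => ->; exists c => //.
    by rewrite !ger0_norm.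
  have [c] := MVT_segment (ltW x0) (dff _ _ xr r00) (cf _ _ xr r00).
  rewrite in_itv/= => /andP[c0 cd]; rewrite f00 !sub0r mulrN => /oppr_inj ->; exists c => //.
  by rewrite !ler0_norm ?lerN2 // ltW.
rewrite Hc normrM exprSr mulrA ler_wpM2r //.
have [_ h] := rP c (le_lt_trans cx xr); apply: le_trans h _.
by rewrite ler_wpM2l ?(ltW e0) // lerXn2r ?nnegrE.
Unshelve. all: by end_near. Qed.

Lemma small1_is_derive f : f 0 = 0 -> is_derive (0 : R) (1 : R) f 0 -> small 1 f.
Proof.
move=> f00 /is_derive1P df e e0.
have : \forall h \near (0 : R)^', `|h^-1 * (f (0 + h) - f 0)| <= e.
  move: df => /cvgr0Pnorm_le/(_ _ e0); exact.
move=> H.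
have : \forall h \near (0 : R), h != 0 -> `|h^-1 * (f (0 + h) - f 0)| <= e by exact: H.
apply: filterS => x; have [->|x0] := eqVneq x 0; first by rewrite f00 !normr0 expr1 mulr0.
move=> /(_ isT); rewrite add0r f00 subr0 normrM normfV ler_pdivrMl ?normr_gt0 //.
by rewrite expr1 mulrC.
Qed.

Lemma small_cvg n f : small n f -> f x / x ^+ n @[x --> (0 : R)^'] --> (0 : R).
Proof.
move=> sf; apply/cvgr0Pnorm_le => e e0.
have := nbhs_dnbhs (sf e e0) => H.
near=> x.
have x0 : x != 0 by near: x; exact: nbhs_dnbhs_neq.
have : `|f x| <= e * `|x| ^+ n by near: x.
by rewrite normrM normfV normrX ler_pdivrMr // exprn_gt0 // normr_gt0.
Unshelve. all: by end_near. Qed.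

End small.

Lemma is_derive_unique (R : realType) (f : R -> R) (x a b : R) :
  is_derive x 1 f a -> is_derive x 1 f b -> a = b.
Proof. by move=> [_ <-] [_ <-]. Qed.

(** The sign [s] is 1 for even and -1 for odd functions; C (cos x) being even, its derivatives of
    odd order vanish at 0. *)
Lemma is_derive_parity (R : realType) (f f1 : R -> R) (s r : R) :
  (forall x, `|x| < r -> f (- x) = s * f x) ->
  (forall x : R, `|x| < r -> is_derive x 1 f (f1 x)) ->
  forall x, `|x| < r -> f1 (- x) = - s * f1 x.
Proof.
move=> fs df x xr; apply: oppr_inj; rewrite mulNr opprK.
have d1 : is_derive x 1 (fun y => f (- y)) (- f1 (- x)).
  have dN : is_derive x 1 (fun y : R => - y) (-1).
    by apply: is_derive_eq.
  have dfN : is_derive (- x) 1 f (f1 (- x)) by apply: df; rewrite normrN.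
  by apply: (is_derive1_comp_eq dfN dN); rewrite mulrN1.
have d2 : is_derive x 1 (fun y => f (- y)) (s * f1 x).
  apply: (@near_is_derive1 _ _ (fun y => s * f y)); last first.
    apply: (is_derive1M_eq (f := cst s) (is_derive_cst _ _ _) (df _ xr)).
    by rewrite mul0r add0r.
  have : \forall y \near x, `|y| < r.
    have : `|y| @[y --> x] --> `|x| by apply: cvg_norm; exact: cvg_id.
    by move=> /cvgr_lt; apply.
  by apply: filterS => y; exact: fs.
exact: is_derive_unique d1 d2.
Qed.

(** Every y of [-1, 1] other than 1 is cos x with x = acos y > 0, and y close to 1 makes x small. *)
Lemma cvg_cos_within (R : realType) (Phi : R -> R) (l : R) :
  Phi (cos x) @[x --> (0 : R)^'+] --> l ->
  Phi y @[y --> within `[-1, 1]%classic (1 : R)^'] --> l.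
Proof.
move=> H A /H; rewrite /= => /nbhs_ballP[e /= e0 eP].
have pi0 := pi_gt0 R.
pose e' := Num.min e (pi / 2).
have e'0 : 0 < e' by rewrite lt_min e0 divr_gt0.
have e'pi : e' < pi by rewrite gt_min; apply/orP; right; lra.
have Ie : e' \in `[0, pi] by rewrite in_itv/= (ltW e'0) (ltW e'pi).
have I0 : (0 : R) \in `[0, pi] by rewrite in_itv/= lexx (ltW pi0).
have c1 : cos e' < 1 by rewrite -cos0 ltr_cos.
have : \forall y \near (1 : R)^', cos e' < y.
  by apply: nbhs_dnbhs; exact: (cvgr_gt _ cvg_id).
have : \forall y \near (1 : R)^', y != 1 by exact: nbhs_dnbhs_neq.
rewrite /nbhs /= /within /=; apply: filter_app2; near=> y => y1 cy; rewrite /= in_itv/= => yD.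
have /andP[a0 ap] := (acos_def yD).1; have ay := (acos_def yD).2.
have ae : acos y < e'.
  by rewrite -(ltr_cos) ?ay // in_itv/= a0 ap.
have a00 : 0 < acos y.
  rewrite lt_neqAle a0 andbT; apply: contra_neq y1 => a00.
  by rewrite -ay -a00 cos0.
rewrite /= -ay; apply: eP => //.
rewrite /ball/= sub0r normrN gtr0_norm //; apply: lt_le_trans ae _.
by rewrite ge_min lexx.
Unshelve. all: by end_near. Qed.

(** Properness of this filter makes the [lim] of [derive_within] unique, hence computable; points
    slightly to the left of x stay in the interval. *)
Lemma within_itv_proper (R : realType) (x : R) : -1 < x <= 1 ->
  ProperFilter (within `[-1, 1]%classic x^').
Proof.
move=> /andP[x1 x2]; apply: Build_ProperFilter => H.
have H' : \forall y \near x^'-, ~ `[-1, 1]%classic y.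
  have : \forall y \near x^', `[-1, 1]%classic y -> False by exact: H.
  move=> K; refine (@filterS _ (nbhs x) _ (fun y => y != x -> `[-1, 1]%classic y -> False) _ _ K).
  by move=> y h yx; apply: h; rewrite lt_eqF.
near x^'- => y.
have : ~ `[-1, 1]%classic y by near: y.
apply; rewrite /= in_itv/=.
have yx : y < x by near: y; exact: nbhs_left_lt.
have y1 : -1 < y by near: y; exact: nbhs_left_gt.
by rewrite ltW //= ltW // (lt_le_trans yx).
Unshelve. all: by end_near. Qed.

Lemma derive_within_is_derive (R : realType) (f : R -> R) (x l : R) : -1 < x <= 1 ->
  is_derive x 1 f l -> derive_within `[-1, 1]%classic f x = l.
Proof.
move=> x1 df; have pf := within_itv_proper x1.
apply: cvg_lim => //.
have : (f y - f x) / (y - x) @[y --> x^'] --> l.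
  apply/cvgr_dnbhsP => u [ux uc].
  have /is_derive1_seqP/(_ (fun n => u n - x)) := df.
  rewrite (_ : (fun n => (u n - x)^-1 * _) = (fun n => (f (u n) - f x) / (u n - x))).
    apply; first by move=> n; rewrite subr_eq0.
    exact/subr_cvg0.
  by apply/funext => n; rewrite mulrC; congr ((f _ - _) / _); rewrite addrC subrK.
apply: cvg_trans; apply: cvg_within_filter; exact: cvg_id.
Qed.

Section cov_expansion.
Context {R : realType}.
Variables (C c1 c2 c3 : R -> R) (c4 r : R).
Hypotheses (r0 : 0 < r)
  (dc : forall x : R, `|x| < r -> is_derive x 1 (fun y => C (cos y)) (c1 x))
  (dc1 : forall x : R, `|x| < r -> is_derive x 1 c1 (c2 x))
  (dc2 : forall x : R, `|x| < r -> is_derive x 1 c2 (c3 x))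
  (dc3 : is_derive (0 : R) (1 : R) c3 c4).

Let near_r : \forall x \near (0 : R), `|x| < r.
Proof. by apply/nbhs_ballP; exists r => //= x; rewrite /ball/= sub0r normrN. Qed.

Let r00 : `|0 : R| < r. Proof. by rewrite normr0. Qed.

Let c1_odd x : `|x| < r -> c1 (- x) = - c1 x.
Proof.
move=> xr; rewrite (is_derive_parity (s := 1) _ dc) // ?mulN1r // => y _.
by rewrite cosN mul1r.
Qed.

Let c2_even x : `|x| < r -> c2 (- x) = c2 x.
Proof.
move=> xr; rewrite (is_derive_parity (s := -1) _ dc1) // ?opprK ?mul1r // => y yr.
by rewrite c1_odd // mulN1r.
Qed.

Let c3_odd x : `|x| < r -> c3 (- x) = - c3 x.
Proof.
move=> xr; rewrite (is_derive_parity (s := 1) _ dc2) // ?mulN1r // => y yr.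
by rewrite c2_even // mul1r.
Qed.

Let c10 : c1 0 = 0. Proof. by have := c1_odd r00; rewrite oppr0; lra. Qed.
Let c30 : c3 0 = 0. Proof. by have := c3_odd r00; rewrite oppr0; lra. Qed.

(** Third derivative at 0 of c1 - c2(0) sin; it turns out to be three times the second derivative of
    [C] at 1. *)
Let K := c4 + c2 0.

Let dsin (x a : R) : is_derive x 1 (fun y : R => a * sin y) (a * cos x).
Proof.
apply: (is_derive1M_eq (f := cst a) (is_derive_cst _ _ _) (is_derive_sin x)).
by rewrite mul0r add0r.
Qed.

Let dcos (x a : R) : is_derive x 1 (fun y : R => a * cos y) (- (a * sin x)).
Proof.
apply: (is_derive1M_eq (f := cst a) (is_derive_cst _ _ _) (is_derive_cos x)).
by rewrite mul0r add0r mulrN.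
Qed.

Let small_k : small 3 (fun x => c1 x - c2 0 * sin x - K / 6 * x ^+ 3).
Proof.
apply: (@small_derive _ _ _ (fun x => c2 x - c2 0 * cos x - K / 2 * x ^+ 2)).
- by rewrite c10 sin0; ring.
- apply: filterS near_r => x xr.
  apply: is_deriveB; first exact: (is_deriveB (dc1 xr) (dsin x _)).
  by apply: is_derive_eq; rewrite /GRing.scale/=; field.
apply: (@small_derive _ _ _ (fun x => c3 x - (- (c2 0 * sin x)) - K * x)).
- by rewrite cos0; ring.
- apply: filterS near_r => x xr.
  apply: is_deriveB; first exact: (is_deriveB (dc2 xr) (dcos x _)).
  by apply: is_derive_eq; rewrite /GRing.scale/=; field.
apply: small1_is_derive; first by rewrite c30 sin0; ring.
have dK : is_derive (0 : R) (1 : R) (fun x : R => K * x) K.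
  by apply: is_derive_eq; rewrite /GRing.scale/=; ring.
have := is_deriveB (is_deriveB dc3 (is_deriveN (dsin 0 (c2 0)))) dK.
by rewrite (_ : c4 - - (c2 0 * cos 0) - K = 0) //; rewrite cos0 /K; ring.
Qed.

Let small_sc : small 3 (fun x : R => (cos x - 1) * sin x + x ^+ 3 / 2).
Proof.
have E : (fun x : R => (cos x - 1) * sin x) = (fun x => cos x * sin x - 1 * sin x).
  by apply/funext => x; ring.
have dcs (x : R) : is_derive x 1 (fun x : R => cos x * sin x) (cos x ^+ 2 - sin x ^+ 2).
  by apply: (is_derive1M_eq (is_derive_cos x) (is_derive_sin x)); ring.
apply: (@small_derive _ _ _ (fun x => (cos x ^+ 2 - sin x ^+ 2) - 1 * cos x + 3 / 2 * x ^+ 2)).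
- by rewrite sin0; ring.
- apply: filterS near_r => x _; apply: is_deriveD.
    by rewrite E; exact: (is_deriveB (dcs x) (dsin x _)).
  by apply: is_derive_eq; rewrite /GRing.scale/=; field.
apply: (@small_derive _ _ _ (fun x => - (4 * (cos x * sin x)) - (- (1 * sin x)) + 3 * x)).
- by rewrite cos0 sin0; ring.
- apply: filterS near_r => x _; apply: is_deriveD; last first.
    by apply: is_derive_eq; rewrite /GRing.scale/=; field.
  apply: is_deriveB; last exact: dcos.
  have -> : - (4 * (cos x * sin x)) = 2 * cos x * (- sin x) - 2 * sin x * cos x by ring.
  apply: is_deriveB.
    have := is_derive1M_eq (is_derive_cos x) (is_derive_cos x) erefl.
    rewrite (_ : (fun y : R => cos y * cos y) = (fun y => cos y ^+ 2)); last by apply/funext => y; rewrite expr2.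
    by rewrite (_ : - sin x * cos x + cos x * - sin x = 2 * cos x * - sin x) //; ring.
  have := is_derive1M_eq (is_derive_sin x) (is_derive_sin x) erefl.
  rewrite (_ : (fun y : R => sin y * sin y) = (fun y => sin y ^+ 2)); last by apply/funext => y; rewrite expr2.
  by rewrite (_ : cos x * sin x + sin x * cos x = 2 * sin x * cos x) //; ring.
apply: small1_is_derive; first by rewrite cos0 sin0; ring.
have d3 : is_derive (0 : R) (1 : R) (fun x : R => 3 * x) 3.
  by apply: is_derive_eq; rewrite /GRing.scale/=; ring.
have d4 : is_derive (0 : R) (1 : R) (fun x : R => 4 * (cos x * sin x)) 4.
  apply: (is_derive1M_eq (f := cst 4) (is_derive_cst _ _ _) (dcs 0)).
  by rewrite cos0 sin0 /cst; ring.
have := is_deriveD (is_deriveB (is_deriveN d4) (is_deriveN (dsin 0 1))) d3.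
by rewrite (_ : - 4 - - (1 * cos 0) + 3 = 0) //; rewrite cos0; ring.
Qed.

Let small_cos : small 2 (fun x : R => cos x - 1 + x ^+ 2 / 2).
Proof.
apply: (@small_derive _ _ _ (fun x => - sin x + x)).
- by rewrite cos0; ring.
- apply: filterS near_r => x _; have dE := is_derive_cos x.
  by apply: is_derive_eq; rewrite /GRing.scale/=; field.
apply: small1_is_derive; first by rewrite sin0; ring.
have dE := is_derive_sin (0 : R).
by apply: is_derive_eq; rewrite cos0; ring.
Qed.

Let small_c : small 2 (fun x : R => C (cos x) - C 1 - c2 0 / 2 * x ^+ 2).
Proof.
apply: (@small_derive _ _ _ (fun x => c1 x - c2 0 * x)).
- by rewrite cos0; ring.
- apply: filterS near_r => x xr; have dE := dc xr.
  by apply: is_derive_eq; rewrite /GRing.scale/=; field.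
apply: small1_is_derive; first by rewrite c10; ring.
have dE := dc1 r00.
by apply: is_derive_eq; rewrite /GRing.scale/=; ring.
Qed.

Let small_ratio n (a : R) (f : R -> R) : small n (fun x => f x - a * x ^+ n) ->
  f x / x ^+ n @[x --> (0 : R)^'] --> a.
Proof.
move=> /small_cvg H.
have K1 : a + (f x - a * x ^+ n) / x ^+ n @[x --> (0 : R)^'] --> a + 0.
  by apply: cvgD => //; exact: cvg_cst.
rewrite addr0 in K1; apply: cvg_trans K1; apply: near_eq_cvg; near=> x.
have x0 : x != 0 by near: x; exact: nbhs_dnbhs_neq.
by rewrite mulrBl mulfK ?expf_neq0 // addrC subrK.
Unshelve. all: by end_near. Qed.

Let cvg_ratio n (a b : R) (f g : R -> R) : b != 0 ->
  f x / x ^+ n @[x --> (0 : R)^'] --> a -> g x / x ^+ n @[x --> (0 : R)^'] --> b ->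
  f x / g x @[x --> (0 : R)^'] --> a / b.
Proof.
move=> b0 fa gb.
have K1 : (f x / x ^+ n) / (g x / x ^+ n) @[x --> (0 : R)^'] --> a / b.
  by apply: cvgM => //; exact: cvgV.
apply: cvg_trans K1; apply: near_eq_cvg; near=> x.
have x0 : x != 0 by near: x; exact: nbhs_dnbhs_neq.
by rewrite invf_div mulrA divfK ?expf_neq0.
Unshelve. all: by end_near. Qed.

Let cos_ratio : (cos x - 1) / x ^+ 2 @[x --> (0 : R)^'] --> - (1 / 2 : R).
Proof.
apply: small_ratio; rewrite (_ : (fun x : R => _) = (fun x : R => cos x - 1 + x ^+ 2 / 2)) //.
by apply/funext => x; ring.
Qed.

Let half_neq0 : - (1 / 2) != 0 :> R.
Proof. by rewrite oppr_eq0 mulf_neq0. Qed.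

(** Numerator and denominator of the difference quotient at cos x are of order 2: c2(0) x^2 / 2 over
    - x^2 / 2. *)
Lemma derive_cov1 : derive_cov C 1 = - c2 0.
Proof.
have pf : ProperFilter (within `[-1, 1]%classic (1 : R)^').
  by apply: within_itv_proper; rewrite lexx andbT; lra.
apply: cvg_lim => //; apply: (@cvg_cos_within R (fun y => (C y - C 1) / (y - 1))).
apply: cvg_dnbhs_at_right.
have -> : - c2 0 = (c2 0 / 2) / - (1 / 2) by field.
by apply: (cvg_ratio half_neq0 _ cos_ratio); exact: small_ratio.
Qed.

Lemma derive_cov_cos : \forall x \near (0 : R)^'+, derive_cov C (cos x) = - c1 x / sin x.
Proof.
have pi0 := pi_gt0 R.
near=> x.
have x0 : 0 < x by near: x; exact: nbhs_right_gt.
have xr : x < r by near: x; exact: nbhs_right_lt.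
have xpi : x < pi / 2 by near: x; apply: nbhs_right_lt; rewrite divr_gt0.
have sx : 0 < sin x by apply: sin_gt0_pi; apply/andP; split => //; lra.
have xI : x \in `[0, pi] by rewrite in_itv/=; apply/andP; split; lra.
have cx1 : cos x < 1.
  by rewrite -cos0 ltr_cos // in_itv/= lexx ltW.
have cx0 : 0 < cos x by apply: cos_gt0_pihalf; apply/andP; split; lra.
have cxI : -1 < cos x < 1 by apply/andP; split; lra.
apply: derive_within_is_derive; first by apply/andP; split; lra.
have aK : acos (cos x) = x by rewrite cosK.
have dacos := is_derive1_acos cxI.
have dcx : is_derive (acos (cos x)) 1 (fun y => C (cos y)) (c1 x).
  by rewrite aK; apply: dc; rewrite gtr0_norm.
apply: (@near_is_derive1 _ _ (fun y => C (cos (acos y)))).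
  have : \forall y \near cos x, -1 < y /\ y < 1.
    case/andP: cxI => cx2 _.
    by apply: filterI; [exact: (cvgr_gt _ cvg_id)|exact: (cvgr_lt _ cvg_id)].
  apply: filterS => y [y1 y2]; rewrite acosK // in_itv/=.
  by rewrite !ltW.
apply: (is_derive1_comp_eq dcx dacos).
have -> : 1 - cos x ^+ 2 = sin x ^+ 2 by rewrite -(cos2Dsin2 x); ring.
by rewrite sqrtr_sqr gtr0_norm //; ring.
Unshelve. all: by end_near. Qed.

(** At cos x the quotient is - (c1 x - c2(0) sin x) over (cos x - 1) sin x; both are of order 3,
    with coefficients - K/6 and - 1/2. *)
Lemma derive2_cov1 : derive2_cov C 1 = K / 3.
Proof.
have pf : ProperFilter (within `[-1, 1]%classic (1 : R)^').
  by apply: within_itv_proper; rewrite lexx andbT; lra.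
apply: cvg_lim => //.
apply: (@cvg_cos_within R (fun y => (derive_cov C y - derive_cov C 1) / (y - 1))).
have K1 : (- (c1 x - c2 0 * sin x)) / ((cos x - 1) * sin x) @[x --> (0 : R)^'] --> K / 3.
  have -> : K / 3 = (- (K / 6)) / - (1 / 2) by field.
  apply: (@cvg_ratio 3) => //; apply: small_ratio.
    have := smallZ (-1) small_k; congr (small 3).
    by apply/funext => x; ring.
  have := small_sc; congr (small 3).
  by apply/funext => x; field.
apply: cvg_trans (cvg_dnbhs_at_right K1); apply: near_eq_cvg.
have pi0 := pi_gt0 R.
near=> x.
have x0 : 0 < x by near: x; exact: nbhs_right_gt.
have xpi : x < pi / 2 by near: x; apply: nbhs_right_lt; rewrite divr_gt0.
have sx : 0 < sin x by apply: sin_gt0_pi; apply/andP; split => //; lra.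
have cx1 : cos x < 1.
  by rewrite -cos0 ltr_cos // in_itv/= ?lexx ?ltW //=; lra.
have -> : derive_cov C (cos x) = - c1 x / sin x.
  by near: x; exact: derive_cov_cos.
rewrite derive_cov1; field.
by rewrite (gt_eqF sx) andbT subr_eq0 lt_eqF.
Unshelve. all: by end_near. Qed.

(* The remainder at cos x is o(x^4), since its derivative in x is o(x^3). *)
Lemma cov_peano e : 0 < e -> exists2 del, 0 < del & forall x, 1 - del < x <= 1 ->
  `|C x - C 1 - derive_cov C 1 * (x - 1) - derive2_cov C 1 / 2 * (x - 1) ^+ 2|
    <= e * (x - 1) ^+ 2.
Proof.
move=> e0; have pi0 := pi_gt0 R.
(* The remainder at cos x, with the first derivative - c2(0) and half the second one, K/6,
   substituted. *)
pose Psi x := C (cos x) - C 1 + c2 0 * (cos x - 1) - K / 6 * (cos x - 1) ^+ 2.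
have sPsi : small 4 Psi.
  apply: (@small_derive _ _ _ (fun x => (c1 x - c2 0 * sin x - K / 6 * x ^+ 3) +
      (K / 3) * ((cos x - 1) * sin x + x ^+ 3 / 2))).
  - by rewrite /Psi cos0; ring.
  - apply: filterS near_r => x xr; rewrite /Psi; have dE := dc xr.
    have d1 : is_derive x 1 (fun y : R => cos y - 1) (- sin x).
      by have dE' := is_derive_cos x; apply: is_derive_eq; rewrite subr0.
    have d2 : is_derive x 1 (fun y : R => c2 0 * (cos y - 1)) (- (c2 0 * sin x)).
      apply: (is_derive1M_eq (f := cst (c2 0)) (is_derive_cst _ _ _) d1).
      by rewrite mul0r add0r mulrN.
    have d3 : is_derive x 1 (fun y : R => (cos y - 1) * (cos y - 1)) (- 2 * (cos x - 1) * sin x).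
      by apply: (is_derive1M_eq d1 d1); ring.
    have d4 : is_derive x 1 (fun y : R => K / 6 * (cos y - 1) ^+ 2) (- (K / 3 * (cos x - 1) * sin x)).
      rewrite (_ : (fun y => _) = (fun y : R => K / 6 * ((cos y - 1) * (cos y - 1)))); last first.
        by apply/funext => y; rewrite expr2.
      apply: (is_derive1M_eq (f := cst (K / 6)) (is_derive_cst _ _ _) d3).
      by rewrite mul0r add0r /cst; field.
    have d5 : is_derive x 1 (fun y => C (cos y) - C 1) (c1 x).
      by apply: is_derive_eq; rewrite subr0.
    have -> : (c1 x - c2 0 * sin x - K / 6 * x ^+ 3) +
      (K / 3) * ((cos x - 1) * sin x + x ^+ 3 / 2) =
      c1 x + - (c2 0 * sin x) - - (K / 3 * (cos x - 1) * sin x) by field.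
    exact: (is_deriveB (is_deriveD d5 d2) d4).
  by apply: smallD; [exact: small_k|apply: smallZ; exact: small_sc].
(* Near 0, 1 - cos x >= x^2 / 4, so x^4 <= 16 (cos x - 1)^2. *)
have e16 : 0 < e / 16 by lra.
have : \forall x \near (0 : R), `|Psi x| <= e * (cos x - 1) ^+ 2.
  have h4 : (0 : R) < 1 / 4 by lra.
  near=> x.
  have h1 : `|Psi x| <= e / 16 * `|x| ^+ 4 by near: x; exact: sPsi.
  have h2 : `|cos x - 1 + x ^+ 2 / 2| <= 1 / 4 * `|x| ^+ 2.
    by near: x; exact: (small_cos h4).
  apply: le_trans h1 _; rewrite -mulrA ler_wpM2l ?(ltW e0) //.
  have xx : `|x| ^+ 2 = x ^+ 2 by rewrite -normrX ger0_norm ?sqr_ge0.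
  have -> : `|x| ^+ 4 = (x ^+ 2) ^+ 2 by rewrite -xx -exprM.
  rewrite xx in h2; move: h2; rewrite ler_norml.
  move: (cos x) (x ^+ 2) (sqr_ge0 x) => c y y0 /andP[h2 h3].
  rewrite !expr2; nra.
move=> /nbhs_ballP[s /= s0 sP].
pose s' := Num.min s (pi / 2).
have s'0 : 0 < s' by rewrite lt_min s0 divr_gt0.
have s'pi : s' < pi by rewrite gt_min; apply/orP; right; lra.
have Is : s' \in `[0, pi] by rewrite in_itv/= (ltW s'0) (ltW s'pi).
have I0 : (0 : R) \in `[0, pi] by rewrite in_itv/= lexx (ltW pi0).
exists (1 - cos s').
  by rewrite subr_gt0 -cos0 ltr_cos.
move=> x /andP[xs x1].
have xD : -1 <= x <= 1.
  rewrite x1 andbT; apply: ltW; apply: le_lt_trans (cos_geN1 s') _; lra.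
have /andP[a0 ap] := (acos_def xD).1; have ax := (acos_def xD).2.
have as' : acos x < s'.
  by rewrite -ltr_cos ?ax //; [lra|rewrite in_itv/= a0 ap].
have := sP (acos x); rewrite /ball/= sub0r normrN ger0_norm // /Psi ax => H.
have {}H := H (lt_le_trans as' _).
rewrite derive_cov1 derive2_cov1.
have -> : C x - C 1 - - c2 0 * (x - 1) - K / 3 / 2 * (x - 1) ^+ 2 =
  C x - C 1 + c2 0 * (x - 1) - K / 6 * (x - 1) ^+ 2 by field.
by apply: H; rewrite ge_min lexx.
Unshelve. all: by end_near. Qed.

End cov_expansion.

(** * Expansion of the covariance in a chart *)

Definition mixed_diff (R : realType) (N : nat) (i j : 'I_N) (f : 'rV[R]_N -> R) : R :=
  f (delta_mx 0 i + delta_mx 0 j) - f (delta_mx 0 i) - f (delta_mx 0 j) + f 0.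

Section chart_expansion.
Context {R : realType} {N : nat}.
Implicit Types u v : 'rV[R]_N.

(** Inner product of the points of the sphere with chart coordinates h u and h v, as computed in
    [dot_chart]. *)
Definition chart_cos (h : R) u v : R :=
  (1 + h ^+ 2 * dot u v) /
  (Num.sqrt (1 + h ^+ 2 * dot u u) * Num.sqrt (1 + h ^+ 2 * dot v v)).

(* chart_cos h u v = 1 + h^2 (lin_coef u v) + h^4 (quad_coef u v) + o(h^4). *)
Definition lin_coef u v : R := dot u v - (dot u u + dot v v) / 2.

Definition quad_coef u v : R :=
  (dot u v ^+ 2 - dot u u * dot v v - lin_coef u v ^+ 2
   - 2 * lin_coef u v * (dot u u + dot v v)) / 2.

Variable h : nat -> R.
Hypotheses (h0 : forall n, h n != 0) (hc : h n @[n --> \oo] --> (0 : R)).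

Let k n := h n ^+ 2.

Let k_gt0 n : 0 < k n. Proof. by rewrite /k exprn_even_gt0 /= ?h0. Qed.

Let k_cvg : k n @[n --> \oo] --> (0 : R).
Proof.
have K : h n * h n @[n --> \oo] --> (0 * 0 : R) by apply: cvgM; exact: hc.
rewrite mulr0 in K; rewrite /k; under eq_fun do rewrite expr2; exact: K.
Qed.

Let kc_cvg (c : R) : k n * c @[n --> \oo] --> (0 : R).
Proof.
have K : k n * c @[n --> \oo] --> 0 * c by apply: cvgM; [exact: k_cvg|exact: cvg_cst].
by rewrite mul0r in K.
Qed.

Variables u v : 'rV[R]_N.
Let a := dot u u. Let b := dot v v. Let m := dot u v.
Let p := lin_coef u v.
Let x n := chart_cos (h n) u v.
Let D n := (1 + k n * a) * (1 + k n * b).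
Let y n := (x n - 1) / k n.

Let D_gt0 n : 0 < D n.
Proof. by rewrite mulr_gt0 // ltr_pwDl // mulr_ge0 ?dot_ge0 // ltW. Qed.

Let D_cvg : D n @[n --> \oo] --> (1 : R).
Proof.
have K : D n @[n --> \oo] --> (1 + 0) * (1 + 0 : R).
  by apply: cvgM; apply: cvgD; [exact: cvg_cst|exact: kc_cvg|exact: cvg_cst|exact: kc_cvg].
by rewrite addr0 mulr1 in K.
Qed.

Let x_def n : x n = (1 + k n * m) / Num.sqrt (D n).
Proof.
rewrite /x /chart_cos -sqrtrM // ?addr_ge0 // mulr_ge0 ?dot_ge0 //.
exact: sqr_ge0.
Qed.

Let x_cvg : x n @[n --> \oo] --> (1 : R).
Proof.
have K : (1 + k n * m) / Num.sqrt (D n) @[n --> \oo] --> (1 + 0) / Num.sqrt 1.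
  apply: cvgM; first by apply: cvgD; [exact: cvg_cst|exact: kc_cvg].
  apply: cvgV; first by rewrite sqrtr1 oner_neq0.
  by apply: continuous_cvg; [exact: sqrt_continuous|exact: D_cvg].
rewrite addr0 sqrtr1 invr1 mulr1 in K.
by apply: cvg_trans K; apply: near_eq_cvg; apply: nearW => n; rewrite x_def.
Qed.

Let x_sqr n : x n ^+ 2 * D n = (1 + k n * m) ^+ 2.
Proof.
by rewrite x_def exprMn exprVn sqr_sqrtr ?ltW // divfK // gt_eqF.
Qed.

(** Squaring removes the roots: x^2 D = (1 + k m)^2, so D (x - 1) (x + 1) = (1 + k m)^2 - D, which
    is k (2 p + k (m^2 - a b)). *)
Let yE n : 1 + x n != 0 -> y n = (2 * p + k n * (m ^+ 2 - a * b)) / (D n * (1 + x n)).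
Proof.
move=> x1; have kn := k_gt0 n; have Dn := D_gt0 n; have xs := x_sqr n.
apply: (mulIf (x := k n * (D n * (1 + x n)))).
  exact: mulf_neq0 (lt0r_neq0 kn) (mulf_neq0 (lt0r_neq0 Dn) x1).
rewrite /y.
have -> : (x n - 1) / k n * (k n * (D n * (1 + x n))) = x n ^+ 2 * D n - D n.
  by field; rewrite gt_eqF.
rewrite xs.
have -> : (2 * p + k n * (m ^+ 2 - a * b)) / (D n * (1 + x n)) * (k n * (D n * (1 + x n))) =
  (2 * p + k n * (m ^+ 2 - a * b)) * k n.
  by field; rewrite x1 gt_eqF.
by rewrite /D /p /lin_coef -/a -/b -/m; field.
Qed.

Let x1_neq0 : \forall n \near \oo, 1 + x n != 0.
Proof.
near=> n; rewrite gt_eqF //; have : 0 < x n by near: n; apply: (cvgr_gt _ x_cvg); exact: ltr01.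
by move=> ?; rewrite ltr_wpDl.
Unshelve. all: by end_near. Qed.

Let Dx_cvg : D n * (1 + x n) @[n --> \oo] --> (2 : R).
Proof.
have K : D n * (1 + x n) @[n --> \oo] --> 1 * (1 + 1 : R).
  by apply: cvgM; [exact: D_cvg|apply: cvgD; [exact: cvg_cst|exact: x_cvg]].
by rewrite mul1r in K.
Qed.

Let y_cvg : y n @[n --> \oo] --> p.
Proof.
have K : (2 * p + k n * (m ^+ 2 - a * b)) / (D n * (1 + x n)) @[n --> \oo] --> (2 * p + 0) / 2.
  apply: cvgM; last by apply: cvgV; [by rewrite pnatr_eq0|exact: Dx_cvg].
  by apply: cvgD; [exact: cvg_cst|exact: kc_cvg].
rewrite addr0 mulrAC divff // mul1r in K.
apply: cvg_trans K; apply: near_eq_cvg; near=> n; rewrite yE //.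
by near: n; exact: x1_neq0.
Unshelve. all: by end_near. Qed.

(** From the same identity: in 2 p - p D (1 + x) the terms of order 0 cancel, since 1 + x = 2 + k y,
    and a factor k comes out. *)
Let yp_cvg : (y n - p) / k n @[n --> \oo] --> quad_coef u v.
Proof.
have K : ((m ^+ 2 - a * b) - p * (y n + (a + b) * (1 + x n) + k n * (a * b) * (1 + x n))) /
    (D n * (1 + x n)) @[n --> \oo] -->
    ((m ^+ 2 - a * b) - p * (p + (a + b) * (1 + 1) + 0 * (1 + 1))) / 2.
  have x1 : 1 + x n @[n --> \oo] --> (1 + 1 : R) by apply: cvgD; [exact: cvg_cst|exact: x_cvg].
  apply: cvgM; last by apply: cvgV; [by rewrite pnatr_eq0|exact: Dx_cvg].
  apply: cvgB; first exact: cvg_cst.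
  apply: cvgM; first exact: cvg_cst.
  apply: cvgD; last by apply: cvgM; [exact: kc_cvg|exact: x1].
  by apply: cvgD; [exact: y_cvg|apply: cvgM; [exact: cvg_cst|exact: x1]].
have -> : quad_coef u v = ((m ^+ 2 - a * b) - p * (p + (a + b) * (1 + 1) + 0 * (1 + 1))) / 2.
  by rewrite /quad_coef -/p -/m -/a -/b; congr (_ / _); ring.
apply: cvg_trans K; apply: near_eq_cvg; near=> n.
have x1 : 1 + x n != 0 by near: n; exact: x1_neq0.
have kn := k_gt0 n; have Dn := D_gt0 n.
have Dx0 : D n * (1 + x n) != 0 by rewrite mulf_neq0 // gt_eqF.
apply: (mulIf Dx0); rewrite divfK //.
have yDx : y n * (D n * (1 + x n)) = 2 * p + k n * (m ^+ 2 - a * b) by rewrite yE // divfK.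
have -> : (y n - p) / k n * (D n * (1 + x n)) =
  (y n * (D n * (1 + x n)) - p * (D n * (1 + x n))) / k n by ring.
rewrite yDx.
have xy : x n = 1 + k n * y n by rewrite /y; field; rewrite gt_eqF.
rewrite /D xy; field.
by rewrite gt_eqF.
Unshelve. all: by end_near. Qed.

Variables (C : R -> R) (A E : R).
Hypothesis C_peano : forall e, 0 < e -> exists2 del, 0 < del &
  forall x, 1 - del < x <= 1 ->
    `|C x - C 1 - A * (x - 1) - E / 2 * (x - 1) ^+ 2| <= e * (x - 1) ^+ 2.
Hypothesis x_le1 : forall n, x n <= 1.

(** As x - 1 = k y with y convergent, the Peano remainder is o(k^2); the constant e / (p^2 + 1)
    absorbs the bound y^2 <= p^2 + 1. *)
Lemma cvg_chart_expansion :
  (C (x n) - C 1 - A * (h n ^+ 2 * p)) / (h n ^+ 2) ^+ 2 @[n --> \oo] -->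
  A * quad_coef u v + E / 2 * lin_coef u v ^+ 2.
Proof.
pose rem n := C (x n) - C 1 - A * (x n - 1) - E / 2 * (x n - 1) ^+ 2.
have rem_cvg : rem n / k n ^+ 2 @[n --> \oo] --> (0 : R).
  apply/cvgr0Pnorm_le => e e0.
  have p1 : 0 < p ^+ 2 + 1 by rewrite ltr_wpDl // sqr_ge0.
  have yy : y n ^+ 2 @[n --> \oo] --> p ^+ 2.
    by rewrite expr2; under eq_fun do rewrite expr2; apply: cvgM; exact: y_cvg.
  have [del del0 H] := C_peano (divr_gt0 e0 p1).
  near=> n.
  have h1 : `|rem n| <= e / (p ^+ 2 + 1) * (x n - 1) ^+ 2.
    apply: H; rewrite x_le1 andbT; near: n; apply: (cvgr_gt _ x_cvg).
    by rewrite ltrBlDr ltrDl.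
  have h2 : y n ^+ 2 <= p ^+ 2 + 1.
    by near: n; apply: (cvgr_le _ yy); rewrite ltrDl.
  have kn2 : 0 < k n ^+ 2 by rewrite exprn_gt0.
  rewrite normrM normfV (gtr0_norm kn2) ler_pdivrMr //.
  apply: le_trans h1 _.
  have -> : x n - 1 = k n * y n by rewrite /y; field; rewrite gt_eqF.
  rewrite exprMn [_ * y n ^+ 2]mulrC mulrA ler_wpM2r ?(ltW kn2) //.
  by rewrite mulrAC ler_pdivrMr // ler_wpM2l // ltW.
have K : rem n / k n ^+ 2 + A * ((y n - p) / k n) + E / 2 * (y n * y n) @[n --> \oo] -->
    0 + A * quad_coef u v + E / 2 * (p * p).
  apply: cvgD; last by apply: cvgM; [exact: cvg_cst|apply: cvgM; exact: y_cvg].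
  by apply: cvgD; [exact: rem_cvg|apply: cvgM; [exact: cvg_cst|exact: yp_cvg]].
rewrite add0r -expr2 in K.
rewrite (_ : (fun n => _) = fun n => rem n / k n ^+ 2 + A * ((y n - p) / k n) + E / 2 * (y n * y n)) //.
apply/funext => n; rewrite /rem -/(k n) /y; have := k_gt0 n; move: (k n) => z z0.
by field; rewrite gt_eqF.
Unshelve. all: by end_near. Qed.

End chart_expansion.

Section mixed_diff_expansion.
Context {R : realType} {N : nat}.
Implicit Types (A E : R) (i j k l : 'I_N).

Let dee i j : dot (delta_mx 0 i : 'rV[R]_N) (delta_mx 0 j) = (i == j)%:R.
Proof. by rewrite dot_delta mxE eqxx. Qed.

Let d0r (u : 'rV[R]_N) : dot u 0 = 0. Proof. by rewrite dotC dot0l. Qed.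

Lemma mixed_diff_lin_coef i j :
  mixed_diff i j (fun u : 'rV[R]_N => lin_coef u 0) = - (i == j)%:R.
Proof.
rewrite /mixed_diff /lin_coef !d0r !dotDl !dotDr !dee !eqxx (eq_sym j i).
by field.
Qed.

(** The difference in v kills the terms affine in v, and what it leaves is constant in u. Hence the
    order h^2 drops out of the covariances of the Hessian, which live at order h^4. *)
Lemma mixed_diff2_lin_coef i j k l :
  mixed_diff i j (fun u : 'rV[R]_N => mixed_diff k l (fun v => lin_coef u v)) = 0.
Proof.
rewrite /mixed_diff /lin_coef !d0r !dot0l !dotDl !dotDr !dee !eqxx.
by field.
Qed.

Lemma mixed_diff2_quad_coef A E i j k l :
  mixed_diff i j (fun u : 'rV[R]_N => mixed_diff k l (fun v =>
    A * quad_coef u v + E / 2 * lin_coef u v ^+ 2)) =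
  A * ((i == j)%:R * (k == l)%:R) +
  E * ((i == j)%:R * (k == l)%:R + (i == k)%:R * (j == l)%:R + (i == l)%:R * (j == k)%:R).
Proof.
rewrite /mixed_diff /quad_coef /lin_coef !d0r !dot0l !dotDl !dotDr !dee !eqxx.
rewrite (eq_sym j i) (eq_sym l k).
by field.
Qed.

End mixed_diff_expansion.

(** * Covariances of derivatives of a stationary family *)

Definition lspan (R : realType) (I T : Type) (D : set I) (Y : I -> T -> R) : set (T -> R) :=
  [set Z | exists n (k : 'I_n -> I) (a : 'I_n -> R),
     (forall l, D (k l)) /\ Z = (fun w => \sum_(l < n) a l * Y (k l) w)].

Section lspan.
Context {d : measure_display} {T : measurableType d} {R : realType}.
Variable P : probability T R.

Lemma ExE (Z : T -> R) : Ex P Z = fine ('E_P[Z])%E.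
Proof. by rewrite unlock. Qed.

Lemma sub_lspan (I : Type) (D : set I) (Y : I -> T -> R) i : D i -> lspan D Y (Y i).
Proof.
move=> Di; exists 1%N, (fun=> i), (fun=> 1); split=> //.
by apply/funext => w; rewrite big_ord1 mul1r.
Qed.

Lemma gaussian_rv_mean (Z : T -> R) : gaussian_rv P Z -> P.-integrable setT (EFin \o Z) /\
  exists v, cgauss P (fun w => Z w - Ex P Z) v.
Proof.
move=> /gaussian_rv_cgauss[m [v Zv]]; have [iZ EZ] := cgauss_mean Zv.
have im : P.-integrable setT (EFin \o cst m) by exact: finite_measure_integrable_cst.
have ZE : Z = (fun w => (Z w - m) + m) by apply/funext => w; rewrite subrK.
have iZ' : P.-integrable setT (EFin \o Z).
  rewrite ZE; under [X in integrable _ _ X]eq_fun do rewrite /= EFinD.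
  exact: integrableD.
split=> //; exists v; have -> : Ex P Z = m; last by [].
by rewrite {1}ZE ExD // EZ Ex_cst add0r.
Qed.

Lemma lspan_gspace (I : Type) (D : set I) (Y : I -> T -> R) :
  gaussian_family P D Y -> (forall i, D i -> ('E_P[Y i] = 0)%E) -> gspace P (lspan D Y).
Proof.
move=> gY Y0; split=> [Z [n [k [a [Dk ->]]]]|a b Z W [n [k [x [Dk ->]]]] [m [l [y [Dl ->]]]]].
- have iY l : P.-integrable setT (EFin \o Y (k l)).
    have := gY 1%N (fun=> k l) (fun=> 1) (fun=> Dk l).
    rewrite (_ : (fun w => _) = Y (k l)); last by apply/funext => w; rewrite big_ord1 mul1r.
    by move=> /gaussian_rv_mean[].
  have [_ [v]] := gaussian_rv_mean (gY n k a Dk).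
  suff -> : Ex P (fun w => \sum_(l < n) a l * Y (k l) w) = 0.
    by under eq_fun do rewrite subr0; exists v.
  suff : forall s : seq 'I_n, P.-integrable setT (EFin \o (fun w => \sum_(l <- s) a l * Y (k l) w)) /\
      Ex P (fun w => \sum_(l <- s) a l * Y (k l) w) = 0 by move=> /(_ (index_enum _))[].
  elim=> [|l s [iS Es]].
    under eq_fun do rewrite big_nil; rewrite Ex_cst; split=> //.
    exact: finite_measure_integrable_cst.
  have il : P.-integrable setT (EFin \o (fun w => a l * Y (k l) w)).
    under [X in integrable _ _ X]eq_fun do rewrite /= EFinM.
    exact: (integrableZl measurableT (a l) (iY l)).
  under eq_fun do rewrite big_cons; split.
    under [X in integrable _ _ X]eq_fun do rewrite /= EFinD.
    exact: (integrableD measurableT il iS).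
  by rewrite ExD // Es addr0 ExZ // ExE Y0 // mulr0.
- exists (n + m)%N, (fun o => match fintype.split o with inl i => k i | inr i => l i end),
    (fun o => match fintype.split o with inl i => a * x i | inr i => b * y i end); split=> [q|].
    by case: (fintype.split q).
  apply/funext => w; rewrite big_split_ord !mulr_sumr; congr (_ + _).
    by apply: eq_bigr => i _; rewrite (unsplitK (inl i)) mulrA.
  by apply: eq_bigr => i _; rewrite (unsplitK (inr i)) mulrA.
Qed.

Lemma cgauss_ae (Z Z' : T -> R) v : cgauss P Z v -> measurable_fun setT Z' ->
  {ae P, forall w, Z' w = Z w} -> cgauss P Z' v.
Proof.
move=> [mZ v0 ZE] mZ' ZZ'; split=> // u b; rewrite -ZE.
have mc (Y : T -> R) : measurable_fun setT Y -> measurable_fun setT (fun w => cos (u * Y w + b)).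
  move=> mY; apply: (measurableT_comp (f := cos)).
    by apply: continuous_measurable_fun; exact: continuous_cos.
  by apply: measurable_funD => //; apply: measurable_funM.
by apply: ae_eq_Ex; [exact: mc|exact: mc|apply: filterS ZZ' => w ->].
Qed.

Variable f : T -> R.
Hypotheses (mf : measurable_fun setT f) (f1 : {ae P, forall w, f w = 1}).

(** With [f] the indicator of a set of full measure, bad paths are replaced by 0 while Gaussian laws
    and covariances are preserved. *)
Definition rescale (V : set (T -> R)) : set (T -> R) :=
  [set Z | exists2 W, V W & Z = (fun w => f w * W w)].

Lemma rescale_gspace V : gspace P V -> gspace P (rescale V).
Proof.
move=> gV; split=> [_ [W VW ->]|a b _ _ [W VW ->] [W' VW' ->]]; last first.
  exists (fun w => a * W w + b * W' w); first exact: gV.2.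
  by apply/funext => w; ring.
have [v Wv] := gV.1 W VW; exists v; apply: cgauss_ae Wv _ _.
  by apply: measurable_funM => //; exact: gspace_measurable gV _ VW.
by apply: filterS f1 => w ->; rewrite mul1r.
Qed.

Lemma cov_rescale V Z W : gspace P V -> V Z -> V W ->
  cov P (fun w => f w * Z w) (fun w => f w * W w) = cov P Z W.
Proof.
move=> gV VZ VW.
have mZ := gspace_measurable gV VZ; have mW := gspace_measurable gV VW.
apply: ae_eq_Ex; first by apply: measurable_funM; apply: measurable_funM.
  exact: measurable_funM.
by apply: filterS f1 => w ->; rewrite !mul1r.
Qed.

End lspan.

Section stationary.
Context {d : measure_display} {T : measurableType d} {R : realType}.
Variables (P : probability T R) (V : set (T -> R)).
Hypothesis gV : gspace P V.

(** Difference quotients belong to the space and converge at every outcome, so [cov_cvg]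
    differentiates under the expectation. *)
Lemma cov_derive (Y Y1 : R -> T -> R) (W : T -> R) (x : R) :
  (forall y, V (Y y)) -> V (Y1 x) -> V W ->
  (forall w, is_derive x 1 (Y ^~ w) (Y1 x w)) ->
  is_derive x 1 (fun y => cov P (Y y) W) (cov P (Y1 x) W).
Proof.
move=> VY VY1 VW dY; apply/is_derive1_seqP => h h0 hc.
pose z n w := (h n)^-1 * Y (x + h n) w + (- (h n)^-1) * Y x w.
have Vz n : V (z n) by exact: gV.2.
rewrite (_ : (fun n => _) = fun n => cov P (z n) W); last first.
  by apply/funext => n; rewrite /z (covDl gV) //; ring.
apply: (cov_cvg gV (z := z) (y := fun=> W)) => // w; last exact: cvg_cst.
rewrite (_ : (fun n => _) = fun n => (h n)^-1 * (Y (x + h n) w - Y x w)).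
  by have /is_derive1_seqP := dY w; exact.
by apply/funext => n; rewrite /z; ring.
Qed.

Variables (Y Y1 Y2 : R -> T -> R) (c : R -> R) (r : R).
Hypotheses (r0 : 0 < r) (VY : forall x, V (Y x)) (VY1 : forall x, V (Y1 x))
  (VY2 : forall x, V (Y2 x))
  (dY : forall (x : R) w, `|x| < r -> is_derive x 1 (Y ^~ w) (Y1 x w))
  (dY1 : forall (x : R) w, `|x| < r -> is_derive x 1 (Y1 ^~ w) (Y2 x w))
  (covY : forall x y, `|x| < r -> `|y| < r -> cov P (Y x) (Y y) = c (x - y)).

Let near_lt (x : R) : `|x| < r -> \forall y \near x, `|y| < r.
Proof.
move=> xr; have : `|y| @[y --> x] --> `|x| by apply: cvg_norm; exact: cvg_id.
by move=> /cvgr_lt; apply.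
Qed.

Let r00 : `|0 : R| < r. Proof. by rewrite normr0. Qed.

Let c1 x := cov P (Y1 x) (Y 0).
Let c2 x := cov P (Y2 x) (Y 0).
Let c3 x := - cov P (Y2 0) (Y1 (- x)).

Lemma stationary_derive1 (x : R) : `|x| < r -> is_derive x 1 c (c1 x).
Proof.
move=> xr; apply: (@near_is_derive1 _ _ (fun y => cov P (Y y) (Y 0))).
  by apply: filterS (near_lt xr) => y yr; rewrite covY // subr0.
by apply: cov_derive => // w; exact: dY.
Qed.

Lemma stationary_derive2 (x : R) : `|x| < r -> is_derive x 1 c1 (c2 x).
Proof. by move=> xr; apply: cov_derive => // w; exact: dY1. Qed.

Let is_derive_shift (f : R -> R) (l x y : R) : is_derive (x - y) 1 f l ->
  is_derive x 1 (fun z => f (z - y)) l.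
Proof.
move=> df; have dx : is_derive x 1 (fun z : R => z - y) 1.
  by apply: is_derive_eq; rewrite subr0.
by apply: (@is_derive1_comp_eq _ f (fun z => z - y) x l 1 l df dx); rewrite mulr1.
Qed.

(** Differentiating cov (Y z) (Y y) = c (z - y) in z shows that the covariance of the derivative
    with the process again depends on x - y only. *)
Let shift1 (x y : R) : `|x| < r -> `|y| < r -> `|x - y| < r -> cov P (Y1 x) (Y y) = c1 (x - y).
Proof.
move=> xr yr xyr.
apply: (@is_derive_unique _ (fun z => cov P (Y z) (Y y)) x).
  by apply: cov_derive => // w; exact: dY.
apply: (@near_is_derive1 _ _ (fun z => c (z - y))).
  by apply: filterS (near_lt xr) => z zr; rewrite covY.
by apply: is_derive_shift; exact: stationary_derive1.
Qed.

Let shift2 (y : R) : `|y| < r -> cov P (Y2 0) (Y y) = c2 (- y).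
Proof.
move=> yr.
apply: (@is_derive_unique _ (fun z => cov P (Y1 z) (Y y)) 0).
  by apply: cov_derive => // w; exact: dY1.
apply: (@near_is_derive1 _ _ (fun z => c1 (z - y))); last first.
  by apply: is_derive_shift; rewrite sub0r; apply: stationary_derive2; rewrite normrN.
have nz : \forall z \near (0 : R), `|z - y| < r.
  have : `|z - y| @[z --> (0 : R)] --> `|0 - y|.
    by apply: cvg_norm; apply: cvgB; [exact: cvg_id|exact: cvg_cst].
  by move=> /cvgr_lt; apply; rewrite sub0r normrN.
by apply: filterS2 (near_lt r00) nz => z zr zyr; exact: shift1.
Qed.

Let is_deriveNarg (f : R -> R) (l x : R) : is_derive (- x) 1 f l ->
  is_derive x 1 (fun z => f (- z)) (- l).
Proof.
move=> df; have dx : is_derive x 1 (fun z : R => - z) (- 1) by apply: is_derive_eq.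
by apply: (@is_derive1_comp_eq _ f (fun z => - z) x l (- 1) (- l) df dx); rewrite mulrN1.
Qed.

(* Stationarity moves the derivatives to the other factor, which makes a third
   and a fourth differentiation possible with C^2 paths only. *)
Lemma stationary_derive3 (x : R) : `|x| < r -> is_derive x 1 c2 (c3 x).
Proof.
move=> xr; apply: (@near_is_derive1 _ _ (fun y => cov P (Y (- y)) (Y2 0))).
  by apply: filterS (near_lt xr) => y yr; rewrite covC shift2 ?opprK // normrN.
rewrite /c3 covC; apply: (is_deriveNarg (f := fun y => cov P (Y y) (Y2 0))).
by apply: cov_derive => // w; apply: dY; rewrite normrN.
Qed.

Lemma stationary_derive4 : is_derive (0 : R) (1 : R) c3 (cov P (Y2 0) (Y2 0)).
Proof.
rewrite -[cov P _ _]opprK; apply: is_deriveN.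
rewrite (_ : (fun x => cov P (Y2 0) (Y1 (- x))) = fun x => cov P (Y1 (- x)) (Y2 0)); last first.
  by apply/funext => x; rewrite covC.
apply: (is_deriveNarg (f := fun y => cov P (Y1 y) (Y2 0))); rewrite oppr0.
by apply: cov_derive => // w; exact: dY1.
Qed.

End stationary.

(** * Positive definiteness on the circle *)

Section circle.
Context {R : realType}.
Variable C : R -> R.
Hypothesis C_posdef : forall n (a th : 'I_n -> R),
  0 <= \sum_(k < n) \sum_(l < n) a k * a l * C (cos (th k - th l)).

(** Positive definiteness at two points with weights 1 and -1. *)
Lemma posdef_le (x : R) : C (cos x) <= C 1.
Proof.
have := @C_posdef 2 (fun i => if i == 0 then 1 else -1) (fun i => if i == 0 then 0 else x).
rewrite !big_ord_recl !big_ord0 /= !subr0 !subrr sub0r cosN cos0.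
by lra.
Qed.

Variable m : nat.
Hypothesis m_gt0 : (0 < m)%N.

Lemma sum_periodic (f : R -> R) (x : R) n : (forall y, f (y + m%:R) = f y) ->
  \sum_(k < m) f (k%:R + (x + n%:R)) = \sum_(k < m) f (k%:R + x).
Proof.
move=> fm; elim: n => [|n <-]; first by rewrite addr0.
move: fm; case: m m_gt0 => // m' _ fm.
rewrite big_ord_recr [RHS]big_ord_recl /= addrC; congr (_ + _).
  by rewrite -[RHS]fm -!natr1; congr f; ring.
by apply: eq_bigr => k _; rewrite /bump /= add1n -!natr1; congr f; ring.
Qed.

Let th : R := 2 * pi / m%:R.

Let mth : m%:R * th = pi *+ 2.
Proof. by rewrite /th mulrC divfK ?pnatr_eq0 -?lt0n // mulr_natl. Qed.

Let cos_period n (x : R) : cos (x + n%:R * (m%:R * th)) = cos x.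
Proof.
rewrite mth; elim: n => [|n IH]; first by rewrite mul0r addr0.
by rewrite -natr1 mulrDl mul1r addrA cosD2pi.
Qed.

Let cos_periodm (x : R) : cos (x + m%:R * th) = cos x.
Proof. by rewrite -[m%:R * th]mul1r (cos_period 1). Qed.

(** Discrete Bochner theorem on the cyclic group: testing positive definiteness with the weights cos
    (n k th) and sin (n k th) and adding gives m times the Fourier coefficient, the double sum being
    a function of k - l modulo m. *)
Lemma posdef_fourier n : 0 <= \sum_(k < m) C (cos (k%:R * th)) * cos (n%:R * (k%:R * th)).
Proof.
pose f (x : R) := C (cos (x * th)) * cos (n%:R * (x * th)).
have fm (y : R) : f (y + m%:R) = f y.
  by rewrite /f mulrDl mulrDr cos_period cos_periodm.
have h1 := C_posdef (fun k : 'I_m => cos (n%:R * (k%:R * th))) (fun k => k%:R * th).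
have h2 := C_posdef (fun k : 'I_m => sin (n%:R * (k%:R * th))) (fun k => k%:R * th).
have : 0 <= \sum_(l < m) \sum_(k < m) f (k%:R + - l%:R).
  have -> : \sum_(l < m) \sum_(k < m) f (k%:R + - l%:R) =
    (\sum_(k < m) \sum_(l < m) cos (n%:R * (k%:R * th)) * cos (n%:R * (l%:R * th)) *
      C (cos (k%:R * th - l%:R * th))) +
    (\sum_(k < m) \sum_(l < m) sin (n%:R * (k%:R * th)) * sin (n%:R * (l%:R * th)) *
      C (cos (k%:R * th - l%:R * th))).
    rewrite exchange_big -big_split; apply: eq_bigr => k _.
    rewrite -big_split; apply: eq_bigr => l _.
    by rewrite /f mulrBl mulrBr (cosB (n%:R * _)) /=; ring.
  exact: addr_ge0.
have -> : \sum_(l < m) \sum_(k < m) f (k%:R + - l%:R) = m%:R * \sum_(k < m) f k%:R.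
  rewrite mulr_natl -[X in _ *+ X]card_ord -sumr_const; apply: eq_bigr => l _.
  rewrite -(sum_periodic (- l%:R) l fm); apply: eq_bigr => k _.
  by rewrite addNr addr0.
by rewrite pmulr_rge0 // ltr0n.
Qed.

(** The sum S(y) is unchanged under y -> y + x, whereas S(y + x) + S(y - x) = 2 cos x S(y); hence (1
    - cos x) S = 0. *)
Lemma sum_cos (x y : R) : cos (m%:R * x) = 1 -> cos x != 1 -> \sum_(n < m) cos (n%:R * x + y) = 0.
Proof.
move=> mx x1; pose f (z : R) := cos (z * x).
have sx : sin (m%:R * x) = 0.
  by apply/eqP; have := cos2Dsin2 (m%:R * x); rewrite mx => /eqP; rewrite expr1n -subr_eq0 addrAC subrr add0r sqrf_eq0.
have fm (z : R) : cos (z + m%:R * x) = cos z.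
  by rewrite cosD mx sx mulr1 mulr0 subr0.
have S1 (z : R) : \sum_(n < m) cos (n%:R * x + (z + x)) = \sum_(n < m) cos (n%:R * x + z).
  move: fm; case: m m_gt0 => // m' _ fm.
  rewrite big_ord_recr [RHS]big_ord_recl /= addrC; congr (_ + _).
    by rewrite -[RHS]fm -!natr1; congr cos; ring.
  by apply: eq_bigr => k _; rewrite /bump /= add1n -!natr1; congr cos; ring.
have : \sum_(n < m) cos (n%:R * x + (y + x)) + \sum_(n < m) cos (n%:R * x + (y - x)) =
    2 * cos x * \sum_(n < m) cos (n%:R * x + y).
  rewrite -big_split mulr_sumr; apply: eq_bigr => n _ /=.
  by rewrite !addrA cosD (cosB _ x); ring.
rewrite S1 -(S1 (y - x)) subrK => S.
have : (1 - cos x) * \sum_(n < m) cos (n%:R * x + y) = 0 by lra.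
by move/eqP; rewrite mulf_eq0 subr_eq0 eq_sym (negbTE x1) => /eqP.
Qed.

Let D (x : R) := \sum_(n < m) cos (n%:R * (x * th)).

Let D_ord (k : 'I_m) : D k%:R = if k == 0 :> nat then m%:R else 0.
Proof.
rewrite /D; case: eqP => [->|/eqP k0].
  under eq_bigr do rewrite mul0r mulr0 cos0.
  by rewrite sumr_const card_ord.
have pi0 := pi_gt0 R.
have th0 : 0 < th by rewrite divr_gt0 ?ltr0n ?mulr_gt0.
under eq_bigr do rewrite -[_ * (k%:R * th)]addr0.
apply: sum_cos; first by rewrite -[_ * _]add0r mulrCA cos_period cos0.
have kth : k%:R * th < 2 * pi.
  by rewrite [2 * pi]mulrC mulr_natr -mth ltr_pM2r // ltr_nat.
have kth0 : 0 < k%:R * th by rewrite mulr_gt0 // ltr0n lt0n.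
apply/eqP => c1.
have : sin (k%:R * th / 2) ^+ 2 = 0.
  have := cos_mulr2n (k%:R * th / 2); have := cos2Dsin2 (k%:R * th / 2).
  by rewrite -[_ / 2 *+ 2]mulr_natr divfK // c1; lra.
have : 0 < sin (k%:R * th / 2) by apply: sin_gt0_pi; lra.
by move=> s0 /eqP; rewrite sqrf_eq0 gt_eqF.
Qed.

Let C_th (s : R) : \sum_(k < m) C (cos ((k%:R + s) * th)) * D k%:R = m%:R * C (cos (s * th)).
Proof.
move: m_gt0 => /prednK mE.
rewrite (bigD1 (Ordinal m_gt0)) //= big1 ?addr0.
  by rewrite (D_ord (Ordinal m_gt0)) /= add0r mulrC.
move=> k k0; rewrite D_ord (_ : (k == 0 :> nat) = false) ?mulr0 //.
by apply/negbTE.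
Qed.

(** Fourier inversion: [D] is m times the indicator of 0 on the cyclic group, so convolution with it
    recovers the value of [C] at the angle i th. *)
Let C_shift (i : nat) :
  \sum_(k < m) C (cos (k%:R * th)) * D (k%:R + i%:R) = m%:R * C (cos (i%:R * th)) /\
  \sum_(k < m) C (cos (k%:R * th)) * D (k%:R - i%:R) = m%:R * C (cos (i%:R * th)).
Proof.
have Dm (y : R) : D (y + m%:R) = D y.
  by apply: eq_bigr => n _; rewrite mulrDl mulrDr cos_period.
have Cm (y : R) : C (cos ((y + m%:R) * th)) = C (cos (y * th)).
  by rewrite mulrDl cos_periodm.
split.
  have := @sum_periodic (fun x => C (cos ((x - i%:R) * th)) * D x) 0 i.
  rewrite add0r => H; rewrite -[RHS](_ : m%:R * C (cos (- i%:R * th)) = _); last by rewrite mulNr cosN.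
  rewrite -C_th.
  under [RHS]eq_bigr do rewrite -[X in D X]addr0 -[X in C (cos ((X - _) * _))]addr0.
  rewrite -[RHS]H => [|y]; last by rewrite addrAC Cm Dm.
  by apply: eq_bigr => k _; rewrite addrK.
have := @sum_periodic (fun x => C (cos (x * th)) * D (x - i%:R)) 0 i.
rewrite add0r => H; rewrite -C_th.
under [LHS]eq_bigr do rewrite -[X in C (cos (X * _))]addr0 -[X in D (X - _)]addr0.
rewrite -[LHS]H => [|y]; last by rewrite addrAC Cm Dm.
by apply: eq_bigr => k _; rewrite addrK.
Qed.

(** For 0 < n < m the angle n th lies between th and 2 pi - th, so its cosine is at most cos th; for
    n = 0 the first factor vanishes. *)
Let weight_ge0 (n : 'I_m) : 0 <= (1 - cos (n%:R * th)) * (cos th - cos (n%:R * th)).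
Proof.
have pi0 := pi_gt0 R.
have th0 : 0 < th by rewrite divr_gt0 ?ltr0n ?mulr_gt0.
case: (posnP n) => [->|n0]; first by rewrite mul0r cos0 subrr mul0r.
apply: mulr_ge0; first by rewrite subr_ge0 cos_le1.
have n1 : th <= n%:R * th by rewrite ler_peMl ?(ltW th0) // ler1n.
have n2 : n%:R * th <= 2 * pi - th.
  rewrite lerBrDr [2 * pi]mulrC mulr_natr -mth -[X in _ + X]mul1r -mulrDl.
  by rewrite ler_pM2r // natr1 ler_nat.
have cos_le (x y : R) : 0 <= x -> x <= y -> y <= pi -> cos y <= cos x.
  move=> x0; rewrite le_eqVlt => /predU1P[-> //|xy] yp.
  by apply/ltW; rewrite ltr_cos // in_itv /=; apply/andP; split; lra.
rewrite subr_ge0; have [np|np] := leP (n%:R * th) pi.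
  by apply: cos_le => //; exact: ltW.
rewrite -[leLHS]cosN -cosD2pi -mulr_natr.
by apply: cos_le; lra.
Qed.

(* The weights (1 - cos (n th)) (cos th - cos (n th)) are nonnegative at every
   frequency n of the cyclic group and cancel n = 0, 1, -1. *)
Lemma posdef_second_diff :
  0 <= (2 * cos th + 1) * C 1 - 2 * (1 + cos th) * C (cos th) + C (cos (2 * th)).
Proof.
set c := cos th.
have : 0 <= \sum_(n < m) 2 * ((1 - cos (n%:R * th)) * (c - cos (n%:R * th))) *
    \sum_(k < m) C (cos (k%:R * th)) * cos (n%:R * (k%:R * th)).
  apply: sumr_ge0 => n _; apply: mulr_ge0; last exact: posdef_fourier.
  by apply: mulr_ge0 => //; exact: weight_ge0.
(* With b = n th and c = cos th, 2 (1 - cos b) (c - cos b) = (2c + 1) - 2 (1 + c) cos b + cos (2b);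
   each factor cos (j b) becomes half the sum of the shifts by j and -j. *)
have -> : \sum_(n < m) 2 * ((1 - cos (n%:R * th)) * (c - cos (n%:R * th))) *
    (\sum_(k < m) C (cos (k%:R * th)) * cos (n%:R * (k%:R * th))) =
  \sum_(k < m) ((2 * c + 1) * (C (cos (k%:R * th)) * D (k%:R + 0%:R))
    - (1 + c) * (C (cos (k%:R * th)) * D (k%:R + 1%:R))
    - (1 + c) * (C (cos (k%:R * th)) * D (k%:R - 1%:R))
    + 2^-1 * (C (cos (k%:R * th)) * D (k%:R + 2%:R))
    + 2^-1 * (C (cos (k%:R * th)) * D (k%:R - 2%:R))).
  under eq_bigr do rewrite mulr_sumr.
  rewrite exchange_big; apply: eq_bigr => k _ /=.
  rewrite /D !mulr_sumr -!sumrB -!big_split; apply: eq_bigr => n _ /=.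
  have -> : n%:R * ((k%:R + 0%:R) * th) = n%:R * (k%:R * th) by ring.
  have -> : n%:R * ((k%:R + 1%:R) * th) = n%:R * (k%:R * th) + n%:R * th by ring.
  have -> : n%:R * ((k%:R - 1%:R) * th) = n%:R * (k%:R * th) - n%:R * th by ring.
  have -> : n%:R * ((k%:R + 2%:R) * th) = n%:R * (k%:R * th) + n%:R * th *+ 2 by ring.
  have -> : n%:R * ((k%:R - 2%:R) * th) = n%:R * (k%:R * th) - n%:R * th *+ 2 by ring.
  move: (n%:R * (k%:R * th)) (n%:R * th) => a b.
  by rewrite (cosD a b) (cosB a b) (cosD a (b *+ 2)) (cosB a (b *+ 2)) cos_mulr2n; field.
rewrite !big_split /= -!mulr_sumr !sumrN -!mulr_sumr.
have [C0 _] := C_shift 0; have [C1 C1'] := C_shift 1; have [C2 C2'] := C_shift 2.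
rewrite C0 C1 C1' C2 C2' mul0r cos0 mul1r -/c => H.
have m0 : 0 < m%:R :> R by rewrite ltr0n.
rewrite -(pmulr_rge0 _ m0); move: H; congr (0 <= _); by field.
Qed.

End circle.

Section posdef_peano.
Context {R : realType}.
Variables (C : R -> R) (A E : R).
Hypothesis C_posdef : forall n (a th : 'I_n -> R),
  0 <= \sum_(k < n) \sum_(l < n) a k * a l * C (cos (th k - th l)).
Hypothesis C_peano : forall e, 0 < e -> exists2 del, 0 < del &
  forall x, 1 - del < x <= 1 ->
    `|C x - C 1 - A * (x - 1) - E / 2 * (x - 1) ^+ 2| <= e * (x - 1) ^+ 2.

Let th (n : nat) : R := 2 * pi / n.+1%:R.

Let th_cvg : th n @[n --> \oo] --> (0 : R).
Proof.
have K : 2 * pi * n.+1%:R^-1 @[n --> \oo] --> (2 * pi * 0 : R).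
  by apply: cvgM; [exact: cvg_cst|exact: cvg_harmonic].
by rewrite mulr0 in K.
Qed.

Let near_cos (s del : R) : 0 < del -> \forall n \near \oo, 1 - del < cos (s * th n) <= 1.
Proof.
move=> d0; have K : s * th n @[n --> \oo] --> s * 0.
  by apply: cvgM; [exact: cvg_cst|exact: th_cvg].
have : cos (s * th n) @[n --> \oo] --> cos (s * 0).
  by apply: continuous_cvg; [exact: continuous_cos|exact: K].
rewrite mulr0 cos0 => /cvgr_gt/(_ (1 - del)).
rewrite ltrBlDr ltrDl => /(_ d0); apply: filterS => n ->.
by rewrite cos_le1.
Qed.

Let cos_th_lt1 n : (1 <= n)%N -> cos (th n) < 1.
Proof.
move=> n1; have pi0 := pi_gt0 R; rewrite lt_neqAle cos_le1 andbT.
have t0 : 0 < th n by rewrite divr_gt0 // mulr_gt0.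
have tpi : th n <= pi.
  rewrite ler_pdivrMr // mulrC ler_pM2l //.
  by rewrite (ler_nat _ 2).
apply/eqP => c1; have : cos (th n) < cos 0.
  rewrite ltr_cos // in_itv /=; apply/andP; split; lra.
by rewrite c1 cos0 ltxx.
Qed.

(** A negative slope would make C x > C 1 for x slightly below 1, against [posdef_le]. The bound on
    1 - x lets the linear term dominate both quadratic ones. *)
Lemma peano_slope_ge0 : 0 <= A.
Proof.
rewrite leNgt; apply/negP => A0.
have [del del0 H] := C_peano ltr01.
have q0 : 0 < 1 + `|1 - E / 2| by rewrite ltr_pwDl.
have e0 : 0 < - A / (1 + `|1 - E / 2|) by rewrite divr_gt0 // oppr_gt0.
near \oo => n.
have n1 : (1 <= n)%N by near: n; exact: nbhs_infty_ge.
have x1 := cos_th_lt1 n1.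
have h1 : 1 - del < cos (1 * th n) <= 1 by near: n; exact: near_cos.
have h2 : 1 - - A / (1 + `|1 - E / 2|) < cos (1 * th n) <= 1 by near: n; exact: near_cos.
rewrite mul1r in h1 h2; move: (H _ h1) (posdef_le C_posdef (th n)) h2 x1.
move: (cos (th n)) => x + Cx /andP[h2 _] x1.
rewrite mul1r ler_norml => /andP[hx _].
have h3 : (1 - x) * (1 + `|1 - E / 2|) < - A by rewrite -ltr_pdivlMr //; lra.
have h4 := ler_norm (1 - E / 2).
have : 0 <= (1 - x) * (`|1 - E / 2| - (1 - E / 2)) by apply: mulr_ge0; lra.
have : 0 < (1 - x) * ((1 - x) * (1 + `|1 - E / 2|) * -1 - A) by apply: mulr_gt0; lra.
rewrite expr2 in hx; nra.
Unshelve. all: by end_near. Qed.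

(** In [posdef_second_diff], with y = 1 - cos th, the constant and the slope cancel and E y^2 (2 -
    y) (3 - 2y) remains, about 6 E y^2. With e = - E / 20 the remainders amount to at most (4 + 16)
    / 20 times |E| y^2, too little to compensate a negative E. *)
Lemma peano_curvature_ge0 : 0 <= E.
Proof.
rewrite leNgt; apply/negP => E0.
have e0 : 0 < - E / 20 by rewrite divr_gt0 // oppr_gt0.
have [del del0 H] := C_peano e0.
near \oo => n.
have n1 : (1 <= n)%N by near: n; exact: nbhs_infty_ge.
have x1 := cos_th_lt1 n1.
have h1 : 1 - del < cos (1 * th n) <= 1 by near: n; exact: near_cos.
have h2 : 1 - del < cos (2 * th n) <= 1 by near: n; exact: near_cos.
have h3 : 1 - 2^-1 < cos (1 * th n) <= 1 by near: n; apply: near_cos; rewrite invr_gt0.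
have := posdef_second_diff C_posdef (ltn0Sn n); rewrite -/(th n).
move: (H _ h1) (H _ h2) h3.
have -> : cos (2 * th n) = 1 + 2 * (cos (th n) - 1) * (cos (th n) + 1).
  by rewrite mulr_natl cos_mulr2n; ring.
rewrite mul1r; move: x1; move: (cos (th n)) => x x1.
move: (C x) (C 1) (C (1 + _ * _)) => Cx C1 C2.
rewrite !ler_norml => /andP[g1 g2] /andP[g3 g4] /andP[g5 _] g6.
have [y y0 xy] : exists2 y, 0 < y & x = 1 - y by exists (1 - x); lra.
have y1 : y < 2^-1 by lra.
have y2 : 0 < y ^+ 2 by rewrite exprn_gt0.
have K1 : 2 * (2 - y) * (A * - y + E / 2 * y ^+ 2 + E / 20 * y ^+ 2 - (Cx - C1)) <= 0.
  by apply: mulr_ge0_le0; [lra|move: g1; rewrite xy; lra].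
have K2 : C2 - C1 - A * (2 * - y * (2 - y)) - E / 2 * (2 * - y * (2 - y)) ^+ 2 <=
    - E / 20 * (2 * - y * (2 - y)) ^+ 2 by move: g4; rewrite xy; lra.
have K3 : 0 <= E * y ^+ 2 * ((2 - y) * (3 - 2 * y) - 2 * (2 - y) / 20 - 4 * (2 - y) ^+ 2 / 20).
  move: K1 K2 g6; rewrite xy; lra.
have K4 : 0 < (2 - y) * (3 - 2 * y) - 2 * (2 - y) / 20 - 4 * (2 - y) ^+ 2 / 20 by nra.
have : E * y ^+ 2 < 0 by rewrite nmulr_rlt0.
by rewrite (pmulr_lge0 _ K4) in K3; rewrite ltNge K3.
Unshelve. all: by end_near. Qed.

End posdef_peano.

(** * Covariances of the Hessian of the field *)

Lemma harmonic_neq0 (R : realType) n : (n.+1%:R^-1 : R) != 0.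
Proof. by rewrite invr_eq0 pnatr_eq0. Qed.

Section partial_ptclosure.
Context {T : Type} {R : realType} {N : nat}.
Variables (V : set (T -> R)) (F : 'rV[R]_N -> T -> R).
Hypotheses (V_lin : forall a b Z W, V Z -> V W -> V (fun w => a * Z w + b * W w))
  (VF : forall u, V (F u)) (F1 : forall w, C1_fun (F ^~ w)).

Lemma partial_ptclosure (i : 'I_N) u : ptclosure V (fun w => partial i (F ^~ w) u).
Proof.
pose h n : R := n.+1%:R^-1.
exists (fun n w => (h n)^-1 * F (u + h n *: delta_mx 0 i) w + - (h n)^-1 * F u w).
  by move=> n; exact: V_lin.
move=> w; have dF : is_derive (0 : R) (1 : R) (fun y => F (u + y *: delta_mx 0 i) w) (partial i (F ^~ w) u).
  have := @is_derive_line R N (F ^~ w) (delta_mx 0 i) u 0.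
  by rewrite scale0r addr0; apply; exact: (F1 w i).1.
have := (is_derive1_seqP _ _ _).1 dF h (@harmonic_neq0 R) (@cvg_harmonic R).
under eq_fun do rewrite add0r scale0r addr0 mulrBr -mulNr.
exact.
Qed.

End partial_ptclosure.

Section mixed_diff_theory.
Context {R : realType} {N : nat}.
Implicit Types (f g : 'rV[R]_N -> R) (i j : 'I_N).

Lemma mixed_diffE i j f g : (forall u, f u = g u) -> mixed_diff i j f = mixed_diff i j g.
Proof. by move=> fg; rewrite /mixed_diff !fg. Qed.

Lemma mixed_diffD i j f g :
  mixed_diff i j (fun u => f u + g u) = mixed_diff i j f + mixed_diff i j g.
Proof. by rewrite /mixed_diff; ring. Qed.

Lemma mixed_diffZ i j (a : R) f : mixed_diff i j (fun u => a * f u) = a * mixed_diff i j f.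
Proof. by rewrite /mixed_diff; ring. Qed.

Lemma mixed_diff_cst i j (a : R) : mixed_diff i j (fun=> a) = 0.
Proof. by rewrite /mixed_diff; ring. Qed.

Lemma cvg_mixed_diff i j (f : nat -> 'rV[R]_N -> R) g :
  (forall u, f n u @[n --> \oo] --> g u) ->
  mixed_diff i j (f n) @[n --> \oo] --> mixed_diff i j g.
Proof. by move=> fg; apply: cvgD => //; apply: cvgB => //; apply: cvgB. Qed.

Context {d : measure_display} {T : measurableType d} (P : probability T R).
Variables (V : set (T -> R)) (F : 'rV[R]_N -> T -> R).
Hypotheses (gV : gspace P V) (VF : forall u, V (F u)).

Let mixed_diff_comb i j : (fun w => mixed_diff i j (F ^~ w)) =
  (fun w => 1 * (fun w => 1 * F (delta_mx 0 i + delta_mx 0 j) w + -1 * F (delta_mx 0 i) w) w +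
            1 * (fun w => -1 * F (delta_mx 0 j) w + 1 * F 0 w) w).
Proof. by apply/funext => w; rewrite /mixed_diff; ring. Qed.

Lemma mixed_diff_gspace i j : V (fun w => mixed_diff i j (F ^~ w)).
Proof. by rewrite mixed_diff_comb; apply: gV.2; apply: gV.2. Qed.

Lemma cov_mixed_diffl i j U : V U ->
  cov P (fun w => mixed_diff i j (F ^~ w)) U = mixed_diff i j (fun u => cov P (F u) U).
Proof.
move=> VU; rewrite mixed_diff_comb.
rewrite (covDl gV) // ?(covDl gV) //; try exact: gV.2.
by rewrite /mixed_diff; ring.
Qed.

End mixed_diff_theory.

Section field.
Context {d : measure_display} {T : measurableType d} {R : realType} {N : nat}.
Variables (P : probability T R) (V : set (T -> R)) (Z : 'rV[R]_N.+1 -> T -> R) (C : R -> R).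
Hypotheses (gV : gspace P V) (VZ : forall s, sphere s -> V (Z s))
  (covZ : forall s u, sphere s -> sphere u -> cov P (Z s) (Z u) = C (dot s u))
  (ZC2 : forall w, C2_sphere (Z ^~ w)).
Variables (t : 'rV[R]_N.+1) (B : 'M[R]_(N, N.+1)).
Hypotheses (t1 : sphere t) (tB : tangent_basis t B).

Let G u w := Z (chart t B u) w.

Let VG u : V (G u). Proof. exact/VZ/sphere_chart. Qed.

Let GC2 w : C2_fun (G ^~ w). Proof. exact: ZC2. Qed.

Let covG u v : cov P (G u) (G v) =
  C ((1 + dot u v) / (Num.sqrt (1 + dot u u) * Num.sqrt (1 + dot v v))).
Proof. by rewrite covZ ?dot_chart //; exact: sphere_chart. Qed.

(** * Second order expansion and positivity along a great circle *)

Section geodesic.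
Variable i0 : 'I_N.

Let e : 'rV[R]_N := delta_mx 0 i0.
Let D1 u w := partial i0 (G ^~ w) u.
Let D2 u w := partial i0 (partial i0 (G ^~ w)) u.
Let V1 := ptclosure V.
Let V2 := ptclosure V1.
Let gV1 : gspace P V1 := ptclosure_gspace gV.
Let gV2 : gspace P V2 := ptclosure_gspace gV1.

Let V1D1 u : V1 (D1 u).
Proof. apply: partial_ptclosure => //; [exact: gV.2|by move=> w; exact: (GC2 w).1]. Qed.

Let V2D1 u : V2 (D1 u). Proof. exact: sub_ptclosure. Qed.

Let V2D2 u : V2 (D2 u).
Proof.
apply: (partial_ptclosure (F := D1)) => //; first exact: gV1.2.
by move=> w; exact: (GC2 w).2.
Qed.

Let q (x : R) := 1 + tan x ^+ 2.
(** In the central chart, x -> tan x e is the great circle through t at unit speed, so Y is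
    stationary for |x| < pi/2, with covariance C (cos (x - y)). *)
Let Y x := G (tan x *: e).
(** The null summand gives [Y1] the two-term form under which a [gspace] is closed. *)
Let Y1 x w := q x * D1 (tan x *: e) w + 0 * D1 0 w.
Let Y2 x w := q x ^+ 2 * D2 (tan x *: e) w + 2 * tan x * q x * D1 (tan x *: e) w.

Let V2Y x : V2 (Y x). Proof. by apply/sub_ptclosure/sub_ptclosure; exact: VG. Qed.
Let V2Y1 x : V2 (Y1 x). Proof. exact: gV2.2. Qed.
Let V2Y2 x : V2 (Y2 x). Proof. exact: gV2.2. Qed.

Let cos_gt0 (x : R) : `|x| < pi / 2 -> 0 < cos x.
Proof. by rewrite ltr_norml => /cos_gt0_pihalf. Qed.

Let dtan (x : R) : `|x| < pi / 2 -> is_derive x 1 tan (q x).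
Proof.
move=> /cos_gt0/lt0r_neq0 cx; rewrite /q -cos2_tan2 //; exact: is_derive_tan.
Qed.

Let dq (x : R) : `|x| < pi / 2 -> is_derive x 1 q (2 * tan x * q x).
Proof.
move=> /dtan dt.
have dtt : is_derive x 1 (fun y => tan y * tan y) (tan x * q x + tan x * q x).
  by apply: (is_derive1M_eq dt dt); ring.
rewrite (_ : q = fun y => 1 + tan y * tan y); last by apply/funext => y; rewrite /q expr2.
by have := is_deriveD (is_derive_cst (1 : R) x 1) dtt; rewrite add0r /q; congr is_derive; ring.
Qed.

Let dline (f : 'rV[R]_N -> R) (x : R) : C1_fun f -> `|x| < pi / 2 ->
  is_derive x 1 (fun y => f (tan y *: e)) (partial i0 f (tan x *: e) * q x).
Proof.
move=> f1 xr; have dl : is_derive (tan x) (1 : R) (fun y : R => f (y *: e)) (partial i0 f (tan x *: e)).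
  have := @is_derive_line R N f e 0 (tan x); rewrite add0r.
  rewrite (_ : (fun y : R => f (0 + y *: e)) = fun y => f (y *: e)).
    by apply; exact: (f1 i0).1.
  by apply/funext => y; rewrite add0r.
exact: (is_derive1_comp_eq dl (dtan xr)).
Qed.

Let dY (x : R) w : `|x| < pi / 2 -> is_derive x 1 (Y ^~ w) (Y1 x w).
Proof.
move=> xr; have := dline (GC2 w).1 xr.
by rewrite /Y1 mul0r addr0 mulrC.
Qed.

Let dY1 (x : R) w : `|x| < pi / 2 -> is_derive x 1 (Y1 ^~ w) (Y2 x w).
Proof.
move=> xr; have dd := dline ((GC2 w).2 i0) xr.
rewrite (_ : Y1 ^~ w = fun y => q y * D1 (tan y *: e) w); last first.
  by apply/funext => y; rewrite /Y1 mul0r addr0.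
by apply: (is_derive1M_eq (dq xr) dd); rewrite /Y2 /D2 /D1; ring.
Qed.

Let covY x y : `|x| < pi / 2 -> `|y| < pi / 2 -> cov P (Y x) (Y y) = C (cos (x - y)).
Proof.
move=> /cos_gt0 cx /cos_gt0 cy; rewrite covG; congr C.
rewrite !dotZl !dotZr dot_delta mxE !eqxx /= !mulr1.
have sqE (z : R) : 0 < cos z -> Num.sqrt (1 + tan z * tan z) = (cos z)^-1.
  move=> cz; rewrite -expr2 -cos2_tan2 ?gt_eqF // -exprVn sqrtr_sqr ger0_norm //.
  by rewrite invr_ge0 ltW.
rewrite !sqE // cosB /tan; field.
by rewrite !gt_eqF.
Qed.

Let pi2_gt0 : 0 < pi / 2 :> R. Proof. by rewrite divr_gt0 // pi_gt0. Qed.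

Lemma field_peano eps : 0 < eps -> exists2 del, 0 < del & forall x, 1 - del < x <= 1 ->
  `|C x - C 1 - derive_cov C 1 * (x - 1) - derive2_cov C 1 / 2 * (x - 1) ^+ 2|
    <= eps * (x - 1) ^+ 2.
Proof.
exact: (cov_peano pi2_gt0 (stationary_derive1 (c := C \o cos) gV2 pi2_gt0 V2Y V2Y1 dY covY)
  (stationary_derive2 gV2 V2Y V2Y1 V2Y2 dY1)
  (stationary_derive3 (c := C \o cos) gV2 pi2_gt0 V2Y V2Y1 V2Y2 dY dY1 covY)
  (stationary_derive4 gV2 pi2_gt0 V2Y1 V2Y2 dY1)).
Qed.

(** The curve [Y] stays in an open half-circle, whereas positive definiteness is used at all angles
    of the circle. *)
Let circle th := cos th *: t + sin th *: row i0 B.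

Let dot_circle x y : dot (circle x) (circle y) = cos (x - y).
Proof.
rewrite /circle dotDl !dotDr !dotZl !dotZr (dotC t (row _ _)) tB.1 tB.2 eqxx !mulr1.
by rewrite (t1 : dot t t = 1) cosB; ring.
Qed.

Lemma field_posdef n (a th : 'I_n -> R) :
  0 <= \sum_(k < n) \sum_(l < n) a k * a l * C (cos (th k - th l)).
Proof.
have sc x : sphere (circle x) by rewrite /sphere /= dot_circle subrr cos0.
have VW := gspace_sum gV (index_enum 'I_n) a (ex_intro _ _ (VZ t1)) (fun k => VZ (sc (th k))).
have := cov_ge0 gV VW; congr (0 <= _).
rewrite (cov_suml gV) //; last by move=> k; exact: VZ.
apply: eq_bigr => k _; rewrite covC (cov_suml gV) //; try by move=> *; exact: VZ.
rewrite mulr_sumr; apply: eq_bigr => l _.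
by rewrite covC covZ // dot_circle mulrA.
Qed.

Lemma derive_cov1_ge0 : 0 <= derive_cov C 1.
Proof. exact: peano_slope_ge0 field_posdef field_peano. Qed.

Lemma derive2_cov1_ge0 : 0 <= derive2_cov C 1.
Proof. exact: peano_curvature_ge0 field_posdef field_peano. Qed.

End geodesic.

(** * Covariances of the Hessian as limits of mixed differences *)

Let A := derive_cov C 1.
Let E := derive2_cov C 1.

Definition chart_hessian i j w := partial i (partial j (Z ^~ w \o chart t B)) 0.

Let V1 := ptclosure V.
Let gV1 : gspace P V1 := ptclosure_gspace gV.
Let h n : R := n.+1%:R^-1.
Let h0 n : h n != 0 := @harmonic_neq0 R n.
Let hc : h n @[n --> \oo] --> (0 : R) := @cvg_harmonic R.
Let z i j n w := (h n) ^- 2 * mixed_diff i j (fun u => G (h n *: u) w) + 0 * Z t w.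

Let Vz i j n : V (z i j n).
Proof.
apply: gV.2; last exact: VZ.
by apply: (mixed_diff_gspace (F := fun u => G (h n *: u)) gV).
Qed.

Let z_cvg i j w : z i j n w @[n --> \oo] --> chart_hessian i j w.
Proof.
rewrite (_ : z i j ^~ w = fun n => (h n) ^- 2 * (G (h n *: (delta_mx 0 i + delta_mx 0 j)) w -
  G (h n *: delta_mx 0 i) w - G (h n *: delta_mx 0 j) w + G 0 w)).
  exact: (@cvg_mixed_difference R N _ i j h (GC2 w) h0 hc).
by apply/funext => n; rewrite /z /mixed_diff mul0r addr0 scaler0.
Qed.

Lemma chart_hessian_ptclosure i j : ptclosure V (chart_hessian i j).
Proof. by exists (z i j) => [n|w]; [exact: Vz|exact: z_cvg]. Qed.

Let covGh n u v : cov P (G (h n *: u)) (G (h n *: v)) = C (chart_cos (h n) u v).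
Proof. by rewrite covG /chart_cos !dotZl !dotZr !mulrA -!expr2. Qed.

Let chart_cos_le1 (n : nat) (u v : 'rV[R]_N) : chart_cos (h n) u v <= 1.
Proof.
have -> : chart_cos (h n) u v = dot (chart t B (h n *: u)) (chart t B (h n *: v)).
  by rewrite dot_chart // /chart_cos !dotZl !dotZr !mulrA -!expr2.
have su := sphere_chart t1 tB (h n *: u); have sv := sphere_chart t1 tB (h n *: v).
move: (chart _ _ _) (chart _ _ _) su sv => s s' ss ss'.
have := dot_ge0 (s + (-1) *: s'); rewrite dotDl !dotDr !dotZl !dotZr (dotC s').
rewrite (ss : dot _ _ = 1) (ss' : dot _ _ = 1); lra.
Qed.

Hypothesis N0 : (0 < N)%N.
Let i0 := Ordinal N0.

(** The covariance with its orders 0 and h^2 removed, rescaled by h^4. *)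
Let Q n (u v : 'rV[R]_N) := (C (chart_cos (h n) u v) - C 1 - A * (h n ^+ 2 * lin_coef u v)) / (h n ^+ 2) ^+ 2.

Let Q_cvg u v : Q n u v @[n --> \oo] --> A * quad_coef u v + E / 2 * lin_coef u v ^+ 2.
Proof.
apply: cvg_chart_expansion => //; first exact: (field_peano i0).
Qed.

Let C_Q n u v : C (chart_cos (h n) u v) =
  C 1 + ((h n ^+ 2 * A) * lin_coef u v + (h n ^+ 2) ^+ 2 * Q n u v).
Proof. by rewrite /Q; field; exact: h0. Qed.

(** The covariance of two second differences is h^-4 times a double mixed difference of the
    covariance in the chart; the constant and the order h^2 are annihilated and exactly the double
    mixed difference of [Q] is left. *)
Lemma cov_hessian i j k l : cov P (chart_hessian i j) (chart_hessian k l) =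
  A * ((i == j)%:R * (k == l)%:R) +
  E * ((i == j)%:R * (k == l)%:R + (i == k)%:R * (j == l)%:R + (i == l)%:R * (j == k)%:R).
Proof.
have V1z i' j' n : V1 (z i' j' n) by apply: sub_ptclosure.
have H := cov_cvg gV1 (V1z i j) (V1z k l) (chart_hessian_ptclosure i j)
  (chart_hessian_ptclosure k l) (@z_cvg i j) (@z_cvg k l).
rewrite -mixed_diff2_quad_coef; apply: (cvg_unique (@Rhausdorff R) H).
have K : mixed_diff i j (fun u => mixed_diff k l (Q n u)) @[n --> \oo] -->
    mixed_diff i j (fun u => mixed_diff k l (fun v => A * quad_coef u v + E / 2 * lin_coef u v ^+ 2)).
  by apply: cvg_mixed_diff => u; apply: cvg_mixed_diff => v; exact: Q_cvg.
apply: cvg_trans K; apply: near_eq_cvg; near=> n.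
have Vm i' j' : V (fun w => mixed_diff i' j' (fun u => G (h n *: u) w)).
  exact: (mixed_diff_gspace (F := fun u => G (h n *: u)) gV).
rewrite /z (covDl gV) //; [|exact: VZ|exact: Vz].
rewrite mul0r addr0 covC (covDl gV) //; last exact: VZ.
rewrite mul0r addr0 covC (cov_mixed_diffl (F := fun u => G (h n *: u)) gV) //.
rewrite [in RHS](@mixed_diffE _ _ i j _ (fun u => (h n ^+ 2 * A) * mixed_diff k l (lin_coef u)
   + (h n ^+ 2) ^+ 2 * mixed_diff k l (Q n u))).
  rewrite [in RHS]mixed_diffD !mixed_diffZ mixed_diff2_lin_coef mulr0 add0r.
  by field; exact: h0.
move=> u; rewrite covC (cov_mixed_diffl (F := fun u => G (h n *: u)) gV) //.
rewrite (@mixed_diffE _ _ k l _ (fun v => C 1 + ((h n ^+ 2 * A) * lin_coef u v + (h n ^+ 2) ^+ 2 * Q n u v))).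
  by rewrite mixed_diffD mixed_diff_cst add0r mixed_diffD !mixed_diffZ.
by move=> v; rewrite covC covGh C_Q.
Unshelve. all: by end_near. Qed.

(** With a single second difference, against the center v = 0, the division is by h^2 only: the
    linear coefficient survives and [Q] enters with a factor h^2. *)
Lemma cov_hessian_field i j : cov P (chart_hessian i j) (Z t) = - (A * (i == j)%:R).
Proof.
have V1z n : V1 (z i j n) by apply: sub_ptclosure.
have V1Z : V1 (Z t) by apply: sub_ptclosure; exact: VZ.
have H : cov P (z i j n) (Z t) @[n --> \oo] --> cov P (chart_hessian i j) (Z t).
  apply: (cov_cvg gV1 V1z (fun=> V1Z) (chart_hessian_ptclosure i j) V1Z (@z_cvg i j)) => w.
  exact: cvg_cst.
apply: (cvg_unique (@Rhausdorff R) H).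
have ZG : Z t = G (h 0 *: 0).
  by rewrite /G scaler0 /chart mul0mx addr0 normalize_sphere.
have K : A * mixed_diff i j (fun u => lin_coef u 0) +
   (h n * h n) * mixed_diff i j (fun u => Q n u 0) @[n --> \oo] -->
   A * mixed_diff i j (fun u => lin_coef u 0) + 0 * 0 *
    mixed_diff i j (fun u => A * quad_coef u 0 + E / 2 * lin_coef u 0 ^+ 2).
  apply: cvgD; first exact: cvg_cst.
  apply: cvgM; first by apply: cvgM; exact: hc.
  by apply: cvg_mixed_diff => u; exact: Q_cvg.
rewrite mul0r mul0r addr0 mixed_diff_lin_coef mulrN in K.
apply: cvg_trans K; apply: near_eq_cvg; near=> n.
have Vm i' j' : V (fun w => mixed_diff i' j' (fun u => G (h n *: u) w)).
  exact: (mixed_diff_gspace (F := fun u => G (h n *: u)) gV).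
rewrite /z (covDl gV) //; try exact: VZ.
rewrite mul0r addr0 (cov_mixed_diffl (F := fun u => G (h n *: u)) gV) //; last exact: VZ.
rewrite [in RHS](@mixed_diffE _ _ i j _ (fun u => C 1 + ((h n ^+ 2 * A) * lin_coef u 0 + (h n ^+ 2) ^+ 2 * Q n u 0))).
  rewrite mixed_diffD mixed_diff_cst add0r mixed_diffD !mixed_diffZ mixed_diff_lin_coef.
  by field; exact: h0.
move=> u; rewrite -C_Q -covGh; congr (cov P _ _).
by rewrite /G scaler0 /chart mul0mx addr0 normalize_sphere.
Unshelve. all: by end_near. Qed.

End field.

(** * Gaussian laws of the Hessian and of GOI matrices *)

(** Half the squared Frobenius norm of a + a^T; [tr_form] is the trace of a. The variance of a
    linear form of any matrix considered here is a combination of [iso_form] and the square of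
    [tr_form]. *)
Definition iso_form (R : realType) (N : nat) (a : 'I_N * 'I_N -> R) : R :=
  \sum_p \sum_q a p * a q *
    ((p.1 == q.1)%:R * (p.2 == q.2)%:R + (p.1 == q.2)%:R * (p.2 == q.1)%:R).

Definition tr_form (R : realType) (N : nat) (a : 'I_N * 'I_N -> R) : R :=
  \sum_p a p * (p.1 == p.2)%:R.

Section linear_variance.
Context {d : measure_display} {T : measurableType d} {R : realType} {N : nat}.
Variables (P : probability T R) (V : set (T -> R)) (Z : 'I_N * 'I_N -> T -> R) (al be : R).
Hypotheses (gV : gspace P V) (VZ : forall p, V (Z p))
  (covZ : forall p q, cov P (Z p) (Z q) =
    al * ((p.1 == q.1)%:R * (p.2 == q.2)%:R + (p.1 == q.2)%:R * (p.2 == q.1)%:R) +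
    be * ((p.1 == p.2)%:R * (q.1 == q.2)%:R)).

Lemma cov_linear (a : 'I_N * 'I_N -> R) (Z0 : T -> R) : V Z0 ->
  cov P (fun w => \sum_p a p * Z p w) (fun w => \sum_p a p * Z p w) =
  al * iso_form a + be * tr_form a ^+ 2.
Proof.
move=> VZ0; have V0 : V !=set0 by exists Z0.
have VS := gspace_sum gV (index_enum _) a V0 VZ.
rewrite (cov_suml gV) // expr2 /iso_form /tr_form mulr_suml !mulr_sumr -big_split.
apply: eq_bigr => p _ /=; rewrite covC (cov_suml gV) //.
rewrite !mulr_sumr -big_split; apply: eq_bigr => q _ /=.
by rewrite covC covZ; ring.
Qed.

Lemma linear_cgauss (a : 'I_N * 'I_N -> R) (Z0 : T -> R) (ga de r : R) : V Z0 ->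
  cov P Z0 Z0 = ga -> (forall p, cov P (Z p) Z0 = de * (p.1 == p.2)%:R) ->
  cgauss P (fun w => \sum_p a p * Z p w + r * Z0 w)
    (al * iso_form a + be * tr_form a ^+ 2 + 2 * r * de * tr_form a + r ^+ 2 * ga).
Proof.
move=> VZ0 c0 cZ; have V0 : V !=set0 by exists Z0.
have VS := gspace_sum gV (index_enum _) a V0 VZ.
have SZ0 : cov P (fun w => \sum_p a p * Z p w) Z0 = de * tr_form a.
  rewrite (cov_suml gV) // /tr_form mulr_sumr; apply: eq_bigr => p _.
  by rewrite cZ mulrCA.
have V1 : V (fun w => 1 * (\sum_p a p * Z p w) + r * Z0 w) by exact: gV.2.
pose W w := 1 * (\sum_p a p * Z p w) + r * Z0 w.
have cW U : V U -> cov P W U = 1 * cov P (fun w => \sum_p a p * Z p w) U + r * cov P Z0 U.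
  by move=> VU; rewrite /W (covDl gV).
have := gspace_cgauss gV V1; rewrite -/W cW // !(covC P _ W) !cW //.
rewrite (cov_linear a VZ0) [cov P Z0 _]covC SZ0 c0.
rewrite (_ : W = (fun w => \sum_p a p * Z p w + r * Z0 w)).
  by congr cgauss; ring.
by apply/funext => w; rewrite /W mul1r.
Qed.

End linear_variance.

Lemma GOI_cgauss (d : measure_display) (T : measurableType d) (R : realType) (N : nat)
    (P : probability T R) (c : R) (M : T -> 'M[R]_N) (a : 'I_N * 'I_N -> R) : GOI P c M ->
  cgauss P (fun w => \sum_p a p * entry p (M w)) (2^-1 * iso_form a + c * tr_form a ^+ 2).
Proof.
move=> [_ gM M0 MM].
have gV := lspan_gspace gM (fun p _ => M0 p.1 p.2).
have VZ p : lspan setT (fun ij w => M w ij.1 ij.2) (fun w => entry p (M w)).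
  exact: (@sub_lspan _ T R _ setT (fun ij w => M w ij.1 ij.2) p Logic.I).
have VS : lspan setT (fun ij w => M w ij.1 ij.2) (fun w => \sum_p a p * entry p (M w)).
  apply: (gspace_sum gV) => //.
  (* The empty combination shows that the span is nonempty even when the matrix has no entry. *)
  exists (fun=> 0); exists 0%N, (fun i : 'I_0 => match notF (ltn_ord i) with end), (fun=> 0).
  by split=> [[]//|]; apply/funext => w; rewrite big_ord0.
have := gspace_cgauss gV VS.
rewrite (cov_linear (al := 2^-1) (be := c) gV VZ _ _ VS) // => p q.
by rewrite /cov ExE MM.
Qed.

Lemma GOI_measurable (d : measure_display) (T : measurableType d) (R : realType) (N : nat)
    (P : probability T R) (c : R) (M : T -> 'M[R]_N) p : GOI P c M ->
  measurable_fun setT (fun w => entry p (M w)).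
Proof.
move=> [_ gM M0 _]; have gV := lspan_gspace gM (fun p _ => M0 p.1 p.2).
by apply: (gspace_measurable gV); exact: (@sub_lspan _ T R _ setT (fun ij w => M w ij.1 ij.2) p Logic.I).
Qed.

Lemma C2_sphere0 (R : realType) (N : nat) : C2_sphere (fun _ : 'rV[R]_N.+1 => 0 : R).
Proof.
have C10 : C1_fun (fun _ : 'rV[R]_N => 0 : R).
  move=> i; split; first by move=> u; exact: derivable_cst.
  rewrite (_ : partial i _ = fun=> 0); first by move=> u; exact: cst_continuous.
  by apply/funext => u; exact: derive_cst.
move=> p B _ _; split; first exact: C10.
move=> i; rewrite (_ : partial i _ = fun=> 0); first exact: C10.
by apply/funext => u; exact: derive_cst.
Qed.

Section hessian_law.
Context {R : realType} {N : nat} {d : measure_display} {T : measurableType d}.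
Variables (N_ge1 : (1 <= N)%N) (P : probability T R) (C : R -> R) (X : 'rV[R]_N.+1 -> T -> R).
Hypotheses (X_gauss : isotropic_gaussian_field P C X)
  (X_C2 : {ae P, forall w, C2_sphere (X ^~ w)}).
Variables (t : 'rV[R]_N.+1) (E : 'I_N -> 'rV[R]_N.+1 -> 'rV[R]_N.+1).
Hypotheses (t_sphere : sphere t) (E_frame : normal_frame t E).
Let A := derive_cov C 1.
Let E2 := derive2_cov C 1.

Lemma unit_variance : C 1 = 1.
Proof.
have [_ X0 XV XX] := X_gauss.
have := XV t t_sphere; rewrite /variance unlock X0 //=.
have := XX t t t_sphere t_sphere; rewrite (t_sphere : dot t t = 1) => + H.
rewrite (_ : (fun w => _) = (fun w => (X t \- cst 0) w * (X t \- cst 0) w)); last first.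
  by apply/funext => w /=; rewrite subr0.
by rewrite H => -[].
Qed.

(* The sample paths are set to 0 on a null set, so that all of them are C^2. *)
Lemma hessian_gauss : [/\ 0 <= A, 0 <= E2 & exists2 Y : T -> 'M[R]_N,
  {ae P, forall w, sphere_hessian E (X ^~ w) t = Y w} /\
    (forall p, measurable_fun setT (fun w => entry p (Y w))) &
  forall (a : 'I_N * 'I_N -> R) r, cgauss P (fun w => \sum_p a p * entry p (Y w) + r * X t w)
    (E2 * iso_form a + (A + E2) * tr_form a ^+ 2 - 2 * r * A * tr_form a + r ^+ 2 * C 1)].
Proof.
have [gX X0 _ XX] := X_gauss.
have gL := lspan_gspace gX X0.
(* [S] is a measurable null set containing every outcome with an irregular path; the set of those
   outcomes itself may fail to be measurable. *)
have [S [mS PS0 badS]] := X_C2.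
pose f : T -> R := \1_(~` S).
have mf : measurable_fun setT f by apply: measurable_indic; exact: measurableC.
have fS w : ~ S w -> f w = 1 by move=> Sw; rewrite /f indicE mem_set.
have f1 : {ae P, forall w, f w = 1}.
  by exists S; split=> // w /= fw; apply: contrapT => /fS.
pose V := rescale f (lspan (@sphere R N.+1) X).
have gV : gspace P V := rescale_gspace mf f1 gL.
pose Z s w := f w * X s w.
have LX s : sphere s -> lspan (@sphere R N.+1) X (X s) by move=> ss; exact: sub_lspan.
have VZ s : sphere s -> V (Z s) by move=> ss; exists (X s) => //; exact: LX.
have covZ s u : sphere s -> sphere u -> cov P (Z s) (Z u) = C (dot s u).
  move=> ss su; rewrite (cov_rescale mf f1 gL (LX s ss) (LX u su)).
  by rewrite /cov ExE XX.
have ZX w : ~ S w -> Z ^~ w = X ^~ w.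
  by move=> Sw; apply/funext => s; rewrite /Z fS // mul1r.
have XC2 w : ~ S w -> C2_sphere (X ^~ w).
  by move=> Sw; apply: contrapT => h; exact/Sw/badS.
have ZC2 w : C2_sphere (Z ^~ w).
  have [Sw|Sw] := pselect (S w); last by rewrite ZX //; exact: XC2.
  rewrite (_ : Z ^~ w = fun=> 0); first exact: C2_sphere0.
  by apply/funext => s; rewrite /Z /f indicE memNset ?mul0r //= => /(_ Sw).
pose B : 'M[R]_(N, N.+1) := \matrix_(i, l) E i t 0 l.
have EB k : E k t = row k B by apply/rowP => l; rewrite !mxE.
have tB : tangent_basis t B.
  have [En _ _] := E_frame; have [h1 h2] := nbhs_singleton En t_sphere.
  by split=> [i|i j]; rewrite -!EB.
have A0 := derive_cov1_ge0 gV VZ covZ ZC2 t_sphere tB (Ordinal N_ge1).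
have E0 := derive2_cov1_ge0 gV VZ covZ ZC2 t_sphere tB (Ordinal N_ge1).
pose H (p : 'I_N * 'I_N) := chart_hessian Z t B p.1 p.2.
have gV1 := ptclosure_gspace gV.
have VH p : ptclosure V (H p) by exact: (chart_hessian_ptclosure gV VZ ZC2 t_sphere tB).
have VZt : ptclosure V (Z t) by apply: sub_ptclosure; exact: VZ.
split=> //; exists (fun w => \matrix_(i, j) H (i, j) w).
  split.
    exists S; split=> // w /= hw; apply: contrapT => Sw; apply: hw; apply/matrixP => i j.
    rewrite (hessian_chart t_sphere tB (XC2 w Sw) EB E_frame) mxE /H /chart_hessian /=.
    by rewrite ZX.
  move=> p; rewrite (_ : (fun w => _) = H p); first exact: (gspace_measurable gV1).
  by apply/funext => w; rewrite /entry mxE; case: p.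
move=> a r.
have covH p q : cov P (H p) (H q) =
    E2 * ((p.1 == q.1)%:R * (p.2 == q.2)%:R + (p.1 == q.2)%:R * (p.2 == q.1)%:R) +
    (A + E2) * ((p.1 == p.2)%:R * (q.1 == q.2)%:R).
  by rewrite (cov_hessian gV VZ covZ ZC2 t_sphere tB N_ge1) -/A -/E2; ring.
have covHZ p : cov P (H p) (Z t) = - A * (p.1 == p.2)%:R.
  by rewrite (cov_hessian_field gV VZ covZ ZC2 t_sphere tB N_ge1) mulNr.
have covZt : cov P (Z t) (Z t) = C 1 by rewrite covZ // (t_sphere : dot t t = 1).
have HG := linear_cgauss gV1 VH covH a r VZt covZt covHZ.
apply: (cgauss_ae (Z := fun w => \sum_p a p * H p w + r * Z t w)).
- rewrite (_ : _ - _ + _ = E2 * iso_form a + (A + E2) * tr_form a ^+ 2 +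
    2 * r * (- A) * tr_form a + r ^+ 2 * C 1); last by ring.
  exact: HG.
- apply: measurable_funD; last first.
    by apply: measurable_funM => //; exact: (gspace_measurable gL (LX t t_sphere)).
  apply: measurable_sum => p; apply: measurable_funM => //.
  rewrite (_ : (fun w => _) = H p); first exact: (gspace_measurable gV1).
  by apply/funext => w; rewrite /entry mxE; case: p.
- apply: filterS f1 => w fw; congr (_ + _); last by rewrite /Z fw mul1r.
  by apply: eq_bigr => p _; rewrite /entry mxE; case: p.
Qed.

End hessian_law.

(** * The conditional kernel *)

Lemma iso_formZ (R : realType) (N : nat) (s : R) (a : 'I_N * 'I_N -> R) :
  iso_form (fun p => s * a p) = s ^+ 2 * iso_form a.
Proof.
rewrite /iso_form mulr_sumr; apply: eq_bigr => p _.
by rewrite mulr_sumr; apply: eq_bigr => q _; ring.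
Qed.

Lemma tr_formZ (R : realType) (N : nat) (s : R) (a : 'I_N * 'I_N -> R) :
  tr_form (fun p => s * a p) = s * tr_form a.
Proof. by rewrite /tr_form mulr_sumr; apply: eq_bigr => p _; rewrite mulrA. Qed.

Lemma cgauss_cos (d : measure_display) (T : measurableType d) (R : realType)
    (P : probability T R) (Z : T -> R) v b : cgauss P Z v ->
  Ex P (fun w => cos (Z w + b)) = cos b * expR (- (v / 2)).
Proof.
move=> [_ _ /(_ 1 b)]; rewrite expr1n mulr1 => <-.
by apply: eq_Ex => w; rewrite mul1r.
Qed.

Lemma continuous_borel_mx (R : realType) (N : nat) (f : 'M[R]_N -> R) :
  continuous f -> measurable_fun [set: borel_mx R N] (f : borel_mx R N -> R).
Proof.
move=> /continuousP cf.
have mG : (@measurable _ R) = <<s @RGenOInfty.G R >> := RGenOInfty.measurableE R.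
apply: (measurability _ mG) => _ [_ [r ->] <-]; rewrite setTI.
apply: sub_sigma_algebra; apply: cf.
by rewrite set_itvE; exact: open_gt.
Qed.

Section conditional_law.
Context {R : realType} {N : nat} {d : measure_display} {T : measurableType d}.
Variables (P : probability T R) (M : T -> 'M[R]_N) (s k : R).
Hypothesis mM : forall p, measurable_fun setT (fun w => entry p (M w)).

(** The regression model at X(t) = z: the mean - s k z times the identity plus the noise s M. *)
Definition shifted_mx (zw : R * T) : borel_mx R N := s *: (M zw.2 - (k * zw.1)%:M).

Lemma measurable_shifted_mx : measurable_fun setT shifted_mx.
Proof.
apply: (@measurable_mx R N _ _ shifted_mx) => p.
rewrite (_ : (fun w => _) = fun w => s * (entry p (M w.2) - k * (p.1 == p.2)%:R * w.1)).
  apply: measurable_funM => //; apply: measurable_funB.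
    exact: (measurableT_comp (mM p)).
  by apply: measurable_funM.
by apply/funext => w; rewrite /entry /shifted_mx !mxE -mulr_natr; ring.
Qed.

Definition shifted_kernel : R.-pker R ~> borel_mx R N :=
  random_kernel P measurable_shifted_mx.

(** For each fixed outcome the shifted matrix is continuous in z, so bounded convergence applies
    along sequences. *)
Lemma weakly_continuous_shifted : weakly_continuous shifted_kernel.
Proof.
move=> f cf [b fb].
have mf := continuous_borel_mx cf.
have mphi z : measurable_fun setT (fun w => shifted_mx (z, w)).
  by apply: (measurableT_comp measurable_shifted_mx); exact: measurable_pair1.
have mfphi z : measurable_fun setT (fun w => f (shifted_mx (z, w))).
  exact: (measurableT_comp mf (mphi z)).
rewrite (_ : (fun z => _) = fun z => Ex P (fun w => f (shifted_mx (z, w)))); last first.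
  apply/funext => z; rewrite /Ex /Rintegral; congr fine.
  rewrite (@integral_pushforward _ _ _ _ _ _ (mphi z) P setT (EFin \o f)) //.
  - exact/measurable_EFinP.
  - by apply: (@bounded_integrable _ _ _ P _ b) => // w; exact: fb.
pose g z := Ex P (fun w => f (shifted_mx (z, w))).
move=> z; apply: (proj2 (@cvg_nbhsP R R^o g z (g z))) => u uz.
apply: (@cvg_Ex _ _ _ P (fun n w => f (shifted_mx (u n, w))) _ b) => //.
move=> w; apply: continuous_cvg; first exact: cf.
rewrite /shifted_mx /=; apply: cvgZr; apply: cvgB; first exact: cvg_cst.
rewrite -scalemx1; under eq_fun do rewrite -scalemx1.
by apply: cvgZl; apply: cvgM => //; exact: cvg_cst.
Qed.

End conditional_law.

(** * Identification of the unconditional and conditional laws *)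

Unset Implicit Arguments.
Set Strict Implicit.

Theorem lemma4p3 (R : realType) (N : nat) (N_ge1 : (1 <= N)%N)
    (d : measure_display) (T : measurableType d) (P : probability T R)
    (C : R -> R) (X : 'rV[R]_N.+1 -> T -> R)
    (X_gauss : isotropic_gaussian_field P C X)
    (X_smooth : smooth_field P X)
    (C' C'' eta kappa : R)
    (C'_def : C' = derive_cov C 1)
    (C''_def : C'' = derive2_cov C 1)
    (C_neq0 : C' * C'' != 0)
    (eta_def : eta = Num.sqrt C' / Num.sqrt C'')
    (kappa_def : kappa = C' / Num.sqrt C'')
    (d1 : measure_display) (T1 : measurableType d1) (P1 : probability T1 R)
    (Mt : T1 -> 'M[R]_N) (Mt_GOI : GOI P1 ((1 + eta ^+ 2) / 2) Mt)
    (d2 : measure_display) (T2 : measurableType d2) (P2 : probability T2 R)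
    (M : T2 -> 'M[R]_N)
    (M_GOI : GOI P2 ((1 + eta ^+ 2 - kappa ^+ 2) / 2) M)
    (t : 'rV[R]_N.+1) (t_sphere : sphere t)
    (E : 'I_N -> 'rV[R]_N.+1 -> 'rV[R]_N.+1) (E_frame : normal_frame t E)
    (x : R) :
  let hess := fun w => sphere_hessian E (X ^~ w) t in
  has_law P hess
    (fun A => P1 ((fun w => Num.sqrt (2 * C'') *: Mt w) @^-1` A))
  /\
  has_cond_law P hess (X t) x
    (fun A => P2 ((fun w =>
       Num.sqrt (2 * C'') *: (M w - (kappa * x / Num.sqrt 2)%:M)) @^-1` A)).
Proof.
move=> hess; have [X_C2 _] := X_smooth.
have [A0 E0 [Y [hessY mY] YG]] := hessian_gauss N_ge1 X_gauss X_C2 t_sphere E_frame.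
have C1 := unit_variance X_gauss t_sphere.
rewrite -C'_def in A0 YG; rewrite -C''_def in E0 YG; rewrite C1 in YG.
(* Nonnegative and nonzero, hence positive; this is what makes the squares of the roots in eta and
   kappa equal to the expected quotients. *)
have Ap : 0 < C' by rewrite lt_neqAle eq_sym A0 andbT; move: C_neq0; rewrite mulf_eq0 negb_or => /andP[].
have Ep : 0 < C'' by rewrite lt_neqAle eq_sym E0 andbT; move: C_neq0; rewrite mulf_eq0 negb_or => /andP[].
have sE : Num.sqrt C'' ^+ 2 = C'' by rewrite sqr_sqrtr.
have rE : Num.sqrt C'' != 0 by rewrite gt_eqF // sqrtr_gt0.
have eta2 : eta ^+ 2 = C' / C'' by rewrite eta_def expr_div_n !sqr_sqrtr.
have kappa2 : kappa ^+ 2 = C' ^+ 2 / C'' by rewrite kappa_def expr_div_n sE.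
set s := Num.sqrt (2 * C'').
have s2 : s ^+ 2 = 2 * C'' by rewrite sqr_sqrtr // mulr_ge0.
(* The regression coefficient of the Hessian on X(t) is - C' times the identity, since X(t) has unit
   variance. *)
have sk : s * (kappa / Num.sqrt 2) = C'.
  rewrite /s kappa_def sqrtrM // -[RHS]mulr1; field.
  by rewrite rE gt_eqF // sqrtr_gt0.
have mX : measurable_fun setT (X t).
  have [gX X0 _ _] := X_gauss.
  by apply: (gspace_measurable (lspan_gspace gX X0)); exact: sub_lspan.
have verY : version P hess Y by split=> //; exact: measurable_mx.
split.
- exists Y => // A mA.
  have mMt p : measurable_fun setT (fun w => entry p (Mt w)) by exact: GOI_measurable Mt_GOI.
  have msMt p : measurable_fun setT (fun w => entry p (s *: Mt w)).
    rewrite (_ : (fun w => _) = fun w => s * entry p (Mt w)); first exact: measurable_funM.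
    by apply/funext => w; rewrite /entry mxE.
  (* The unconditional law is the case of a null scalar and [B] the whole line. *)
  have := @joint_law _ _ _ _ R N P P1 Y (cst 0) (fun w => s *: Mt w) (cst 0) mY _ msMt _ _ A setT mA measurableT.
  rewrite !preimage_setT !setIT; apply=> //; try exact: measurable_cst.
  move=> a r b.
  transitivity (Ex P (fun w => cos (\sum_ij a ij * entry ij (Y w) + 0 * X t w + b))).
    by apply: eq_Ex => w; rewrite /= mulr0 mul0r.
  rewrite (cgauss_cos _ (YG a 0)).
  transitivity (Ex P1 (fun w => cos (\sum_ij s * a ij * entry ij (Mt w) + b))); last first.
    apply: eq_Ex => w; rewrite /= mulr0 addr0; congr (cos (_ + _)).
    by apply: eq_bigr => p _; rewrite /entry mxE; ring.
  rewrite (cgauss_cos _ (GOI_cgauss (fun p => s * a p) Mt_GOI)) iso_formZ tr_formZ exprMn s2 eta2.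
  congr (_ * expR (- (_ / 2))); field; exact: lt0r_neq0.
pose k := kappa / Num.sqrt 2.
have mM p : measurable_fun setT (fun w => entry p (M w)) by exact: GOI_measurable M_GOI.
exists (shifted_kernel P2 s k mM); split.
- exists Y => // A B mA mB.
  have mS := measurable_shifted_mx s k mM.
  rewrite -(random_kernel_prod P2 mS P mX mA mB).
  (* Model of the Hessian on the product space, driven by the actual X(t) and an independent M; the
     pair (S, X(t)) has to have the joint law of (Y, X(t)). *)
  pose S (w : T * T2) := shifted_mx M s k (X t w.1, w.2).
  have mS' p : measurable_fun setT (fun w => entry p (S w)).
    rewrite (_ : (fun w => _) = fun w => s * (entry p (M w.2) - k * (p.1 == p.2)%:R * X t w.1)).
      apply: measurable_funM => //; apply: measurable_funB.
        exact: (measurableT_comp (mM p)).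
      by apply: measurable_funM => //; exact: (measurableT_comp mX).
    by apply/funext => w; rewrite /entry /S /shifted_mx !mxE -mulr_natr /=; ring.
  have mX1 : measurable_fun setT (fun w : T * T2 => X t w.1) by exact: (measurableT_comp mX).
  apply: (@joint_law _ _ _ _ R N P (P \x P2)%E Y (X t) S (fun w => X t w.1) mY mX mS' mX1 _ A B mA mB).
  move=> a r b; rewrite (cgauss_cos _ (YG a r)).
  (* Total coefficient of X(t) in the linear form: r from the scalar and - C' tr a from the
     shift. *)
  have XG : cgauss P (fun w => (r - C' * tr_form a) * X t w) ((r - C' * tr_form a) ^+ 2).
    have [gX X0 _ XX] := X_gauss.
    have gV := lspan_gspace gX X0.
    have VX : lspan (@sphere R N.+1) X (X t) by exact: sub_lspan.
    have V1 := gV.2 (r - C' * tr_form a) 0 _ _ VX VX.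
    have := gspace_cgauss gV V1; rewrite (covDl gV) // covC (covDl gV) //.
    rewrite {1}/cov ExE XX // (t_sphere : dot t t = 1) C1 !mul0r !addr0 mulr1 -expr2.
    by congr cgauss; apply/funext => w; rewrite mul0r addr0.
  have MG := GOI_cgauss (fun p => s * a p) M_GOI.
  transitivity (Ex (P \x P2)%E (fun w => cos ((r - C' * tr_form a) * X t w.1 +
      \sum_p s * a p * entry p (M w.2) + b))); last first.
    apply: eq_Ex => w; congr (cos (_ + _)).
    have -> : \sum_p a p * entry p (S w) =
        \sum_p s * a p * entry p (M w.2) - C' * tr_form a * X t w.1.
      rewrite -sk -/k /tr_form mulr_sumr mulr_suml -sumrB; apply: eq_bigr => p _.
      by rewrite /entry /S /shifted_mx !mxE -mulr_natr /=; ring.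
    by ring.
  rewrite (cgauss_cos _ (cgauss_prod XG MG)) iso_formZ tr_formZ exprMn s2 eta2 kappa2.
  (* The square (r - C' tr a)^2 brings C'^2 (tr a)^2, which the - kappa^2 in the parameter of M
     takes away, s^2 kappa^2 / 2 being C'^2. *)
  congr (_ * expR (- (_ / 2))); field; exact: lt0r_neq0.
- exact: weakly_continuous_shifted.
- move=> A mA /=; rewrite /shifted_kernel /= /random_kernel /push /= /pushforward.
  congr (P2 _); apply/seteqP; split=> w; rewrite /= /shifted_mx /= /k (_ : kappa / Num.sqrt 2 * x = kappa * x / Num.sqrt 2) //; ring.
Qed.
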